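(* Let $p>2$. Given $\ell,\lambda>0$, there exists a unique action ground state on $\mathcal{G}_\ell$ (for the parameter $\lambda$), and it is a type $\mathcal{A}$ solution. In particular, every (positive) energy ground state on $\mathcal{G}_\ell$ is an action ground state for the associated Lagrange multiplier $\lambda$.
   Context: The $\mathcal{T}$-graph $\mathcal{G}_\ell$ ($\ell>0$) is the metric graph made of two half-lines $e_1,e_2$, identified with $I_1=I_2=[0,\infty)$, and a terminal edge $e_3$, identified with $I_3=[0,\ell]$, all glued at the vertex $\mathbf{0}$ (coordinate $0$ on each edge); the other end of $e_3$ has coordinate $\ell$. A function on $\mathcal{G}_\ell$ is a triple $u=(u_1,u_2,u_3)$, $u_i:I_i\to\mathbb{R}$; $u\in H^1(\mathcal{G}_\ell)$ means $u_i\in H^1(I_i)$ and $u_1(0)=u_2(0)=u_3(0)$. A solution of $-u''+\lambda u=|u|^{p-2}u$ on $\mathcal{G}_\ell$ is $u\in H^1(\mathcal{G}_\ell)$ satisfying the equation on each edge and the Neumann–Kirchhoff conditions $u_1'(0)+u_2'(0)+u_3'(0)=0$, $u_3'(\ell)=0$. A positive solution is of type $\mathcal{A}$ if $u_1=u_2$ and these are strictly decreasing on $[0,\infty)$. Action: $S_\lambda(u,\mathcal{G}_\ell)=\frac12\int_{\mathcal{G}_\ell}(|u'|^2+\lambda u^2)\,dx-\frac1p\int_{\mathcal{G}_\ell}|u|^p\,dx$; least action level: $\mathcal{S}_{\mathcal{G}_\ell}(\lambda)=\inf\{S_\lambda(u,\mathcal{G}_\ell): u\in H^1(\mathcal{G}_\ell)\setminus\{0\}\text{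 solution of }-u''+\lambda u=|u|^{p-2}u\}$. An action ground state (for $\lambda$) is a positive solution $u$ with $S_\lambda(u,\mathcal{G}_\ell)=\mathcal{S}_{\mathcal{G}_\ell}(\lambda)$. Energy: $E(u,\mathcal{G}_\ell)=\frac12\int_{\mathcal{G}_\ell}|u'|^2dx-\frac1p\int_{\mathcal{G}_\ell}|u|^p\,dx$. For $\nu>0$, an energy ground state of mass $\nu$ is a minimizer of $E(\cdot,\mathcal{G}_\ell)$ over $\{u\in H^1(\mathcal{G}_\ell):\int_{\mathcal{G}_\ell}|u|^2dx=\nu\}$; it solves $-u''+\lambda u=|u|^{p-2}u$ on $\mathcal{G}_\ell$ for some $\lambda$, called the associated Lagrange multiplier. *)

(* Defs.v *)
From HB Require Import structures.
From mathcomp Require Import all_boot all_order all_algebra.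
From mathcomp Require Import all_classical all_reals all_analysis.

Set Implicit Arguments.
Unset Strict Implicit.
Unset Printing Implicit Defensive.

Import Order.TTheory GRing.Theory Num.Theory.
Import numFieldNormedType.Exports.

Local Open Scope classical_set_scope.
Local Open Scope ring_scope.

(* Throughout, a function on an interval [I] with left end 0 is a total
   function [R -> R] of which only the values on [I] matter. *)

Definition L2 (R : realType) (I : set R) (f : R -> R) : Prop :=
  (f \_ I) \in Lfun (@lebesgue_measure R) 2%:E.

(* [g] is the derivative of [u] in H^1(I), for the (absolutely) continuous
   representative [u]; on an interval [I] containing 0 this determines [g]
   almost everywhere on [I]. *)
Definition is_weak_derivative (R : realType) (I : set R) (u g : R -> R) : Prop :=
  L2 I g /\
  forall x, I x ->
    u x = u 0 + \int[@lebesgue_measure R]_(t in `[0, x]) g t.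

(* Elements of H^1(I) are given by their continuous representatives, so that
   point values such as [u 0] are meaningful. *)
Definition H1 (R : realType) (I : set R) (u : R -> R) : Prop :=
  L2 I u /\ exists g, is_weak_derivative I u g.

(* Well defined up to a null subset of [I] when [H1 I u]; only used under an
   integral over [I]. *)
Definition weak_derivative (R : realType) (I : set R) (u : R -> R) : R -> R :=
  xget (fun=> 0) [set g | is_weak_derivative I u g].

(* Classical derivative on [I]: the difference quotients converge along points
   of [I], hence the derivative is one-sided at an end of [I] lying in [I]. *)
Definition is_derivative_on (R : realType) (I : set R) (f df : R -> R) : Prop :=
  forall x, I x ->
    (fun y => (f y - f x) / (y - x)) @ within I x^' --> df x.

(* [e1] and [e2] are the half-lines, [e3] is the terminal edge. *)
Record gfun (R : realType) := GFun { e1 : R -> R; e2 : R -> R; e3 : R -> R }.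

Definition half_line (R : realType) : set R := `[0, +oo[.
Definition terminal_edge (R : realType) (ell : R) : set R := `[0, ell].

Section TGraph.
Context (R : realType) (ell : R).
Implicit Types (u v du : gfun R) (p lam nu : R).

Local Notation mu := (@lebesgue_measure R).
Local Notation I12 := (@half_line R).
Local Notation I3 := (terminal_edge ell).

Definition eq_on_graph u v : Prop :=
  [/\ {in I12, e1 u =1 e1 v}, {in I12, e2 u =1 e2 v} & {in I3, e3 u =1 e3 v}].

Definition gzero : gfun R := GFun (fun=> 0) (fun=> 0) (fun=> 0).

Definition positive_on_graph u : Prop :=
  [/\ forall x, I12 x -> 0 < e1 u x, forall x, I12 x -> 0 < e2 u x
    & forall x, I3 x -> 0 < e3 u x].

Definition H1_graph u : Prop :=
  [/\ H1 I12 (e1 u), H1 I12 (e2 u), H1 I3 (e3 u), e1 u 0 = e2 u 0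
    & e2 u 0 = e3 u 0].

Definition gderivative u : gfun R :=
  GFun (weak_derivative I12 (e1 u)) (weak_derivative I12 (e2 u))
       (weak_derivative I3 (e3 u)).

Definition gintegral (F : R -> R) u : R :=
  \int[mu]_(x in I12) F (e1 u x) + \int[mu]_(x in I12) F (e2 u x)
  + \int[mu]_(x in I3) F (e3 u x).

Definition mass u : R := gintegral (fun y => `|y| ^+ 2) u.

Definition energy p u : R :=
  2^-1 * gintegral (fun y => `|y| ^+ 2) (gderivative u)
  - p^-1 * gintegral (fun y => `|y| `^ p) u.

Definition action p lam u : R :=
  2^-1 * (gintegral (fun y => `|y| ^+ 2) (gderivative u)
          + lam * gintegral (fun y => y ^+ 2) u)
  - p^-1 * gintegral (fun y => `|y| `^ p) u.

Definition solves_on p lam (I : set R) (f df : R -> R) : Prop :=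
  is_derivative_on I f df /\
  exists2 ddf, is_derivative_on I df ddf &
    forall x, I x -> - ddf x + lam * f x = `|f x| `^ (p - 2) * f x.

Definition solution p lam u : Prop :=
  H1_graph u /\
  exists du,
    [/\ solves_on p lam I12 (e1 u) (e1 du),
        solves_on p lam I12 (e2 u) (e2 du),
        solves_on p lam I3 (e3 u) (e3 du),
        e1 du 0 + e2 du 0 + e3 du 0 = 0
      & e3 du ell = 0].

Definition type_A p lam u : Prop :=
  [/\ solution p lam u, positive_on_graph u, {in I12, e1 u =1 e2 u}
    & {in I12 &, forall x y, x < y -> e1 u y < e1 u x}].

Definition least_action_level p lam : \bar R :=
  ereal_inf [set (action p lam u)%:E | u in
    [set u | solution p lam u /\ ~ eq_on_graph u gzero]].

Definition action_ground_state p lam u : Prop :=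
  [/\ solution p lam u, positive_on_graph u
    & (action p lam u)%:E = least_action_level p lam].

Definition energy_ground_state p nu u : Prop :=
  [/\ H1_graph u, mass u = nu
    & forall v, H1_graph v -> mass v = nu -> energy p u <= energy p v].

End TGraph.

(* Main.v *)
(* Write H(y) = lam y^2/2 - |y|^p/p. On a half-line u'^2 = 2 H(u), so each u_i is a
   piece of a soliton, whose action is expressed by a primitive Phi of sqrt(2 H):
   the full soliton of height M (the positive zero of H) has action 2 Phi(M). If a
   half-line piece is not decreasing, or the terminal edge has a second critical
   point, the action is at least 2 Phi(M); otherwise u is, up to sign, of type A,
   and then a monotone quantity along the terminal edge shows that its action is
   below 2 Phi(M). The type A solution is unique, by Sturm comparison when the
   energies of two of them are ordered as their values at the vertex, and by
   comparing phases in the potential well otherwise; it exists because the time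
   map giving the length of the terminal edge takes every value in (0, oo). Hence
   it is the ground state.

   An energy ground state u of mass nu satisfies the Euler-Lagrange equation
   because its energy is minimal along renormalized perturbations. Any solution v
   lies on its Nehari manifold, so rescaling v to mass nu decreases its action,
   while E + lam nu/2 is minimal at u; thus the action of u is least. *)
Require Import Defs.
From HB Require Import structures.
From mathcomp Require Import all_boot all_order all_algebra.
From mathcomp Require Import all_classical all_reals all_analysis.
From mathcomp Require Import measurable_realfun.
From mathcomp Require Import ring lra.

Set Implicit Arguments.
Unset Strict Implicit.
Unset Printing Implicit Defensive.

Import Order.TTheory GRing.Theory Num.Theory.
Import numFieldNormedType.Exports.

Local Open Scope classical_set_scope.
Local Open Scope ring_scope.

(** * Calculus and the nonlinearity *)

Section Calculus.
Context {R : realType}.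
Implicit Types (f g df dg : R -> R) (a b x : R).

(** All constants originate at the vertex. On the type A branch both half-lines leave it with slope
    minus sqrt(2h), h being the potential there, so Kirchhoff gives the terminal edge the slope 2
    sqrt(2h). Along that edge the conserved quantity is then 3h instead of 0: u'^2 = 2 H(u) + 6h,
    and the Neumann end sits where H = -3h, above the height M of the soliton. There H is negative,
    so the primitive Phi no longer measures the action; this is why the upper bound by 2 Phi(M)
    needs an auxiliary function on the last part of the edge. By the Nehari identity the action of a
    solution is (1/2 - 1/p) times the integral of |u|^p, a sum of nonnegative edge contributions.
    The edges can therefore be estimated one by one; the terms u u' / 2 that appear at the vertex
    cancel by Kirchhoff. The vertex value may lie on either side of the maximum point W of H, so two
    type A solutions may have their values and their energies ordered in opposite ways. This is what
    splits the uniqueness proof in two, in place of a monotonicity statement for the length of the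
    edge as a function of the vertex value. *)

Lemma deriv_const (c x : R) : is_derive x 1 (fun _ : R => c) 0.
Proof. exact: is_derive_cst. Qed.

Lemma deriv_id (x : R) : is_derive x 1 (fun t : R => t) 1.
Proof. exact: is_derive_id. Qed.

Lemma deriv_add f g x a b : is_derive x 1 f a -> is_derive x 1 g b ->
  is_derive x 1 (fun t => f t + g t) (a + b).
Proof. by move=> fa gb; exact: is_deriveD. Qed.

Lemma deriv_opp f x a : is_derive x 1 f a ->
  is_derive x 1 (fun t => - f t) (- a).
Proof. by move=> fa; exact: is_deriveN. Qed.

Lemma deriv_sub f g x a b : is_derive x 1 f a -> is_derive x 1 g b ->
  is_derive x 1 (fun t => f t - g t) (a - b).
Proof. by move=> fa gb; exact: is_deriveB. Qed.

Lemma deriv_mul f g x a b : is_derive x 1 f a -> is_derive x 1 g b ->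
  is_derive x 1 (fun t => f t * g t) (a * g x + f x * b).
Proof.
move=> fa gb; have := is_deriveM fa gb.
by move/is_derive_eq; apply; rewrite addrC [a * _]mulrC.
Qed.

Lemma deriv_scale f x a c : is_derive x 1 f a ->
  is_derive x 1 (fun t => c * f t) (c * a).
Proof. by move=> fa; exact: (is_deriveZ c fa). Qed.

Lemma deriv_sqr f x a : is_derive x 1 f a ->
  is_derive x 1 (fun t => f t ^+ 2) (2 * f x * a).
Proof.
move=> fa; have := deriv_mul fa fa.
by move/is_derive_eq; apply; ring.
Qed.

Lemma deriv_comp f g x a b : is_derive (g x) 1 f a -> is_derive x 1 g b ->
  is_derive x 1 (fun t => f (g t)) (a * b).
Proof. by move=> fa gb; exact: is_derive1_comp. Qed.

Lemma deriv_inv f x a : f x != 0 -> is_derive x 1 f a ->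
  is_derive x 1 (fun t => (f t)^-1) (- a / f x ^+ 2).
Proof.
move=> f0 fa; have := is_deriveV f0 fa.
by move/is_derive_eq; apply; rewrite -[LHS]/(_ * _) mulNr mulNr mulrC.
Qed.

Lemma deriv_div f g x a b : g x != 0 ->
  is_derive x 1 f a -> is_derive x 1 g b ->
  is_derive x 1 (fun t => f t / g t) ((a * g x - f x * b) / g x ^+ 2).
Proof.
move=> g0 fa gb; have := deriv_mul fa (deriv_inv g0 gb).
by move/is_derive_eq; apply; field.
Qed.

Lemma deriv_sqrt f x a : 0 < f x -> is_derive x 1 f a ->
  is_derive x 1 (fun t => Num.sqrt (f t)) (a / (2 * Num.sqrt (f x))).
Proof.
move=> f0 fa; have := deriv_comp (is_derive1_sqrt f0) fa.
by move/is_derive_eq; apply; rewrite mulrC.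
Qed.

Lemma deriv_reflect f x a c : is_derive (c - x) 1 f a ->
  is_derive x 1 (fun t => f (c - t)) (- a).
Proof.
move=> fa; have := @deriv_comp f (fun t => c - t) _ _ _ fa (deriv_sub (deriv_const c x) (deriv_id x)).
by move/is_derive_eq; apply; rewrite sub0r mulrN1.
Qed.

Lemma deriv_continuous f x a : is_derive x 1 f a -> {for x, continuous f}.
Proof.
by move=> [df _]; exact/differentiable_continuous/derivable1_diffP.
Qed.

Lemma near_eq_deriv f g x a : (\forall t \near x, f t = g t) ->
  is_derive x 1 f a -> is_derive x 1 g a.
Proof. by move=> fg fa; exact: near_eq_is_derive fg fa. Qed.

Lemma continuous_on_within f a b :
  (forall x, a <= x <= b -> {for x, continuous f}) ->
  {within `[a, b], continuous f}.
Proof.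
move=> cf; apply: continuous_in_subspaceT => x.
by rewrite inE/= in_itv/= => /cf.
Qed.

Lemma mean_value f df a b : a < b ->
  (forall x, a <= x <= b -> {for x, continuous f}) ->
  (forall x, a < x < b -> is_derive x 1 f (df x)) ->
  exists2 c, a < c < b & f b - f a = df c * (b - a).
Proof.
move=> ab /continuous_on_within cf dfx.
have dfx' x : x \in `]a, b[ -> is_derive x 1 f (df x).
  by rewrite in_itv/= => /dfx.
have [c cab ->] := MVT ab dfx' cf.
by exists c => //; move: cab; rewrite in_itv.
Qed.

Lemma deriv_ge0_le f df a b : a <= b ->
  (forall x, a <= x <= b -> {for x, continuous f}) ->
  (forall x, a < x < b -> is_derive x 1 f (df x)) ->
  (forall x, a < x < b -> 0 <= df x) -> f a <= f b.
Proof.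
rewrite le_eqVlt => /predU1P[->//|ab] cf dfx df0.
have [c cab /eqP] := mean_value ab cf dfx.
by rewrite subr_eq => /eqP ->; rewrite lerDr mulr_ge0 ?df0// subr_ge0 ltW.
Qed.

Lemma deriv_gt0_lt f df a b : a < b ->
  (forall x, a <= x <= b -> {for x, continuous f}) ->
  (forall x, a < x < b -> is_derive x 1 f (df x)) ->
  (forall x, a < x < b -> 0 < df x) -> f a < f b.
Proof.
move=> ab cf dfx df0.
have [c cab /eqP] := mean_value ab cf dfx.
by rewrite subr_eq => /eqP ->; rewrite ltrDr mulr_gt0 ?df0// subr_gt0.
Qed.

Lemma deriv_le0_ge f df a b : a <= b ->
  (forall x, a <= x <= b -> {for x, continuous f}) ->
  (forall x, a < x < b -> is_derive x 1 f (df x)) ->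
  (forall x, a < x < b -> df x <= 0) -> f b <= f a.
Proof.
rewrite le_eqVlt => /predU1P[->//|ab] cf dfx df0.
have [c cab /eqP] := mean_value ab cf dfx.
rewrite subr_eq => /eqP ->; rewrite gerDr.
by apply: mulr_le0_ge0; [exact: df0|rewrite subr_ge0 ltW].
Qed.

Lemma deriv_lt0_gt f df a b : a < b ->
  (forall x, a <= x <= b -> {for x, continuous f}) ->
  (forall x, a < x < b -> is_derive x 1 f (df x)) ->
  (forall x, a < x < b -> df x < 0) -> f b < f a.
Proof.
move=> ab cf dfx df0.
have [c cab /eqP] := mean_value ab cf dfx.
by rewrite subr_eq => /eqP ->; rewrite gtrDr nmulr_rlt0 ?df0// subr_gt0.
Qed.

Lemma deriv_eq0_cst f df a b : a <= b ->
  (forall x, a <= x <= b -> {for x, continuous f}) ->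
  (forall x, a < x < b -> is_derive x 1 f (df x)) ->
  (forall x, a < x < b -> df x = 0) -> f b = f a.
Proof.
rewrite le_eqVlt => /predU1P[->//|ab] cf dfx df0.
have [c cab /eqP] := mean_value ab cf dfx.
by rewrite df0// mul0r subr_eq0 => /eqP.
Qed.

Lemma intermediate_value f a b v : a <= b ->
  (forall x, a <= x <= b -> {for x, continuous f}) ->
  Num.min (f a) (f b) <= v <= Num.max (f a) (f b) ->
  exists2 c, a <= c <= b & f c = v.
Proof.
move=> ab /continuous_on_within cf hv.
by have [c] := IVT ab cf hv; rewrite in_itv; exists c.
Qed.

Lemma continuous_integrable f a b : continuous f ->
  (@lebesgue_measure R).-integrable `[a, b] (EFin \o f).
Proof.
move=> cf; apply: continuous_compact_integrable; first exact: segment_compact.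
exact: continuous_subspaceT.
Qed.

Lemma antiderivative_exists f : continuous f ->
  exists F : R -> R, forall x, is_derive x 1 F (f x).
Proof.
move=> cf.
pose mu := @lebesgue_measure R.
pose I a x : R := \int[mu]_(t in `[a, x]) f t.
have dI a x : a < x -> is_derive x 1 (I a) (f x).
  move=> ax; have xx1 : x < x + 1 by rewrite ltrDl.
  have [d1 d2] := continuous_FTC1_closed xx1 (continuous_integrable a (x + 1) cf)
    ax (cf x).
  by apply: DeriveDef; [exact: d1|rewrite -derive1E; exact: d2].
have II a b x y : a < x -> b < x -> a < y -> b < y -> I a x - I a y = I b x - I b y.
  wlog xy : x y / x <= y => [wl ax bx ay by_|ax bx ay by_].
    have [/wl|/ltW/wl wl'] := leP x y; first exact.
    by rewrite -opprB wl'// opprB.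
  have key c : c < x -> I c y - I c x = I x y.
    move=> cx; rewrite /I (@Rintegral_itvB _ f (BLeft c) (BRight y) x).
    - rewrite Rintegral_itv_obnd_cbnd//.
      apply: integrableS (continuous_integrable x y cf) => //.
      exact: subset_itv_oc_cc.
    - exact: continuous_integrable.
    - by rewrite bnd_simp ltW.
    - by rewrite bnd_simp.
  by rewrite -opprB key// -[RHS]opprB key.
(* An integral is differentiable in its upper bound only to the right of its base point, so the base
   point moves with [x], staying left of both [x] and 0. Subtracting the value at 0 makes the result
   independent of that choice, by [II]. *)
exists (fun x => I (- (`|x| + 1)) x - I (- (`|x| + 1)) 0) => x.
pose A := - (`|x| + 2).
have Ax : A < x by rewrite /A; have := ler_norm (- x); rewrite normrN; lra.
have A0 : A < 0 by rewrite /A; have := normr_ge0 x; lra.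
have := deriv_sub (dI _ _ Ax) (deriv_const (I A 0) x).
rewrite subr0; apply: near_eq_deriv; near=> t.
have At : A < t.
  near: t; exact: lt_nbhsr.
apply: II => //; first by have := ler_norm (- t); rewrite normrN; lra.
all: by have := normr_ge0 t; lra.
Unshelve. all: by end_near. Qed.

End Calculus.

(** * Derivatives along an interval and two-sided derivatives *)

Section Difference_quotients.
Context {R : realType}.
Implicit Types (f df : R -> R) (I : set R).

Lemma is_derive_quotientP f (x a : R) :
  is_derive x 1 f a <-> (fun y => (f y - f x) / (y - x)) @ x^' --> a.
Proof.
split.
  move=> /is_derive1_caratheodory[h [fE hC <-]].
  apply: (@cvg_trans _ (h @ x^')); last exact: cvg_within_filter hC.
  apply: near_eq_cvg; near=> y; rewrite fE mulfK// subr_eq0.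
  near: y; exact: nbhs_dnbhs_neq.
move=> fx; apply/is_derive1_caratheodory.
exists (fun y => if y == x then a else (f y - f x) / (y - x)); split.
- move=> z; case: eqP => [->|/eqP zx]; first by rewrite !subrr mulr0.
  by rewrite divfK// subr_eq0.
- apply/cvgrPdist_lt => e e0; rewrite eqxx.
  move/cvgrPdist_lt: fx => /(_ e e0); rewrite !near_withinE.
  move=> nf; near=> y; case: eqP => [_|/eqP yx]; first by rewrite subrr normr0.
  by move: yx; near: y; exact: nf.
- by rewrite eqxx.
Unshelve. all: by end_near. Qed.

Lemma is_derivative_on_of_derive I f df :
  (forall x : R, I x -> is_derive x 1 f (df x)) -> is_derivative_on I f df.
Proof.
move=> fdf x Ix; have /is_derive_quotientP := fdf x Ix.
by apply: cvg_trans; apply: cvg_app; exact: cvg_within.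
Qed.

Lemma is_derivative_on_derive I f df (x : R) : is_derivative_on I f df ->
  nbhs x I -> is_derive x 1 f (df x).
Proof.
move=> fdf nI; apply/is_derive_quotientP.
have Ix := nbhs_singleton nI.
apply: cvg_trans (fdf x Ix); apply: cvg_app => A.
move=> h; have {h} : \forall y \near x^', I y -> A y := h.
move=> h; near=> y; have Iy : I y by near: y; exact: nbhs_dnbhs.
by move: Iy; near: y.
Unshelve. all: by end_near. Qed.

Lemma is_derivative_on_continuous I f df (x : R) : is_derivative_on I f df ->
  I x -> f y @[y --> within I (nbhs x)] --> f x.
Proof.
move=> fdf Ix; have := fdf x Ix => /cvgrPdist_lt/(_ 1 ltr01).
move=> nq0; have {nq0} nq : \forall y \near x, y != x -> I y ->
    `|df x - (f y - f x) / (y - x)| < 1 := nq0.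
apply/cvgrPdist_lt => e e0; rewrite near_withinE.
have K0 : 0 < `|df x| + 1 by rewrite ltr_wpDl.
near=> y; move=> Iy; have [->|yx] := eqVneq y x; first by rewrite subrr normr0.
have yx0 : y - x != 0 by rewrite subr_eq0.
have q1 : `|df x - (f y - f x) / (y - x)| < 1.
  by move: yx Iy; near: y.
have q2 : `|(f y - f x) / (y - x)| < `|df x| + 1.
  have := ler_normB (df x) (df x - (f y - f x) / (y - x)).
  by rewrite opprB addrC subrK => /le_lt_trans; apply; rewrite ltrD2l.
rewrite distrC -(mulfVK yx0 (f y - f x)) normrM.
apply: (@le_lt_trans _ _ ((`|df x| + 1) * `|y - x|)).
  by apply: ler_wpM2r => //; exact: ltW.
rewrite mulrC -ltr_pdivlMr//.
near: y; exists (e / (`|df x| + 1)) => /=; first by rewrite divr_gt0.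
by move=> z /=; rewrite distrC.
Unshelve. all: by end_near. Qed.

End Difference_quotients.

(** * The power nonlinearity and its primitive *)

Section Power_nonlinearity.
Context {R : realType} (p : R).
Hypothesis p2 : 2 < p.
Implicit Types (x y lam : R).

Definition pabs y : R := `|y| `^ p.
Definition psgn y : R := `|y| `^ (p - 2) * y.

Let p0 : 0 < p. Proof. by move: p2; lra. Qed.
Let q0 : 0 < p - 2. Proof. by move: p2; lra. Qed.

Lemma powRSr y : 0 <= y -> y `^ (p - 1) = y `^ (p - 2) * y.
Proof.
move=> y0; rewrite mulrC (_ : p - 2 = p - 1 - 1); last by ring.
by rewrite mulr_powRB1//; move: p2; lra.
Qed.

Lemma psgn0 : psgn 0 = 0. Proof. by rewrite /psgn mulr0. Qed.

Lemma pabs0 : pabs 0 = 0. Proof. by rewrite /pabs normr0 powR0// gt_eqF. Qed.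

Lemma psgnN y : psgn (- y) = - psgn y.
Proof. by rewrite /psgn normrN mulrN. Qed.

Lemma pabsN y : pabs (- y) = pabs y.
Proof. by rewrite /pabs normrN. Qed.

Lemma pabs_ge0 y : 0 <= pabs y. Proof. exact: powR_ge0. Qed.

Lemma pabs_gt0 y : y != 0 -> 0 < pabs y.
Proof. by move=> y0; rewrite powR_gt0// normr_gt0. Qed.

Lemma pabs_sqr y : pabs y = `|y| `^ (p - 2) * y ^+ 2.
Proof.
have [->|y0] := eqVneq y 0; first by rewrite pabs0 expr0n/= mulr0.
rewrite -[y ^+ 2]real_normK ?num_real// -powR_mulrn// -powRD; last first.
  by rewrite normr_eq0 y0 implybT.
by rewrite subrK.
Qed.

Lemma psgn_mul y : psgn y * y = pabs y.
Proof. by rewrite pabs_sqr /psgn expr2 mulrA. Qed.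

Lemma psgn_ge0E y : 0 <= y -> psgn y = y `^ (p - 2) * y.
Proof. by move=> y0; rewrite /psgn ger0_norm. Qed.

Lemma pabs_ge0E y : 0 <= y -> pabs y = y `^ p.
Proof. by move=> y0; rewrite /pabs ger0_norm. Qed.

Lemma continuous_psgn : continuous psgn.
Proof.
move=> y; have [->|y0] := eqVneq y 0.
  apply/cvgrPdist_lt => e e0; rewrite psgn0; near=> t.
  have t1 : `|t| <= 1.
    near: t; exists 1 => //= t /=; rewrite sub0r normrN; exact: ltW.
  rewrite sub0r normrN normrM; apply: (@le_lt_trans _ _ `|t|).
    rewrite ler_piMl// ger0_norm ?powR_ge0//.
    apply: le_trans (ge0_ler_powR (ltW q0) _ _ t1) _; rewrite ?nnegrE//.
    by rewrite powR1.
  by near: t; exists e => //= t /=; rewrite sub0r normrN.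
apply: cvgM; last exact: cvg_id.
have y0' : 0 < `|y| by rewrite normr_gt0.
have c1 := deriv_continuous (is_derive1_powR (p - 2) y0').
by apply: (@continuous_comp _ _ _ (@Num.norm _ R) (@powR R ^~ (p - 2)));
  [exact: norm_continuous|exact: c1].
Unshelve. all: by end_near. Qed.

Lemma deriv_pabs y : is_derive y 1 pabs (p * psgn y).
Proof.
have [y0|y0|->] := ltgtP y 0.
- apply: (@near_eq_deriv _ (fun t => (- t) `^ p)).
    near=> t; rewrite /pabs ltr0_norm//; near: t; exact: lt_nbhsl.
  have y0' : 0 < - y by rewrite oppr_gt0.
  have := @deriv_comp _ (@powR R ^~ p) (fun t => - t) _ _ _
    (is_derive1_powR p y0') (deriv_opp (deriv_id y)).
  move/is_derive_eq; apply; rewrite /psgn ltr0_norm// mulrN1 -mulrN; congr (_ * _).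
  by rewrite powRSr ?ltW// mulrN opprK.
- apply: (@near_eq_deriv _ (@powR R ^~ p)).
    near=> t; rewrite /pabs gtr0_norm//; near: t; exact: lt_nbhsr.
  have := is_derive1_powR p y0.
  move/is_derive_eq; apply; rewrite /psgn gtr0_norm//; congr (_ * _).
  by rewrite powRSr ?ltW.
(* The difference quotient of [pabs] at 0 is [psgn] itself, since [psgn p z * z = pabs p z]. *)
- apply/is_derive1_caratheodory; exists psgn; split.
  + by move=> z; rewrite pabs0 !subr0 psgn_mul.
  + exact: continuous_psgn.
  + by rewrite psgn0 mulr0.
Unshelve. all: by end_near. Qed.

Lemma continuous_pabs : continuous pabs.
Proof. by move=> y; apply: deriv_continuous (deriv_pabs y). Qed.

End Power_nonlinearity.

(** * The potential, the extension of solutions beyond their edge, the conserved energy *)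

Section Potential.
Context {R : realType}.
Implicit Types (p lam x y : R) (f df F dF : R -> R) (I : set R).

Definition potential p lam y : R := lam * y ^+ 2 / 2 - pabs p y / p.
Definition force p lam y : R := lam * y - psgn p y.

Lemma potential0 p lam : 2 < p -> potential p lam 0 = 0.
Proof. by move=> p2; rewrite /potential pabs0// expr0n/=; ring. Qed.

Lemma potentialN p lam y : potential p lam (- y) = potential p lam y.
Proof. by rewrite /potential pabsN sqrrN. Qed.

Lemma forceN p lam y : force p lam (- y) = - force p lam y.
Proof. by rewrite /force psgnN; ring. Qed.

Lemma deriv_potential p lam y : 2 < p ->
  is_derive y 1 (potential p lam) (force p lam y).
Proof.
move=> p2; rewrite /potential.
have := deriv_sub (deriv_scale (lam / 2) (deriv_sqr (deriv_id y)))
  (deriv_scale p^-1 (deriv_pabs p2 y)).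
rewrite (_ : (fun t => _) = (fun t => lam * t ^+ 2 / 2 - pabs p t / p)).
  move/is_derive_eq; apply; rewrite /force; field.
  by apply: lt0r_neq0; lra.
by apply/funext => t; congr (_ - _); [ring|rewrite mulrC].
Qed.

Lemma continuous_potential p lam : 2 < p -> continuous (potential p lam).
Proof. by move=> p2 y; apply: deriv_continuous (deriv_potential lam y p2). Qed.

Lemma continuous_force p lam : 2 < p -> continuous (force p lam).
Proof.
move=> p2 y; apply: cvgB; last exact: continuous_psgn.
by apply: cvgMr; exact: cvg_id.
Qed.

(* The derivatives are two-sided: a solution on an interval containing 0 is
   extended by integrating its second derivative, frozen outside [I]. *)
Definition ode_solution p lam I f df : Prop :=
  [/\ forall x, is_derive x 1 f (df x), continuous df
    & forall x, I x -> is_derive x 1 df (force p lam (f x))].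

(** The map [c] retracts the line onto [I], so [f \o c] is continuous everywhere although [f] is
    controlled on [I] only. Integrating [force p lam (f (c x))] twice, with the initial data of [f]
    at 0, produces two-sided derivatives; on [I] the differences with [df] and [f] have zero
    derivative. *)
Lemma ode_extension p lam I (c : R -> R) f df : 2 < p ->
  continuous c -> (forall x, I (c x)) -> (forall x, I x -> c x = x) ->
  I 0 -> (forall x, I x -> 0 <= x) ->
  (forall x t, I x -> 0 < t < x -> nbhs t I) ->
  solves_on p lam I f df ->
  exists F dF, [/\ ode_solution p lam I F dF,
    (forall x, I x -> F x = f x) & (forall x, I x -> dF x = df x)].
Proof.
move=> p2 cc Ic cI I0 Ige0 In [fdf [ddf dfddf eqn]].
have compc (u du : R -> R) : is_derivative_on I u du -> continuous (u \o c).
  move=> udu x; apply: cvg_trans (is_derivative_on_continuous udu (Ic x)).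
  move=> A hA; rewrite /= in hA.
  have hA' : \forall y \near c x, I y -> A (u y) := hA.
  have := cc x _ hA'.
  by apply: (@filterS _ (nbhs x)) => t; apply; exact: Ic.
have cG : continuous (fun x => force p lam (f (c x))).
  move=> x; apply: (@continuous_comp _ _ _ (f \o c) (force p lam)).
    exact: (compc _ _ fdf).
  exact: continuous_force.
have [dF0 hdF0] := antiderivative_exists cG.
pose dF x := dF0 x + (df 0 - dF0 0).
have hdF x : is_derive x 1 dF (force p lam (f (c x))).
  have := deriv_add (hdF0 x) (deriv_const (df 0 - dF0 0) x).
  by rewrite addr0.
have cdF : continuous dF by move=> x; exact: deriv_continuous (hdF x).
have [F0 hF0] := antiderivative_exists cdF.
pose F x := F0 x + (f 0 - F0 0).
have hF x : is_derive x 1 F (dF x).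
  have := deriv_add (hF0 x) (deriv_const (f 0 - F0 0) x).
  by rewrite addr0.
have agree (u du v dv : R -> R) : is_derivative_on I u du ->
    (forall x, is_derive x 1 v (dv x)) -> (forall x, I x -> dv x = du x) ->
    v 0 = u 0 -> forall x, I x -> v x = u x.
  move=> udu vdv dvdu v0u0 x Ix.
  have := @deriv_eq0_cst _ (fun t => v t - u (c t)) (fun t => dv t - du t) 0 x.
  rewrite cI// cI// v0u0 subrr => h; apply/eqP; rewrite -subr_eq0; apply/eqP.
  apply: h; first exact: Ige0.
  - move=> t _; apply: cvgB; first exact: deriv_continuous (vdv t).
    exact: (compc _ _ udu).
  - move=> t tx; have nI := In _ _ Ix tx; apply: deriv_sub => //.
    apply: near_eq_deriv (is_derivative_on_derive udu nI).
    by apply: filterS nI => s Is; rewrite cI.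
  - move=> t tx; rewrite dvdu ?subrr//.
    exact: nbhs_singleton (In _ _ Ix tx).
have dFdf : forall x, I x -> dF x = df x.
  apply: (agree df ddf dF _ dfddf hdF); last by rewrite /dF addrC subrK.
  move=> x Ix; rewrite cI//; have := eqn x Ix; rewrite /force /psgn => <-; ring.
have Ff : forall x, I x -> F x = f x.
  by apply: (agree f df F dF fdf hF dFdf); rewrite /F addrC subrK.
exists F, dF; split => //; split => // x Ix.
by have := hdF x; rewrite cI// Ff.
Qed.

Lemma ode_extension_half_line p lam f df : 2 < p ->
  solves_on p lam (@half_line R) f df ->
  exists F dF, [/\ ode_solution p lam (@half_line R) F dF,
    (forall x, 0 <= x -> F x = f x) & (forall x, 0 <= x -> dF x = df x)].
Proof.
move=> p2 sol.
have IE x : half_line x <-> 0 <= x by rewrite /half_line/= in_itv/= andbT.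
have [|||||||F [dF [h1 h2 h3]]] :=
    @ode_extension p lam (@half_line R) (fun x => Num.max 0 x) f df p2.
- by move=> x; apply: continuous_max; [exact: cvg_cst|exact: cvg_id].
- by move=> x; apply/IE; rewrite le_max lexx.
- by move=> x /IE x0; rewrite max_r.
- exact/IE.
- by move=> x /IE.
- move=> x t _ /andP[t0 _]; near=> s; apply/IE/ltW; near: s; exact: lt_nbhsr.
- exact: sol.
by exists F, dF; split => // x /IE; [exact: h2|exact: h3].
Unshelve. all: by end_near. Qed.

Lemma ode_extension_edge p lam (ell : R) f df : 2 < p -> 0 < ell ->
  solves_on p lam (terminal_edge ell) f df ->
  exists F dF, [/\ ode_solution p lam (terminal_edge ell) F dF,
    (forall x, 0 <= x <= ell -> F x = f x)
    & (forall x, 0 <= x <= ell -> dF x = df x)].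
Proof.
move=> p2 l0 sol.
have IE x : terminal_edge ell x <-> 0 <= x <= ell
  by rewrite /terminal_edge/= in_itv/=.
have [|||||||F [dF [h1 h2 h3]]] :=
    @ode_extension p lam (terminal_edge ell)
      (fun x => Num.min ell (Num.max 0 x)) f df p2.
- move=> x; apply: continuous_min; first exact: cvg_cst.
  by apply: continuous_max; [exact: cvg_cst|exact: cvg_id].
- by move=> x; apply/IE; rewrite le_min ge_min le_max lexx (ltW l0) lexx.
- by move=> x /IE /andP[x0 xl]; rewrite max_r// min_r.
- by apply/IE; rewrite lexx ltW.
- by move=> x /IE /andP[].
- move=> x t /IE /andP[_ xl] /andP[t0 tx]; near=> s; apply/IE/andP; split.
    by apply: ltW; near: s; exact: lt_nbhsr.
  by apply: ltW; near: s; apply: lt_nbhsl; exact: lt_le_trans xl.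
- exact: sol.
exists F, dF; split; first exact: h1.
- by move=> x xl; apply: h2; exact/IE.
- by move=> x xl; apply: h3; exact/IE.
Unshelve. all: by end_near. Qed.

Lemma ode_energy p lam I f df a x : 2 < p -> ode_solution p lam I f df ->
  a <= x -> (forall t, a <= t <= x -> I t) ->
  df x ^+ 2 / 2 - potential p lam (f x) = df a ^+ 2 / 2 - potential p lam (f a).
Proof.
move=> p2 [fdf cdf ode] ax It.
apply: (@deriv_eq0_cst _ (fun t => df t ^+ 2 / 2 - potential p lam (f t))
  (fun t => df t * force p lam (f t) - force p lam (f t) * df t)) => //.
- move=> t _; apply: cvgB.
    by apply: cvgMl; apply: (@continuous_comp _ _ _ df (fun y => y ^+ 2));
      [exact: cdf|exact: exprn_continuous].
  apply: (@continuous_comp _ _ _ f (potential p lam)).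
    exact: deriv_continuous (fdf t).
  exact: continuous_potential.
- move=> t /andP[/ltW at_ /ltW tx]; have It' := It t; rewrite at_ tx in It'.
  apply: deriv_sub.
    have := deriv_scale 2^-1 (deriv_sqr (ode t (It' isT))).
    rewrite (_ : (fun s => _) = (fun s => df s ^+ 2 / 2)); last first.
      by apply/funext => s; rewrite mulrC.
    by move/is_derive_eq; apply; field.
  exact: (@deriv_comp _ (potential p lam) f _ _ _ (deriv_potential lam _ p2) (fdf t)).
- by move=> t _; ring.
Qed.

End Potential.

Notation summable I f :=
  ((@lebesgue_measure _).-integrable I (EFin \o f)).

(** * Square integrability and the conserved energy *)

Section Summable.
Context {R : realType}.
Local Notation mu := (@lebesgue_measure R).
Implicit Types (I : set R) (f g u : R -> R).

Lemma summable_eq I f g : measurable I -> {in I, f =1 g} ->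
  summable I f -> summable I g.
Proof. by move=> mI fg; apply: eq_integrable => // x xI; rewrite /= fg. Qed.

Lemma summable_measurable I f : summable I f -> measurable_fun I f.
Proof. by move=> /measurable_int/measurable_EFinP. Qed.

Lemma summableD I f g : measurable I -> summable I f -> summable I g ->
  summable I (fun x => f x + g x).
Proof. by move=> mI fI gI; exact: (@integrableD _ _ _ mu I mI _ _ fI gI). Qed.

Lemma summableB I f g : measurable I -> summable I f -> summable I g ->
  summable I (fun x => f x - g x).
Proof. by move=> mI fI gI; exact: (@integrableB _ _ _ mu I mI _ _ fI gI). Qed.

Lemma summableZ I (c : R) f : measurable I -> summable I f ->
  summable I (fun x => c * f x).
Proof. by move=> mI fI; exact: (@integrableZl _ _ _ mu I mI c _ fI). Qed.

Lemma summable_le I f g : measurable I -> measurable_fun I f ->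
  (forall x, I x -> `|f x| <= g x) -> summable I g -> summable I f.
Proof.
move=> mI mf fg; apply: le_integrable => //; first exact/measurable_EFinP.
by move=> x Ix; rewrite /= lee_fin; apply: le_trans (fg _ Ix) (ler_norm _).
Qed.

Lemma summable_abs I f : measurable I -> summable I f ->
  summable I (fun x => `|f x|).
Proof. by move=> mI; exact: integrable_norm. Qed.

Lemma summable_sub I J f : measurable I -> measurable J -> J `<=` I ->
  summable I f -> summable J f.
Proof. by move=> mI mJ JI; exact: integrableS. Qed.

Lemma L2P I f : measurable I ->
  L2 I f <-> measurable_fun I f /\ summable I (fun x => f x ^+ 2).
Proof.
move=> mI; rewrite /L2.
have sqr_patch : (fun x => (f \_ I) x ^+ 2) = (fun x => f x ^+ 2) \_ I.
  by apply/funext => x; rewrite !patchE; case: ifP => //; rewrite expr0n.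
split.
- move=> fL2; have mfI : measurable_fun setT (f \_ I).
    by move: fL2; rewrite inE => /andP[/[!inE]].
  have mf : measurable_fun I f by apply/measurable_restrictT.
  split=> //.
  have := Lfun2_integrable_sqr fL2.
  rewrite sqr_patch -restrict_EFin => h.
  by apply/(@integrable_mkcond _ _ _ mu I _ mI).
- move=> [mf fs].
  have mfI := (measurable_restrictT f mI).1 mf.
  rewrite inE; apply/andP; split; rewrite inE//=.
  rewrite /finite_norm unlock/=; apply: poweR_lty.
  have := fs => /(@integrable_mkcond _ _ _ mu I _ mI); rewrite restrict_EFin -sqr_patch.
  move=> /integrableP[_]; apply: le_lt_trans.
  rewrite le_eqVlt; apply/orP; left; apply/eqP; apply: eq_integral => x _ /=.
  by rewrite powR_mulrn// real_normK ?num_real// ger0_norm// sqr_ge0.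
Qed.

Lemma L2_measurable I f : measurable I -> L2 I f -> measurable_fun I f.
Proof. by move=> mI /(L2P _ mI)[]. Qed.

Lemma L2_summable_sqr I f : measurable I -> L2 I f ->
  summable I (fun x => f x ^+ 2).
Proof. by move=> mI /(L2P _ mI)[]. Qed.

Lemma L2_summable_mul I f g : measurable I -> L2 I f -> L2 I g ->
  summable I (fun x => f x * g x).
Proof.
move=> mI fI gI; apply: (@summable_le _ _ (fun x => f x ^+ 2 + g x ^+ 2)) => //.
- by apply: measurable_funM; exact: L2_measurable.
- move=> x _; rewrite normrM -[f x ^+ 2]real_normK ?num_real//.
  rewrite -[g x ^+ 2]real_normK ?num_real//.
  by have := sqr_ge0 (`|f x| - `|g x|); have := mulr_ge0 (normr_ge0 (f x)) (normr_ge0 (g x)); nra.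
- by apply: summableD => //; exact: L2_summable_sqr.
Qed.

Lemma L2_linear I f g (a b : R) : measurable I -> L2 I f -> L2 I g ->
  L2 I (fun x => a * f x + b * g x).
Proof.
move=> mI fI gI; apply/(L2P _ mI); split.
  by apply: measurable_funD; apply: measurable_funM => //; exact: L2_measurable.
apply: (@summable_le _ _ (fun x => (2 * a ^+ 2) * f x ^+ 2 + (2 * b ^+ 2) * g x ^+ 2)) => //.
- apply: measurable_funX; apply: measurable_funD; apply: measurable_funM => //;
    exact: L2_measurable.
- move=> x _; rewrite ger0_norm ?sqr_ge0//.
  by have := sqr_ge0 (a * f x - b * g x); nra.
- by apply: summableD => //; apply: summableZ => //; exact: L2_summable_sqr.
Qed.

Lemma L2_summable_itv I f (a b : R) : measurable I -> `[a, b] `<=` I ->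
  L2 I f -> summable `[a, b] f.
Proof.
move=> mI abI fI.
apply: (@summable_le _ _ (fun x => 1 + f x ^+ 2)) => //.
- by apply: measurable_funS abI _ => //; exact: L2_measurable.
- move=> x _; rewrite -[f x ^+ 2]real_normK ?num_real//.
  by have := sqr_ge0 (`|f x| - 1); have := normr_ge0 (f x); nra.
- apply: summableD => //; last exact: summable_sub (L2_summable_sqr mI fI).
  exact: (@continuous_integrable _ (fun=> 1) a b (fun x => cvg_cst _)).
Qed.

Lemma continuous_L2_itv f (a b : R) : continuous f -> L2 `[a, b] f.
Proof.
move=> cf; apply/L2P => //; split.
  by apply: measurable_funTS; exact: continuous_measurable_fun.
apply: (@continuous_integrable _ (fun x => f x ^+ 2)) => x.
by apply: (@continuous_comp _ _ _ f (fun y => y ^+ 2));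
  [exact: cf|exact: exprn_continuous].
Qed.

(** Treats both kinds of edge at once. The point [e] stands for a possible right end, so that every
    point of [I] other than 0 and [e] is interior. By the last clause the part of [I] up to any [b]
    lies in some [[0, x]] with [x] in [I], which turns integrability on such segments into local
    integrability. *)
Definition edge_interval I : Prop :=
  [/\ measurable I, I 0, forall x, I x -> 0 <= x,
      forall x y, I x -> 0 <= y <= x -> I y
    & (exists e, forall x, I x -> [\/ x = 0, x = e | nbhs x I]) /\
      (forall b, exists2 x, I x & forall t, I t -> t <= b -> t <= x)].

Lemma edge_interval_half_line : edge_interval (@half_line R).
Proof.
have IE x : half_line x <-> 0 <= x by rewrite /half_line/= in_itv/= andbT.
split.
- exact: measurable_itv.
- exact/IE.
- by move=> x /IE.
- by move=> x y /IE x0 /andP[y0 _]; exact/IE.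
- split; last first.
    by move=> b; exists (Num.max 0 b); [apply/IE; rewrite le_max lexx|
      move=> t _ tb; rewrite le_max tb orbT].
  exists 0 => x /IE; rewrite le_eqVlt => /predU1P[->|x0]; first by constructor.
  by constructor 3; near=> t; apply/IE/ltW; near: t; exact: lt_nbhsr.
Unshelve. all: by end_near. Qed.

Lemma edge_interval_terminal_edge (ell : R) : 0 < ell ->
  edge_interval (terminal_edge ell).
Proof.
move=> l0.
have IE x : terminal_edge ell x <-> 0 <= x <= ell.
  by rewrite /terminal_edge/= in_itv/=.
split.
- exact: measurable_itv.
- by apply/IE; rewrite lexx ltW.
- by move=> x /IE /andP[].
- by move=> x y /IE /andP[x0 xl] /andP[y0 yx]; apply/IE; rewrite y0 (le_trans yx).
- split; last first.
    move=> b; exists ell; first by apply/IE; rewrite lexx ltW.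
    by move=> t /IE /andP[].
  exists ell => x /IE /andP[]; rewrite le_eqVlt => /predU1P[<-|x0].
    by move=> _; constructor.
  rewrite le_eqVlt => /predU1P[->|xl]; first by constructor.
  constructor 3; near=> t; apply/IE/andP; split; apply/ltW; near: t.
    exact: lt_nbhsr.
  exact: lt_nbhsl.
Unshelve. all: by end_near. Qed.

Lemma edge_interval_sub I (x : R) : edge_interval I -> I x -> `[0, x] `<=` I.
Proof.
by move=> [_ _ _ h _] Ix y; rewrite /= in_itv/=; exact: h.
Qed.

(** The difference of the two candidates, extended by 0, is locally integrable with vanishing
    integrals over [[0, x]], hence zero almost everywhere by Lebesgue differentiation; the two
    possible ends are discarded as a null set. Integrability is asked on segments only, so that a
    classical derivative can be compared before it is known to be square integrable. *)
Lemma weak_derivative_unique_loc I u g1 g2 : edge_interval I ->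
  measurable_fun I g1 -> measurable_fun I g2 ->
  (forall x, I x -> summable `[0, x] g1) ->
  (forall x, I x -> summable `[0, x] g2) ->
  (forall x, I x -> u x = u 0 + \int[mu]_(t in `[0, x]) g1 t) ->
  (forall x, I x -> u x = u 0 + \int[mu]_(t in `[0, x]) g2 t) ->
  {ae mu, forall x, I x -> g1 x = g2 x}.
Proof.
move=> eI mg1 mg2 g1s g2s ug1 ug2.
have [mI I0 Ige0 Iconv [[e eP] bP]] := eI.
pose k x := g1 x - g2 x.
pose h : R -> R := k \_ I.
have mk : measurable_fun I k by exact: measurable_funB.
have mh : measurable_fun setT h by exact: (measurable_restrictT k mI).1 mk.
have hK (a b : R) : summable `[a, b] h.
  have [x Ix xP] := bP b.
  have mKI : measurable (`[a, b] `&` I) by apply: measurableI.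
  apply/(@integrable_mkcond _ _ _ mu `[a, b]) => //.
  rewrite (_ : (EFin \o h) \_ _ = (EFin \o k) \_ (`[a, b] `&` I)); last first.
    apply/funext => t; rewrite !patchE in_setI; case: ifP => //= _.
    by rewrite /h patchE; case: ifP.
  apply/(@integrable_mkcond _ _ _ mu (`[a, b] `&` I)) => //.
  apply: (@summable_sub `[0, x]) => //.
    move=> t [/= + It]; rewrite !in_itv/= => /andP[_ tb].
    by rewrite Ige0//= xP.
  by apply: summableB => //; [exact: g1s|exact: g2s].
have lh : locally_integrable setT h.
  split => //; first exact: openT.
  move=> K _ cK; have /ex_strict_bound_gt0[M M0 /= KM] := compact_bounded cK.
  have := hK (- M) M => /integrableP[_]; apply: le_lt_trans.
  apply: ge0_subset_integral => //=.
  - exact: compact_measurable.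
  - apply/measurable_EFinP; apply: measurableT_comp => //.
    exact: measurable_funTS.
  - by move=> x Kx; rewrite /= in_itv/=; have := KM x Kx; rewrite ltr_norml => /andP[/ltW -> /ltW ->].
have F0 x : I x -> \int[mu]_(t in `[0, x]) h t = 0.
  move=> Ix; have sI := edge_interval_sub eI Ix.
  rewrite (@eq_Rintegral _ _ _ mu `[0, x] (fun t => g1 t - g2 t)); last first.
    move=> t tx; rewrite /h patchE mem_set; last by apply: sI; rewrite inE in tx.
    by [].
  rewrite RintegralB//; [|exact: g1s|exact: g2s].
  by have := ug1 x Ix; rewrite (ug2 x Ix); lra.
have ae0 (a : R) : {ae mu, forall x, x <> a}.
  exists [set a]; split => //; first exact: lebesgue_measure_set1.
  by move=> x /=; apply: contrapT.
have := @FTC1 R h (BLeft 0) (fun y => hK 0 y) lh.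
move=> ftc; have FF := ae_filter_ringOfSetsType mu.
apply: filterS3 (ae0 0) (ae0 e) ftc => x xn0 xne hx Ix.
have x0 : 0 < x by rewrite lt_neqAle Ige0// andbT eq_sym; apply/eqP.
have nI : nbhs x I by case: (eP x Ix).
have [dF hxE] := hx x0.
have : is_derive x 1 (fun y => \int[mu]_(t in `[0, y]) h t) 0.
  apply: near_eq_deriv (deriv_const 0 x).
  by apply: filterS nI => t It; rewrite F0.
move=> /(@derive_val _ _ _ _ _ _ _); rewrite -derive1E hxE /h patchE mem_set//.
by rewrite /k; lra.
Qed.

Lemma weak_derivative_unique I u g1 g2 : edge_interval I ->
  is_weak_derivative I u g1 -> is_weak_derivative I u g2 ->
  {ae mu, forall x, I x -> g1 x = g2 x}.
Proof.
move=> eI [g1L2 ug1] [g2L2 ug2]; have mI : measurable I by case: eI.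
apply: weak_derivative_unique_loc ug1 ug2 => //; try exact: L2_measurable.
- by move=> x Ix; exact: L2_summable_itv (edge_interval_sub eI Ix) g1L2.
- by move=> x Ix; exact: L2_summable_itv (edge_interval_sub eI Ix) g2L2.
Qed.

Lemma weak_derivativeP I u g : edge_interval I -> is_weak_derivative I u g ->
  \int[mu]_(x in I) (`|weak_derivative I u x| ^+ 2) = \int[mu]_(x in I) (g x ^+ 2).
Proof.
move=> eI ug; have mI : measurable I by case: eI.
have wg : is_weak_derivative I u (weak_derivative I u).
  by apply: (@xgetPex _ (fun=> 0) (is_weak_derivative I u)); exists g.
congr fine; apply: ae_eq_integral => //.
- apply/measurable_EFinP; apply: measurable_funX; apply: measurableT_comp => //.
  exact: L2_measurable wg.1.
- by apply/measurable_EFinP; apply: measurable_funX; exact: L2_measurable ug.1.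
- have FF := ae_filter_ringOfSetsType mu.
  apply: filterS (weak_derivative_unique eI wg ug) => x h Ix.
  by rewrite real_normK ?num_real// h.
Qed.

End Summable.

(** * Integrals over the half-line and estimates for H^1 functions *)

Section Half_line_integrals.
Context {R : realType}.
Local Notation mu := (@lebesgue_measure R).
Implicit Types (I : set R) (f g F df u : R -> R).

Lemma half_lineE (x : R) : half_line x = (0 <= x) :> Prop.
Proof. by rewrite /half_line/= in_itv/= andbT. Qed.

Lemma terminal_edgeE (ell x : R) : terminal_edge ell x = (0 <= x <= ell) :> Prop.
Proof. by rewrite /terminal_edge/= in_itv. Qed.

Lemma Rintegral_FTC F f (a b : R) : a <= b ->
  (forall x : R, is_derive x 1 F (f x)) -> continuous f ->
  \int[mu]_(x in `[a, b]) f x = F b - F a.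
Proof.
move=> + dF cf; rewrite le_eqVlt => /predU1P[<-|ab].
  by rewrite set_itv1 Rintegral_set1 subrr.
rewrite /Rintegral (@continuous_FTC2 _ f F)//.
- exact: continuous_subspaceT.
- split.
  + by move=> x _; have [] := dF x.
  + by apply: cvg_at_right_filter; exact: deriv_continuous (dF a).
  + by apply: cvg_at_left_filter; exact: deriv_continuous (dF b).
- by move=> x _; rewrite derive1E; have [_ ->] := dF x.
Qed.

Lemma Rintegral_itv_cst (c a b : R) : a <= b ->
  \int[mu]_(x in `[a, b]) c = c * (b - a).
Proof.
move=> ab; have dF (x : R) : is_derive x 1 (fun x => c * x) c.
  by have := deriv_scale c (deriv_id x); rewrite mulr1.
by rewrite (Rintegral_FTC ab dF (fun x => cvg_cst _)) mulrBr.
Qed.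

Lemma Rintegral_half_line_cvg f : summable (@half_line R) f ->
  (fun n => \int[mu]_(x in `[0, n%:R]) f x) @ \oo -->
  \int[mu]_(x in @half_line R) f x.
Proof.
move=> fs; have mI : measurable (@half_line R) by exact: measurable_itv.
have mf := summable_measurable fs.
pose f_ n : R -> \bar R := EFin \o (f \_ `[0, n%:R]).
have [|||||_ _ cv] := @dominated_convergence _ _ _ mu (@half_line R) mI f_
  (EFin \o f) (EFin \o (fun x => `|f x|)).
- move=> n; apply: measurable_funTS; apply/measurable_EFinP.
  suff mfn : measurable_fun (`[0, n%:R] : set R) f.
    exact: ((@measurable_restrictT _ _ _ _ _ f (measurable_itv `[0, n%:R])).1 mfn).
  apply: measurable_funS mf => //.
  by move=> x; rewrite /= half_lineE in_itv/= => /andP[].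
- exact/measurable_EFinP.
- apply: aeW => x; rewrite half_lineE => x0.
  apply: cvg_near_cst; near=> n; rewrite /f_/= patchE mem_set//= in_itv/= x0/=.
  by near: n; exact: nbhs_infty_ger.
- exact: summable_abs.
- apply: aeW => x n _; rewrite /f_/= patchE; case: ifP => _ //=.
  by rewrite normr0 lee_fin.
have fin : (\int[mu]_(x in @half_line R) (f x)%:E)%E \is a fin_num.
  exact: integrable_fin_num.
have E n : (\int[mu]_(x in `[0%R, n%:R]) (f x)%:E =
    \int[mu]_(x in @half_line R) f_ n x)%E.
  rewrite /f_ -restrict_EFin -integral_mkcondr; congr integral; apply/seteqP; split => x /=.
    by rewrite half_lineE in_itv/= => /[dup] /andP[].
  by move=> [].
apply: (@fine_cvg R _ _ _ (fun n => \int[mu]_(x in `[0%R, n%:R]) (f x)%:E)%E).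
by rewrite fineK//; under eq_fun do rewrite E.
Unshelve. all: by end_near. Qed.

Lemma half_line_FTC F f (l : R) : (forall x : R, is_derive x 1 F (f x)) ->
  continuous f -> summable (@half_line R) f -> F x @[x --> +oo] --> l ->
  \int[mu]_(x in @half_line R) f x = l - F 0.
Proof.
move=> dF cf fs Fl; have := Rintegral_half_line_cvg fs.
under eq_fun do rewrite (Rintegral_FTC _ dF cf)//.
move/(cvg_lim (@Rhausdorff R)) => <-; apply: (cvg_lim (@Rhausdorff R)).
apply: cvgB; last exact: cvg_cst.
exact: cvg_comp (@cvgr_idn R) Fl.
Qed.

Lemma half_line_not_summable f (c a : R) : 0 < c -> 0 <= a ->
  (forall x, a <= x -> c <= f x) -> ~ summable (@half_line R) f.
Proof.
move=> c0 a0 cf fs.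
have mI : measurable (@half_line R) by exact: measurable_itv.
have : summable `[a, +oo[ (fun _ : R => c).
  apply: (@summable_le _ _ _ f) => //.
    move=> x; rewrite /= in_itv/= andbT => ax.
    by rewrite gtr0_norm// cf.
  apply: summable_sub fs => // x; rewrite /= half_lineE in_itv/= andbT.
  exact: le_trans.
move=> /integrableP[_] /=; rewrite integral_cst//=.
rewrite [X in (_ * X)%E](_ : _ = +oo%E); last first.
  by rewrite lebesgue_measure_itv/= ltry.
by rewrite gt0_muley ?ltxx// lte_fin normr_gt0 gt_eqF.
Qed.

(** The bound on [df] makes f^2 exp(2 K x) nondecreasing. Hence [f x ^+ 2] is at most [expR (2 * K)]
    times the integral of f^2 over [x, x + 1], and this tends to 0 because f^2 is summable. *)
Lemma summable_decay f df (K : R) : 0 <= K ->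
  (forall x : R, is_derive x 1 f (df x)) ->
  (forall x, 0 <= x -> `|df x| <= K * `|f x|) ->
  summable (@half_line R) (fun x => f x ^+ 2) -> f x @[x --> +oo] --> 0.
Proof.
move=> K0 fdf dfK fs.
have cf : continuous f by move=> x; exact: deriv_continuous (fdf x).
have cf2 : continuous (fun x => f x ^+ 2).
  move=> x; apply: (@continuous_comp _ _ _ f (fun y => y ^+ 2));
  [exact: cf|exact: exprn_continuous].
have [F dF] := antiderivative_exists cf2.
have cF : continuous F by move=> x; exact: deriv_continuous (dF x).
pose S := \int[mu]_(x in @half_line R) f x ^+ 2.
have FS (x : R) : F x - F 0 <= S.
  have [x0|x0] := leP 0 x; last first.
    apply: (@le_trans _ _ 0); last by apply: Rintegral_ge0 => y _; exact: sqr_ge0.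
    rewrite subr_le0.
    exact: (deriv_ge0_le (ltW x0) (fun y _ => cF y) (fun y _ => dF y)
      (fun y _ => sqr_ge0 _)).
  rewrite -(Rintegral_FTC x0 dF cf2) /S.
  rewrite fine_le//.
  - apply: integrable_fin_num => //; exact: continuous_integrable.
  - by apply: integrable_fin_num => //; exact: measurable_itv.
  apply: ge0_subset_integral => //=.
  - exact: measurable_itv.
  - by apply/measurable_EFinP; exact: (summable_measurable fs).
  - by move=> y _; rewrite lee_fin sqr_ge0.
  - by move=> y; rewrite /= in_itv/= half_lineE => /andP[].
have Fmono : {homo F : x y / x <= y}.
  move=> x y xy; exact: (deriv_ge0_le xy (fun y _ => cF y) (fun y _ => dF y)
    (fun y _ => sqr_ge0 _)).
have Fl : F x @[x --> +oo] --> sup (range F).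
  apply: nondecreasing_cvgr => //; exists (S + F 0) => _ [x _ <-].
  by rewrite -lerBlDr.
have D0 : F (x + 1) - F x @[x --> +oo] --> 0.
  rewrite -(subrr (sup (range F))); apply: cvgB => //.
  apply: cvg_comp Fl; exact: cvg_addrr.
pose E := expR (2 * K).
have lower x : 0 <= x -> f x ^+ 2 <= E * (F (x + 1) - F x).
  move=> x0; have x1 : x < x + 1 by rewrite ltrDl.
  have [c /andP[xc c1] ->] := mean_value x1 (fun y _ => cF y) (fun y _ => dF y).
  rewrite addrAC subrr add0r mulr1.
  pose g t := f t ^+ 2 * expR (2 * K * t).
  have dg (t : R) : is_derive t 1 g (2 * f t * df t * expR (2 * K * t) +
      f t ^+ 2 * (expR (2 * K * t) * (2 * K * 1))).
    exact: (deriv_mul (deriv_sqr (fdf t)) (@deriv_comp _ expR (fun s => 2 * K * s)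
      _ _ _ (is_derive_expR _) (deriv_scale _ (deriv_id t)))).
  have : g x <= g c.
    apply: (deriv_ge0_le (ltW xc) _ (fun y _ => dg y)) => [z _|z /andP[xz _]].
    - exact: deriv_continuous (dg z).
    - have := dfK z (le_trans x0 (ltW xz)).
      rewrite (_ : _ + _ = 2 * expR (2 * K * z) * (f z * df z + K * f z ^+ 2));
        last by ring.
      move=> h; apply: mulr_ge0; first by rewrite mulr_ge0 ?expR_ge0.
      have := ler_norm (- (f z * df z)); rewrite normrN normrM.
      rewrite -[f z ^+ 2]real_normK ?num_real//.
      by have := normr_ge0 (f z); nra.
  rewrite /g => h.
  have : f x ^+ 2 * expR (2 * K * x) <= f c ^+ 2 * (E * expR (2 * K * x)).
    apply: (le_trans h); apply: ler_wpM2l; first exact: sqr_ge0.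
    rewrite /E -expRD ler_expR; nra.
  by rewrite mulrA ler_pM2r ?expR_gt0// mulrC.
have f20 : f x ^+ 2 @[x --> +oo] --> 0.
  apply: (@squeeze_cvgr _ _ _ _ (fun=> 0) (fun x => E * (F (x + 1) - F x))).
  - near=> x; apply/andP; split; first exact: sqr_ge0.
    by apply: lower; near: x; exact: nbhs_pinfty_ge.
  - exact: cvg_cst.
  - by rewrite -(mulr0 E); exact: cvgMr.
apply/cvgrPdist_lt => e e0.
have /cvgrPdist_lt/(_ (e ^+ 2)) := f20; rewrite exprn_gt0// => /(_ isT).
apply: filterS => x; rewrite !sub0r !normrN normrX.
by rewrite ltr_pXn2r// nnegrE// ltW.
Unshelve. all: by end_near. Qed.

Lemma le_Rintegral_subset I J f : measurable I -> measurable J -> J `<=` I ->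
  (forall x, I x -> 0 <= f x) -> summable I f ->
  \int[mu]_(x in J) f x <= \int[mu]_(x in I) f x.
Proof.
move=> mI mJ JI f0 fs; rewrite fine_le//.
- by apply: integrable_fin_num => //; exact: summable_sub fs.
- exact: integrable_fin_num.
- apply: ge0_subset_integral => //=.
  by apply/measurable_EFinP; exact: summable_measurable fs.
Qed.

(** Integrates 2 |g| <= 1/w + w g^2 in place of the Cauchy-Schwarz inequality. A small weight [w]
    makes the second term small, after which a small [x - y] handles the first: this yields
    continuity of [u]. *)
Lemma H1_increment_weighted I u g (x y w : R) : edge_interval I -> 0 < w ->
  is_weak_derivative I u g -> 0 <= y <= x -> I x ->
  `|u x - u y| <= ((x - y) / w + w * \int[mu]_(t in I) g t ^+ 2) / 2.
Proof.
move=> eI w0 [gL2 ug] /andP[y0 yx] Ix; have [mI I0 Ige0 Iconv _] := eI.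
have Iy : I y by apply: (Iconv x); rewrite // y0.
have s0x := L2_summable_itv mI (edge_interval_sub eI Ix) gL2.
have sub : `[y, x] `<=` I.
  move=> t; rewrite /= in_itv/= => /andP[yt tx].
  by apply: (Iconv x); rewrite // tx (le_trans y0).
have syx : summable `[y, x] g by exact: L2_summable_itv gL2.
have -> : u x - u y = \int[mu]_(t in `[y, x]) g t.
  rewrite (ug x Ix) (ug y Iy) opprD addrACA subrr add0r.
  rewrite (@Rintegral_itvB _ g (BLeft 0) (BRight x) y)//.
    rewrite Rintegral_itv_obnd_cbnd//.
    by apply: summable_sub syx => //; exact: subset_itv_oc_cc.
have g2s : summable `[y, x] (fun t => g t ^+ 2).
  by apply: summable_sub (L2_summable_sqr mI gL2).
apply: le_trans (le_normr_Rintegral _ syx) _ => //.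
have c1 : summable `[y, x] (fun _ => w^-1 : R).
  exact: (@continuous_integrable _ (fun=> w^-1) y x (fun x => cvg_cst _)).
have c2 := summableZ w (measurable_itv _) g2s.
have c12 := summableD (measurable_itv _) c1 c2.
apply: (@le_trans _ _ (\int[mu]_(t in `[y, x]) (2^-1 * (w^-1 + w * g t ^+ 2)))).
  apply: le_Rintegral => //.
  - exact: summable_abs.
  - exact: summableZ.
  - move=> t _; rewrite -[g t ^+ 2]real_normK ?num_real//.
    have w1 : w != 0 by rewrite gt_eqF.
    have wi : 0 < w^-1 by rewrite invr_gt0.
    have h := mulr_ge0 (ltW wi) (sqr_ge0 (w * `|g t| - 1)).
    have e : w^-1 * (w * `|g t| - 1) ^+ 2 = w * `|g t| ^+ 2 - 2 * `|g t| + w^-1.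
      by field.
    by rewrite e in h; lra.
rewrite RintegralZl// mulrC ler_pM2r// RintegralD// RintegralZl//.
rewrite Rintegral_itv_cst// [w^-1 * _]mulrC lerD2l ler_pM2l//.
by apply: le_Rintegral_subset => //; [move=> t _; exact: sqr_ge0|exact: L2_summable_sqr].
Qed.

Lemma H1_increment I u g (x y : R) : edge_interval I ->
  is_weak_derivative I u g -> 0 <= y <= x -> I x ->
  `|u x - u y| <= (x - y + \int[mu]_(t in I) g t ^+ 2) / 2.
Proof.
move=> eI ug yx Ix; have := H1_increment_weighted eI ltr01 ug yx Ix.
by rewrite divr1 mul1r.
Qed.

(** If |u| exceeded the bound at some x > 1, the increment estimate would keep it above [1 + S] on
    [x - 1, x], whose share of the integral of u^2 would then exceed the total [S]. *)
Lemma H1_bounded I u : edge_interval I -> H1 I u ->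
  exists B, forall x, I x -> `|u x| <= B.
Proof.
move=> eI [uL2 [g ug]]; have [mI I0 Ige0 Iconv _] := eI.
set G := \int[mu]_(t in I) g t ^+ 2.
pose S := \int[mu]_(t in I) u t ^+ 2.
have S0 : 0 <= S by apply: Rintegral_ge0 => t _; exact: sqr_ge0.
exists (`|u 0| + (1 + G) / 2 + (1 + S)) => x Ix.
have x0 := Ige0 x Ix; have u00 := normr_ge0 (u 0).
have [x1|x1] := leP x 1.
  have := H1_increment eI ug (_ : 0 <= 0 <= x) Ix.
  rewrite lexx x0 subr0 -/G => /(_ isT).
  by have := ler_normD (u x - u 0) (u 0); rewrite subrK; lra.
rewrite leNgt; apply/negP => big.
have sub : `[x - 1, x] `<=` I.
  move=> t; rewrite /= in_itv/= => /andP[yt tx].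
  by apply: (Iconv x); rewrite // tx andbT; lra.
have lower t : `[x - 1, x]%classic t -> (1 + S) ^+ 2 <= u t ^+ 2.
  move=> tx; have /= := tx; rewrite in_itv/= => /andP[t1 t2].
  have := H1_increment eI ug (_ : 0 <= t <= x) Ix.
  rewrite -/G => /(_ _)/wrap[]; first by rewrite t2 andbT; lra.
  have := ler_normD (u x - u t) (u t); rewrite subrK => h1 h2.
  rewrite -[u t ^+ 2]real_normK ?num_real// lerXn2r ?nnegrE//; lra.
have u2s := L2_summable_sqr mI uL2.
have : \int[mu]_(t in `[x - 1, x]) (1 + S) ^+ 2 <= S.
  apply: (@le_trans _ _ (\int[mu]_(t in `[x - 1, x]) u t ^+ 2)).
    apply: le_Rintegral => //.
    - exact: (@continuous_integrable _ (fun=> (1 + S) ^+ 2) _ _ (fun x => cvg_cst _)).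
    - exact: summable_sub u2s.
  apply: le_Rintegral_subset => // t _; exact: sqr_ge0.
rewrite Rintegral_itv_cst; last lra.
by rewrite (_ : x - (x - 1) = 1); [nra|ring].
Qed.

Lemma H1_summable_pabs p I u : 2 < p -> edge_interval I -> H1 I u ->
  summable I (fun x => pabs p (u x)).
Proof.
move=> p2 eI uH1; have [B uB] := H1_bounded eI uH1; have [uL2 _] := uH1.
have mI : measurable I by case: eI.
apply: (@summable_le _ _ _ (fun x => B `^ (p - 2) * u x ^+ 2)) => //.
- apply: measurableT_comp; last exact: L2_measurable.
  exact: continuous_measurable_fun (continuous_pabs p2).
- move=> x Ix; rewrite ger0_norm ?pabs_ge0// pabs_sqr//.
  apply: ler_wpM2r; first exact: sqr_ge0.
  apply: ge0_ler_powR; rewrite ?nnegrE//; first lra.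
    exact: le_trans (uB x Ix).
  exact: uB.
- by apply: summableZ => //; exact: L2_summable_sqr.
Qed.

(** Some weak derivative is square integrable by [H1 I u]; the classical one agrees with it almost
    everywhere and inherits this. *)
Lemma classical_weak_derivative I u du : edge_interval I -> H1 I u ->
  (forall x : R, is_derive x 1 u (du x)) -> continuous du ->
  is_weak_derivative I u du.
Proof.
move=> eI [uL2 [g ug]] udu cdu; have [mI I0 Ige0 Iconv _] := eI.
have mdu : measurable_fun I du.
  by apply: measurable_funTS; exact: continuous_measurable_fun.
have ftc x : I x -> u x = u 0 + \int[mu]_(t in `[0, x]) du t.
  by move=> Ix; rewrite (Rintegral_FTC _ udu cdu) ?Ige0// addrC subrK.
split => //; apply/(L2P _ mI); split => //.
have [gL2 ugE] := ug.
have ae : {ae mu, forall x, I x -> g x = du x}.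
  apply: weak_derivative_unique_loc ugE ftc => //.
  - exact: L2_measurable gL2.
  - by move=> x Ix; exact: L2_summable_itv (edge_interval_sub eI Ix) gL2.
  - by move=> x Ix; exact: continuous_integrable.
have g2s := L2_summable_sqr mI gL2.
have mdu2 : measurable_fun I (fun x => du x ^+ 2) by exact: measurable_funX.
apply/integrableP; split; first exact/measurable_EFinP.
move: g2s => /integrableP[mg2]; apply: le_lt_trans.
rewrite le_eqVlt; apply/orP; left; apply/eqP; apply: ae_eq_integral => //.
- by apply: measurableT_comp => //; exact/measurable_EFinP.
- by apply: measurableT_comp.
- have FF := ae_filter_ringOfSetsType mu.
  by apply: filterS ae => x h Ix; rewrite /= h.
Qed.

End Half_line_integrals.

(** * Decay, Nehari identity and action of a solution *)

Section Solutions_on_edges.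
Context {R : realType}.
Local Notation mu := (@lebesgue_measure R).
Implicit Types (I : set R) (f g u v F dF : R -> R) (p lam ell : R).

Lemma eq_L2 I u v : (forall x, I x -> u x = v x) -> L2 I u -> L2 I v.
Proof.
move=> uv; rewrite /L2 (_ : u \_ I = v \_ I)//.
by apply/funext => x; rewrite !patchE; case: ifP => // /set_mem/uv.
Qed.

Lemma eq_is_weak_derivative I u v g : I 0 -> (forall x, I x -> u x = v x) ->
  is_weak_derivative I u g -> is_weak_derivative I v g.
Proof.
move=> I0 uv [gL2 ug]; split => // x Ix.
by rewrite -uv// -uv// ug.
Qed.

Lemma eq_H1 I u v : I 0 -> (forall x, I x -> u x = v x) -> H1 I u -> H1 I v.
Proof.
move=> I0 uv [uL2 [g ug]]; split; first exact: eq_L2 uv uL2.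
by exists g; exact: eq_is_weak_derivative uv ug.
Qed.

Lemma classical_H1 I u du : edge_interval I -> L2 I u -> L2 I du ->
  (forall x : R, is_derive x 1 u (du x)) -> continuous du -> H1 I u.
Proof.
move=> eI uL2 duL2 udu cdu; have [_ _ Ige0 _ _] := eI.
split => //; exists du; split => // x Ix.
by rewrite (Rintegral_FTC _ udu cdu) ?Ige0// addrC subrK.
Qed.

Lemma ode_continuous p lam I f df : ode_solution p lam I f df -> continuous f.
Proof. by move=> [fdf _ _] x; exact: deriv_continuous (fdf x). Qed.

Lemma continuous_sqr f : continuous f -> continuous (fun x => f x ^+ 2).
Proof.
move=> cf x; apply: (@continuous_comp _ _ _ f (fun y => y ^+ 2));
  [exact: cf|exact: exprn_continuous].
Qed.

Lemma continuous_pabs_comp p f : 2 < p -> continuous f ->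
  continuous (fun x => pabs p (f x)).
Proof.
move=> p2 cf x; apply: (@continuous_comp _ _ _ f (pabs p));
  [exact: cf|exact: continuous_pabs].
Qed.

Lemma force_mul p lam y : 2 < p ->
  y * force p lam y = lam * y ^+ 2 - pabs p y.
Proof. by move=> p2; rewrite /force mulrBr -psgn_mul//; ring. Qed.

Lemma deriv_virial p lam I f df x : 2 < p -> ode_solution p lam I f df -> I x ->
  is_derive x 1 (fun t => f t * df t)
    (df x ^+ 2 + lam * f x ^+ 2 - pabs p (f x)).
Proof.
move=> p2 [fdf _ ode] Ix; have := deriv_mul (fdf x) (ode x Ix).
by move/is_derive_eq; apply; rewrite force_mul// addrA expr2.
Qed.

Section Half_line.
Context p lam f df (p2 : 2 < p) (ode : ode_solution p lam (@half_line R) f df)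
  (fH1 : H1 (@half_line R) f).

Let mI : measurable (@half_line R). Proof. exact: measurable_itv. Qed.

Lemma half_line_deriv_weak : is_weak_derivative (@half_line R) f df.
Proof.
have [fdf cdf _] := ode.
exact: classical_weak_derivative (edge_interval_half_line (R := R)) fH1 fdf cdf.
Qed.

Lemma half_line_summable : [/\ summable (@half_line R) (fun x => f x ^+ 2),
  summable (@half_line R) (fun x => df x ^+ 2)
  & summable (@half_line R) (fun x => pabs p (f x))].
Proof.
split.
- by apply: L2_summable_sqr => //; case: fH1.
- by apply: L2_summable_sqr => //; case: half_line_deriv_weak.
- exact: H1_summable_pabs p2 (edge_interval_half_line (R := R)) fH1.
Qed.

(* The conserved quantity [df^2/2 - potential f] is integrable on the half-line, hence zero. *)
Lemma half_line_energy x : 0 <= x -> df x ^+ 2 = 2 * potential p lam (f x).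
Proof.
move=> x0; have [f2s df2s fps] := half_line_summable.
pose E y := df y ^+ 2 / 2 - potential p lam (f y).
have EE y : 0 <= y -> E y = E x.
  have E0 z : 0 <= z -> E z = E 0.
    move=> z0; apply: (ode_energy p2 ode z0) => t /andP[t0 _].
    by rewrite half_lineE.
  by move=> y0; rewrite !E0.
have Es : summable (@half_line R) E.
  apply: (@summable_eq _ _ (fun y => 2^-1 * df y ^+ 2 -
      ((lam / 2) * f y ^+ 2 - p^-1 * pabs p (f y)))) => //.
    by move=> y _; rewrite /E /potential; ring.
  by do 2 (apply: summableB => //; [exact: summableZ|]); exact: summableZ.
have [E0|En0] := eqVneq (E x) 0.
  by move: E0; rewrite /E => /eqP; rewrite subr_eq0 => /eqP <-; field.
have Ex0 : 0 < `|E x| by rewrite normr_gt0.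
have := @half_line_not_summable _ (fun y => `|E y|) _ 0 Ex0 (lexx _).
case; last exact: summable_abs.
by move=> y y0; rewrite EE.
Qed.

(** The energy identity without its nonpositive term. Here [lam] may have either sign, hence the
    absolute value. This is the growth bound that [summable_decay] requires. *)
Lemma half_line_deriv_le x : 0 <= x -> `|df x| <= Num.sqrt `|lam| * `|f x|.
Proof.
move=> x0; rewrite -(@ler_pXn2r _ 2)// ?nnegrE// ?mulr_ge0// ?sqrtr_ge0//.
rewrite exprMn sqr_sqrtr// !real_normK ?num_real//.
rewrite half_line_energy// /potential.
have : 0 <= pabs p (f x) / p.
  by rewrite divr_ge0 ?pabs_ge0// (le_trans _ (ltW p2)).
by have := ler_norm lam; have := sqr_ge0 (f x); nra.
Qed.

Lemma half_line_cvg0 : f x @[x --> +oo] --> 0 /\ df x @[x --> +oo] --> 0.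
Proof.
have [fdf cdf _] := ode; have [f2s _ _] := half_line_summable.
have f0 : f x @[x --> +oo] --> 0.
  exact: (summable_decay (sqrtr_ge0 _) fdf half_line_deriv_le f2s).
split => //; apply/cvgrPdist_lt => e e0.
pose K := Num.sqrt `|lam| + 1.
have K0 : 0 < K by rewrite ltr_wpDl ?sqrtr_ge0.
have /cvgrPdist_lt/(_ (e / K)) := f0; rewrite divr_gt0// => /(_ isT) h.
near=> x; have x0 : 0 <= x by near: x; exact: nbhs_pinfty_ge.
rewrite sub0r normrN; apply: le_lt_trans (half_line_deriv_le x0) _.
apply: (@le_lt_trans _ _ (K * `|f x|)).
  by rewrite ler_wpM2r// /K lerDl.
rewrite mulrC -ltr_pdivlMr// -normrN -sub0r.
by near: x.
Unshelve. all: by end_near. Qed.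

(** The combined integrand is the derivative of [f * df], a product that tends to 0 at infinity. *)
Lemma half_line_nehari :
  \int[mu]_(x in @half_line R) df x ^+ 2
  + lam * \int[mu]_(x in @half_line R) f x ^+ 2
  - \int[mu]_(x in @half_line R) pabs p (f x) = - (f 0 * df 0).
Proof.
have [fdf cdf _] := ode; have [f2s df2s fps] := half_line_summable.
have cf := ode_continuous ode.
rewrite -RintegralZl// -RintegralD//; last exact: summableZ.
rewrite -RintegralB//; last by apply: summableD => //; exact: summableZ.
have [f0 df0] := half_line_cvg0.
have [G dG] : exists G : R -> R, forall x : R, is_derive x 1 G
    (df x ^+ 2 + lam * f x ^+ 2 - pabs p (f x)).
  apply: antiderivative_exists => x; apply: cvgB; last exact: continuous_pabs_comp.
  by apply: cvgD; [exact: continuous_sqr|apply: cvgMr; exact: continuous_sqr].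
have GE x : 0 <= x -> G x - G 0 = f x * df x - f 0 * df 0.
  move=> x0; suff : G x - f x * df x = G 0 - f 0 * df 0 by lra.
  apply: (@deriv_eq0_cst _ (fun t => G t - f t * df t)
    (fun t => (df t ^+ 2 + lam * f t ^+ 2 - pabs p (f t))
       - (df t ^+ 2 + lam * f t ^+ 2 - pabs p (f t))) _ _ x0).
  - move=> t _; apply: cvgB; first exact: deriv_continuous (dG t).
    by apply: cvgM; [exact: cf|exact: cdf].
  - move=> t /andP[t0 _]; apply: deriv_sub => //.
    by apply: (deriv_virial p2 ode); rewrite half_lineE ltW.
  - by move=> t _; rewrite subrr.
rewrite (half_line_FTC (F := G) (l := G 0 - f 0 * df 0) dG); first by ring.
- move=> x; apply: cvgB; last exact: continuous_pabs_comp.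
  by apply: cvgD; [exact: continuous_sqr|apply: cvgMr; exact: continuous_sqr].
- apply: summableB => //; apply: summableD => //; exact: summableZ.
- have : f x * df x + (G 0 - f 0 * df 0) @[x --> +oo] --> 0 * 0 + (G 0 - f 0 * df 0).
    by apply: cvgD; [exact: cvgM|exact: cvg_cst].
  rewrite mul0r add0r; apply: cvg_trans; apply: near_eq_cvg; near=> x.
  have x0 : 0 <= x by near: x; exact: nbhs_pinfty_ge.
  by have := GE x x0; lra.
Unshelve. all: by end_near. Qed.

End Half_line.

Lemma virial_itv p lam I f df (a b : R) : 2 < p -> ode_solution p lam I f df ->
  a <= b -> (forall x, a <= x <= b -> I x) ->
  \int[mu]_(x in `[a, b]) df x ^+ 2 + lam * \int[mu]_(x in `[a, b]) f x ^+ 2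
  - \int[mu]_(x in `[a, b]) pabs p (f x) = f b * df b - f a * df a.
Proof.
move=> p2 ode ab abI; have [fdf cdf _] := ode.
have cf := ode_continuous ode.
have c1 := continuous_sqr cf; have c2 := continuous_sqr cdf.
have c3 := continuous_pabs_comp p2 cf.
have c : continuous (fun x => df x ^+ 2 + lam * f x ^+ 2 - pabs p (f x)).
  by move=> x; apply: cvgB; [apply: cvgD; [exact: c2|apply: cvgMr; exact: c1]|exact: c3].
have s1 := continuous_integrable a b c1.
have s2 := continuous_integrable a b c2.
have s3 := continuous_integrable a b c3.
rewrite -RintegralZl// -RintegralD//; last exact: summableZ.
rewrite -RintegralB//; last by apply: summableD => //; exact: summableZ.
have [G dG] := antiderivative_exists c.
rewrite (Rintegral_FTC ab dG c).
suff : G b - f b * df b = G a - f a * df a by lra.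
apply: (@deriv_eq0_cst _ (fun t => G t - f t * df t)
    (fun t => (df t ^+ 2 + lam * f t ^+ 2 - pabs p (f t))
       - (df t ^+ 2 + lam * f t ^+ 2 - pabs p (f t))) _ _ ab).
- move=> t _; apply: cvgB; first exact: deriv_continuous (dG t).
  by apply: cvgM; [exact: cf|exact: cdf].
- move=> t /andP[t0 t1]; apply: deriv_sub => //.
  by apply: (deriv_virial p2 ode); apply: abI; rewrite !ltW.
- by move=> t _; rewrite subrr.
Qed.

Lemma RintegralI3E ell f : \int[mu]_(x in terminal_edge ell) f x =
  \int[mu]_(x in `[0, ell]) f x.
Proof. by []. Qed.

(** A solution seen through extensions of its three components: [f1], [f2], [f3] have the two-sided
    derivatives [g1], [g2], [g3] on the whole line, but agree with [u] and satisfy the equation on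
    their edges only. *)
Record split_solution p lam ell (u : gfun R) (f1 g1 f2 g2 f3 g3 : R -> R) : Prop :=
  SplitSolution {
  split_ode1 : ode_solution p lam (@half_line R) f1 g1;
  split_ode2 : ode_solution p lam (@half_line R) f2 g2;
  split_ode3 : ode_solution p lam (terminal_edge ell) f3 g3;
  split_H1_1 : H1 (@half_line R) f1;
  split_H1_2 : H1 (@half_line R) f2;
  split_H1_3 : H1 (terminal_edge ell) f3;
  split_eq1 : forall x, 0 <= x -> f1 x = e1 u x;
  split_eq2 : forall x, 0 <= x -> f2 x = e2 u x;
  split_eq3 : forall x, 0 <= x <= ell -> f3 x = e3 u x;
  split_vertex12 : f1 0 = f2 0;
  split_vertex23 : f2 0 = f3 0;
  split_kirchhoff : g1 0 + g2 0 + g3 0 = 0;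
  split_neumann : g3 ell = 0 }.

Lemma solution_split p lam ell (u : gfun R) : 2 < p -> 0 < ell -> solution ell p lam u ->
  exists f1 g1 f2 g2 f3 g3, split_solution p lam ell u f1 g1 f2 g2 f3 g3.
Proof.
move=> p2 l0 [[h1 h2 h3 v12 v23] [du [s1 s2 s3 kir neu]]].
have l0' : (0 : R) <= 0 <= ell by apply/andP; split; [exact: lexx|exact: ltW].
have ll : 0 <= ell <= ell by apply/andP; split; [exact: ltW|exact: lexx].
have [f1 [g1 [so1 fe1 ge1]]] := ode_extension_half_line p2 s1.
have [f2 [g2 [so2 fe2 ge2]]] := ode_extension_half_line p2 s2.
have [f3 [g3 [so3 fe3 ge3]]] := ode_extension_edge p2 l0 s3.
exists f1, g1, f2, g2, f3, g3; split => //.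
- apply: eq_H1 h1; first by rewrite half_lineE.
  by move=> x; rewrite half_lineE => /fe1.
- apply: eq_H1 h2; first by rewrite half_lineE.
  by move=> x; rewrite half_lineE => /fe2.
- apply: eq_H1 h3; first by rewrite terminal_edgeE.
  by move=> x; rewrite terminal_edgeE => /fe3.
- by rewrite fe1 ?fe2.
- by rewrite fe2 ?fe3.
- by rewrite ge1 ?ge2 ?ge3.
- by rewrite ge3.
Qed.

Definition kinetic ell (u : gfun R) : R :=
  gintegral ell (fun y => `|y| ^+ 2) (gderivative ell u).

Section Split.
Context p lam ell (u : gfun R) f1 g1 f2 g2 f3 g3 (p2 : 2 < p) (l0 : 0 < ell)
  (us : split_solution p lam ell u f1 g1 f2 g2 f3 g3).

Lemma split_gintegral (F : R -> R) : gintegral ell F u =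
  \int[mu]_(x in @half_line R) F (f1 x) + \int[mu]_(x in @half_line R) F (f2 x)
  + \int[mu]_(x in `[0, ell]) F (f3 x).
Proof.
rewrite /gintegral RintegralI3E; congr (_ + _ + _); apply: eq_Rintegral => x.
- by rewrite inE half_lineE => x0; rewrite (split_eq1 us).
- by rewrite inE half_lineE => x0; rewrite (split_eq2 us).
- by rewrite inE /= in_itv/= => x0; rewrite (split_eq3 us).
Qed.

Lemma split_kinetic : kinetic ell u =
  \int[mu]_(x in @half_line R) g1 x ^+ 2 + \int[mu]_(x in @half_line R) g2 x ^+ 2
  + \int[mu]_(x in `[0, ell]) g3 x ^+ 2.
Proof.
have eH := edge_interval_half_line (R := R).
have eE := edge_interval_terminal_edge l0.
rewrite /kinetic /gintegral/=; congr (_ + _ + _); apply: weak_derivativeP => //.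
- have := half_line_deriv_weak (split_ode1 us) (split_H1_1 us).
  apply: eq_is_weak_derivative; first by rewrite half_lineE.
  by move=> x; rewrite half_lineE => /(split_eq1 us).
- have := half_line_deriv_weak (split_ode2 us) (split_H1_2 us).
  apply: eq_is_weak_derivative; first by rewrite half_lineE.
  by move=> x; rewrite half_lineE => /(split_eq2 us).
- have [fdf cdf _] := split_ode3 us.
  have := classical_weak_derivative eE (split_H1_3 us) fdf cdf.
  apply: eq_is_weak_derivative; first by rewrite terminal_edgeE lexx ltW.
  by move=> x; rewrite terminal_edgeE => /(split_eq3 us).
Qed.

Lemma split_nehari :
  kinetic ell u + lam * gintegral ell (fun y => y ^+ 2) u
  = gintegral ell (pabs p) u.
Proof.
rewrite split_kinetic !split_gintegral.
have := half_line_nehari p2 (split_ode1 us) (split_H1_1 us).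
have := half_line_nehari p2 (split_ode2 us) (split_H1_2 us).
have := virial_itv p2 (split_ode3 us) (ltW l0) (fun x h => h).
rewrite (split_neumann us) -(split_vertex23 us) -(split_vertex12 us).
have := split_kirchhoff us.
move: (g1 0) (g2 0) (g3 0) (f1 0) => a b c d.
move: (\int[mu]_(x in _) _) (\int[mu]_(x in _) _) (\int[mu]_(x in _) _).
move=> A B D.
move: (\int[mu]_(x in _) _) (\int[mu]_(x in _) _) (\int[mu]_(x in _) _).
move=> A' B' D'.
move: (\int[mu]_(x in _) _) (\int[mu]_(x in _) _) (\int[mu]_(x in _) _).
move=> A'' B'' D'' h1 h2 h3 h4.
(* [d] is the common value at the vertex: the boundary terms of the three edges add up to [d] times
   the Kirchhoff sum. *)
have : d * (a + b + c) = 0 by rewrite h1 mulr0.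
by lra.
Qed.

(** The Nehari identity replaces the quadratic part of the action by half the integral of |u|^p. *)
Lemma split_action : action ell p lam u =
  (2^-1 - p^-1) * gintegral ell (pabs p) u.
Proof.
rewrite /action -/(kinetic ell u) split_nehari /pabs; ring.
Qed.

End Split.

Lemma solution_nehari p lam ell (u : gfun R) : 2 < p -> 0 < ell -> solution ell p lam u ->
  kinetic ell u + lam * gintegral ell (fun y => y ^+ 2) u
  = gintegral ell (pabs p) u.
Proof.
move=> p2 l0 /(solution_split p2 l0)[f1 [g1 [f2 [g2 [f3 [g3 us]]]]]].
exact: split_nehari us.
Qed.

End Solutions_on_edges.

(** * Convexity of the power and linear combinations of weak derivatives *)

Section Convexity.
Context {R : realType}.
Local Notation mu := (@lebesgue_measure R).
Implicit Types (I : set R) (u v g h phi : R -> R) (p y z : R).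

Lemma psgn_homo p y z : 2 < p -> y <= z -> psgn p y <= psgn p z.
Proof.
move=> p2; have pos a b : 0 <= a -> a <= b -> psgn p a <= psgn p b.
  move=> a0 ab; have b0 := le_trans a0 ab.
  rewrite !psgn_ge0E//; apply: ler_pM => //; first exact: powR_ge0.
  by apply: ge0_ler_powR; rewrite ?nnegrE//; lra.
move=> yz; have [y0|y0] := leP 0 y; first exact: pos.
have [z0|z0] := leP z 0.
  by rewrite -lerN2 -!psgnN; apply: pos; [rewrite oppr_ge0|rewrite lerN2].
apply: (@le_trans _ _ 0).
  by rewrite -oppr_ge0 -psgnN -(psgn0 p); apply: pos => //; rewrite oppr_ge0 ltW.
by rewrite -(psgn0 p); apply: pos => //; exact: ltW.
Qed.

Lemma pabs_tangent p y z : 2 < p ->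
  pabs p y + p * psgn p y * (z - y) <= pabs p z.
Proof.
move=> p2; have [yz|yz|->] := ltgtP y z; last by rewrite subrr mulr0 addr0.
- have [c /andP[yc cz] E] := mean_value yz (fun x _ => @continuous_pabs _ p p2 x)
    (fun x _ => deriv_pabs p2 x).
  have h := psgn_homo p2 (ltW yc).
  have zy : 0 < z - y by lra.
  by rewrite -lerBrDl E ler_pM2r// ler_pM2l//; lra.
- have [c /andP[zc cy] E] := mean_value yz (fun x _ => @continuous_pabs _ p p2 x)
    (fun x _ => deriv_pabs p2 x).
  have h := psgn_homo p2 (ltW cy).
  have zy : 0 < y - z by lra.
  suff : p * psgn p c * (y - z) <= p * psgn p y * (y - z) by move: E; lra.
  by rewrite ler_pM2r// ler_pM2l//; lra.
Qed.

Lemma psgn_L2 p I u : 2 < p -> edge_interval I -> H1 I u ->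
  L2 I (fun x => psgn p (u x)).
Proof.
move=> p2 eI uH1; have [B uB] := H1_bounded eI uH1; have [uL2 _] := uH1.
have mI : measurable I by case: eI.
have mpu : measurable_fun I (fun x => psgn p (u x)).
  apply: measurableT_comp; last exact: L2_measurable.
  exact: continuous_measurable_fun (continuous_psgn p2).
apply/(L2P _ mI); split => //.
apply: (@summable_le _ _ _ (fun x => (B `^ (p - 2)) ^+ 2 * u x ^+ 2)) => //.
- exact: measurable_funX.
- move=> x Ix; rewrite ger0_norm ?sqr_ge0// /psgn exprMn.
  apply: ler_wpM2r; first exact: sqr_ge0.
  rewrite lerXn2r ?nnegrE ?powR_ge0//.
  apply: ge0_ler_powR; rewrite ?nnegrE//; first lra.
    exact: le_trans (uB x Ix).
  exact: uB.
- by apply: summableZ => //; exact: L2_summable_sqr.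
Qed.

Lemma Rintegral_sqr_linear I u v (a b : R) : measurable I -> L2 I u -> L2 I v ->
  \int[mu]_(x in I) (a * u x + b * v x) ^+ 2 =
  a ^+ 2 * \int[mu]_(x in I) u x ^+ 2
  + 2 * a * b * \int[mu]_(x in I) (u x * v x)
  + b ^+ 2 * \int[mu]_(x in I) v x ^+ 2.
Proof.
move=> mI uL2 vL2.
have s1 := L2_summable_sqr mI uL2; have s2 := L2_summable_sqr mI vL2.
have s3 := L2_summable_mul mI uL2 vL2.
have t1 := summableZ (a ^+ 2) mI s1; have t2 := summableZ (b ^+ 2) mI s2.
have t3 := summableZ (2 * a * b) mI s3; have t13 := summableD mI t1 t3.
rewrite -!RintegralZl// -RintegralD// -RintegralD//.
by apply: eq_Rintegral => x _; ring.
Qed.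

Lemma Rintegral_pabs_tangent p I u v (e : R) : 2 < p -> edge_interval I ->
  H1 I u -> H1 I v -> H1 I (fun x => u x + e * v x) ->
  \int[mu]_(x in I) pabs p (u x)
  + p * e * \int[mu]_(x in I) (psgn p (u x) * v x) <=
  \int[mu]_(x in I) pabs p (u x + e * v x).
Proof.
move=> p2 eI uH vH wH; have mI : measurable I by case: eI.
have s1 := H1_summable_pabs p2 eI uH; have s2 := H1_summable_pabs p2 eI wH.
have s3 := L2_summable_mul mI (psgn_L2 p2 eI uH) vH.1.
rewrite -RintegralZl// -RintegralD//; last exact: summableZ.
apply: le_Rintegral => //; first by apply: summableD => //; exact: summableZ.
move=> x _; have := pabs_tangent (u x) (u x + e * v x) p2.
by rewrite addrAC subrr add0r; lra.
Qed.

Lemma is_weak_derivative_linear I u v g h (a b : R) : edge_interval I ->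
  is_weak_derivative I u g -> is_weak_derivative I v h ->
  is_weak_derivative I (fun x => a * u x + b * v x) (fun x => a * g x + b * h x).
Proof.
move=> eI [gL2 ug] [hL2 vh]; have mI : measurable I by case: eI.
split => [|x Ix]; first exact: L2_linear.
have s1 := L2_summable_itv mI (edge_interval_sub eI Ix) gL2.
have s2 := L2_summable_itv mI (edge_interval_sub eI Ix) hL2.
rewrite RintegralD//; [|exact: summableZ|exact: summableZ].
by rewrite !RintegralZl// (ug x Ix) (vh x Ix); ring.
Qed.

End Convexity.

(** * Functionals on the graph and the first variation of the energy *)

Section Graph_functionals.
Context {R : realType}.
Local Notation mu := (@lebesgue_measure R).
Implicit Types (u v du dv : gfun R) (p ell a b t lam nu : R).

Definition glinear a u b v : gfun R :=
  GFun (fun x => a * e1 u x + b * e1 v x) (fun x => a * e2 u x + b * e2 v x)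
       (fun x => a * e3 u x + b * e3 v x).

Definition gscale t u : gfun R :=
  GFun (fun x => t * e1 u x) (fun x => t * e2 u x) (fun x => t * e3 u x).

Lemma gscale1 u : gscale 1 u = u.
Proof. by case: u => a b c; rewrite /gscale; f_equal; apply/funext => x; rewrite /= mul1r. Qed.

Definition ginner ell u v : R :=
  \int[mu]_(x in @half_line R) (e1 u x * e1 v x)
  + \int[mu]_(x in @half_line R) (e2 u x * e2 v x)
  + \int[mu]_(x in terminal_edge ell) (e3 u x * e3 v x).

Definition gL2 ell u : Prop :=
  [/\ L2 (@half_line R) (e1 u), L2 (@half_line R) (e2 u)
    & L2 (terminal_edge ell) (e3 u)].

Definition graph_weak_derivative ell u du : Prop :=
  [/\ is_weak_derivative (@half_line R) (e1 u) (e1 du),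
      is_weak_derivative (@half_line R) (e2 u) (e2 du)
    & is_weak_derivative (terminal_edge ell) (e3 u) (e3 du)].

Lemma gscaleE t u : gscale t u = glinear t u 0 u.
Proof. by rewrite /gscale /glinear; f_equal; apply/funext => x; rewrite mul0r addr0. Qed.

Lemma H1_graph_gL2 ell u : H1_graph ell u -> gL2 ell u.
Proof. by move=> [[? _] [? _] [? _] _ _]. Qed.

Lemma graph_weak_derivative_gL2 ell u du :
  graph_weak_derivative ell u du -> gL2 ell du.
Proof. by move=> [[? _] [? _] [? _]]. Qed.

Lemma H1_graph_weak ell u : H1_graph ell u ->
  exists du, graph_weak_derivative ell u du.
Proof.
by move=> [[_ [g1 ?]] [_ [g2 ?]] [_ [g3 ?]] _ _]; exists (GFun g1 g2 g3).
Qed.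

Lemma graph_weak_derivative_linear ell u v du dv a b : 0 < ell ->
  graph_weak_derivative ell u du -> graph_weak_derivative ell v dv ->
  graph_weak_derivative ell (glinear a u b v) (glinear a du b dv).
Proof.
move=> l0 [u1 u2 u3] [v1 v2 v3].
have eH := edge_interval_half_line (R := R).
have eE := edge_interval_terminal_edge l0.
by split; exact: is_weak_derivative_linear.
Qed.

Lemma gL2_linear ell u v a b : gL2 ell u -> gL2 ell v ->
  gL2 ell (glinear a u b v).
Proof.
move=> [u1 u2 u3] [v1 v2 v3].
by split; apply: L2_linear => //; exact: measurable_itv.
Qed.

Lemma H1_graph_linear ell u v a b : 0 < ell -> H1_graph ell u -> H1_graph ell v ->
  H1_graph ell (glinear a u b v).
Proof.
move=> l0 uH vH.
have [du ud] := H1_graph_weak uH; have [dv vd] := H1_graph_weak vH.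
have [w1 w2 w3] := graph_weak_derivative_linear a b l0 ud vd.
have [l1 l2 l3] := gL2_linear a b (H1_graph_gL2 uH) (H1_graph_gL2 vH).
case: uH => _ _ _ uv1 uv2; case: vH => _ _ _ vv1 vv2.
split; [split => //; eexists; exact: w1|split => //; eexists; exact: w2|
  split => //; eexists; exact: w3| |]; by rewrite /= ?uv1 ?uv2 ?vv1 ?vv2.
Qed.

Lemma kinetic_weak ell u du : 0 < ell -> graph_weak_derivative ell u du ->
  kinetic ell u = gintegral ell (fun y => y ^+ 2) du.
Proof.
move=> l0 [u1 u2 u3].
have eH := edge_interval_half_line (R := R).
have eE := edge_interval_terminal_edge l0.
by rewrite /kinetic /gintegral/=; congr (_ + _ + _); exact: weak_derivativeP.
Qed.

Lemma mass_sqr ell u : mass ell u = gintegral ell (fun y => y ^+ 2) u.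
Proof.
rewrite /mass /gintegral; congr (_ + _ + _); apply: eq_Rintegral => x _;
  by rewrite real_normK ?num_real.
Qed.

Lemma gintegral_sqr_linear ell u v a b : gL2 ell u -> gL2 ell v ->
  gintegral ell (fun y => y ^+ 2) (glinear a u b v) =
  a ^+ 2 * gintegral ell (fun y => y ^+ 2) u + 2 * a * b * ginner ell u v
  + b ^+ 2 * gintegral ell (fun y => y ^+ 2) v.
Proof.
move=> [u1 u2 u3] [v1 v2 v3]; rewrite /gintegral /ginner/=.
rewrite !Rintegral_sqr_linear//; try exact: measurable_itv.
by ring.
Qed.

Lemma mass_scale ell u t : gL2 ell u -> mass ell (gscale t u) = t ^+ 2 * mass ell u.
Proof.
by move=> u2; rewrite !mass_sqr gscaleE gintegral_sqr_linear//; ring.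
Qed.

Lemma kinetic_scale ell u t : 0 < ell -> H1_graph ell u ->
  kinetic ell (gscale t u) = t ^+ 2 * kinetic ell u.
Proof.
move=> l0 /H1_graph_weak[du ud].
rewrite (kinetic_weak l0 ud) gscaleE.
rewrite (kinetic_weak l0 (graph_weak_derivative_linear t 0 l0 ud ud)).
have d2 := graph_weak_derivative_gL2 ud.
by rewrite gintegral_sqr_linear//; ring.
Qed.

Lemma H1_graph_scale ell u t : 0 < ell -> H1_graph ell u -> H1_graph ell (gscale t u).
Proof. by move=> l0 uH; rewrite gscaleE; exact: H1_graph_linear. Qed.

Lemma gintegral_pabs_scale p ell u t : 2 < p -> 0 < ell -> 0 <= t -> H1_graph ell u ->
  gintegral ell (pabs p) (gscale t u) = t `^ p * gintegral ell (pabs p) u.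
Proof.
move=> p2 l0 t0 [u1 u2 u3 _ _].
have eH := edge_interval_half_line (R := R).
have eE := edge_interval_terminal_edge l0.
have mH : measurable (@half_line R) by exact: measurable_itv.
have mE : measurable (terminal_edge ell) by exact: measurable_itv.
have s1 := H1_summable_pabs p2 eH u1; have s2 := H1_summable_pabs p2 eH u2.
have s3 := H1_summable_pabs p2 eE u3.
have scale I f : measurable I -> summable I (fun x => pabs p (f x)) ->
    \int[mu]_(x in I) pabs p (t * f x) = t `^ p * \int[mu]_(x in I) pabs p (f x).
  move=> mI sI; rewrite -RintegralZl//; apply: eq_Rintegral => x _.
  by rewrite /pabs normrM powRM// ger0_norm.
rewrite /gintegral (scale _ _ mH s1) (scale _ _ mH s2) (scale _ _ mE s3).
have alg (k a b c : R) : k * a + k * b + k * c = k * (a + b + c) by ring.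
exact: alg.
Qed.

Definition gpsgn p u : gfun R :=
  GFun (fun x => psgn p (e1 u x)) (fun x => psgn p (e2 u x))
       (fun x => psgn p (e3 u x)).

Lemma gintegral_pabs_tangent p ell u v (e : R) : 2 < p -> 0 < ell ->
  H1_graph ell u -> H1_graph ell v ->
  gintegral ell (pabs p) u + p * e * ginner ell (gpsgn p u) v
  <= gintegral ell (pabs p) (glinear 1 u e v).
Proof.
move=> p2 l0 uH vH.
have eH := edge_interval_half_line (R := R).
have eE := edge_interval_terminal_edge l0.
have wH := H1_graph_linear 1 e l0 uH vH.
have wE : glinear 1 u e v = GFun (fun x => e1 u x + e * e1 v x)
    (fun x => e2 u x + e * e2 v x) (fun x => e3 u x + e * e3 v x).
  by rewrite /glinear; f_equal; apply/funext => x; rewrite mul1r.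
rewrite wE in wH *.
case: uH => u1 u2 u3 _ _; case: vH => v1 v2 v3 _ _; case: wH => w1 w2 w3 _ _.
have alg (a b c x y z A B C k : R) : a + k * x <= A -> b + k * y <= B ->
  c + k * z <= C -> a + b + c + k * (x + y + z) <= A + B + C by lra.
exact: alg (Rintegral_pabs_tangent p2 eH u1 v1 w1)
  (Rintegral_pabs_tangent p2 eH u2 v2 w2) (Rintegral_pabs_tangent p2 eE u3 v3 w3).
Qed.

Lemma energyE ell p u :
  energy ell p u = 2^-1 * kinetic ell u - p^-1 * gintegral ell (pabs p) u.
Proof. by []. Qed.

(** The one-variable core of the Euler-Lagrange equation. [K] and [P] are the kinetic and p-power
    integrals of u; [X1], [X2] are the coefficients of the mass of u + e v, [Y1], [Y2] those of its
    kinetic integral, and [Z] pairs |u|^(p-2) u with v. The right-hand side equals the left at e =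
    0, so its derivative vanishes there; the multiplier (P - K) / nu comes from differentiating the
    renormalizing factor. *)
Lemma renormalized_energy_min p nu K P X1 X2 Y1 Y2 Z : 2 < p -> 0 < nu ->
  (forall e : R, 0 < nu + 2 * X1 * e + X2 * e ^+ 2 ->
    2^-1 * K - p^-1 * P <=
    2^-1 * (nu / (nu + 2 * X1 * e + X2 * e ^+ 2) * (K + 2 * Y1 * e + Y2 * e ^+ 2))
    - p^-1 * ((nu / (nu + 2 * X1 * e + X2 * e ^+ 2)) `^ (p / 2) * (P + p * Z * e))) ->
  Y1 + (P - K) / nu * X1 - Z = 0.
Proof.
move=> p2 nu0 EE.
pose D e := nu + 2 * X1 * e + X2 * e ^+ 2.
pose q e := nu / D e.
pose E e := 2^-1 * (q e * (K + 2 * Y1 * e + Y2 * e ^+ 2))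
  - p^-1 * (q e `^ (p / 2) * (P + p * Z * e)).
have D0 : D 0 = nu by rewrite /D; ring.
have q0 : q 0 = 1 by rewrite /q D0 divff// gt_eqF.
have E0 : E 0 = 2^-1 * K - p^-1 * P.
  by rewrite /E q0 powR1; ring.
(* For |e| < 1 the variation of [D] is at most (2 |X1| + |X2|) |e|, which the second bound on |e|
   keeps below [nu]. *)
pose d := Num.min 1 (nu / (2 * `|X1| + `|X2| + 1)).
have S0 : 0 < 2 * `|X1| + `|X2| + 1.
  by have := normr_ge0 X1; have := normr_ge0 X2; lra.
have d0 : 0 < d by rewrite lt_min ltr01 divr_gt0.
have Dpos (e : R) : - d < e < d -> 0 < D e.
  rewrite -ltr_norml lt_min => /andP[e1 e2].
  move: e2; rewrite ltr_pdivlMr// => e2.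
  have h1 : - (`|X1| * `|e|) <= X1 * e.
    by have := ler_norm (- (X1 * e)); rewrite normrN normrM; lra.
  have h2 : - (`|X2| * `|e|) <= X2 * e ^+ 2.
    have := ler_norm (- (X2 * e ^+ 2)); rewrite normrN normrM normrX.
    have e0 := normr_ge0 e; have := mulr_ge0 (normr_ge0 X2) (mulr_ge0 e0 (_ : 0 <= 1 - `|e|)).
    by move=> /(_ _)/wrap[]; [lra|nra].
  by rewrite /D; have := normr_ge0 e; nra.
have dD (e : R) : is_derive e 1 D (2 * X1 + X2 * (2 * e)).
  have := deriv_add (deriv_add (deriv_const nu e) (deriv_scale (2 * X1) (deriv_id e)))
     (deriv_scale X2 (deriv_sqr (deriv_id e))).
  by move/is_derive_eq; apply; ring.
have dE (e : R) : 0 < D e -> is_derive e 1 E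
    (2^-1 * ((- nu * (2 * X1 + X2 * (2 * e)) / D e ^+ 2)
       * (K + 2 * Y1 * e + Y2 * e ^+ 2) + q e * (2 * Y1 + Y2 * (2 * e)))
     - p^-1 * ((p / 2 * q e `^ (p / 2 - 1) * (- nu * (2 * X1 + X2 * (2 * e)) / D e ^+ 2))
       * (P + p * Z * e) + q e `^ (p / 2) * (p * Z))).
  move=> De; have Dn : D e != 0 by rewrite gt_eqF.
  have qe : 0 < q e by rewrite divr_gt0.
  have dq : is_derive e 1 q (- nu * (2 * X1 + X2 * (2 * e)) / D e ^+ 2).
    have := deriv_scale nu (deriv_inv Dn (dD e)).
    by move/is_derive_eq; apply; ring.
  have dqp := @deriv_comp _ (@powR R ^~ (p / 2)) q _ _ _ (is_derive1_powR (p / 2) qe) dq.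
  have dk : is_derive e 1 (fun e => K + 2 * Y1 * e + Y2 * e ^+ 2)
      (2 * Y1 + Y2 * (2 * e)).
    have := deriv_add (deriv_add (deriv_const K e) (deriv_scale (2 * Y1) (deriv_id e)))
     (deriv_scale Y2 (deriv_sqr (deriv_id e))).
    by move/is_derive_eq; apply; ring.
  have dp : is_derive e 1 (fun e => P + p * Z * e) (p * Z).
    have := deriv_add (deriv_const P e) (deriv_scale (p * Z) (deriv_id e)).
    by move/is_derive_eq; apply; ring.
  exact: deriv_sub (deriv_scale _ (deriv_mul dq dk)) (deriv_scale _ (deriv_mul dqp dp)).
have dE0 : is_derive (0 : R) 1 E 0.
  apply: (@derive1_at_min _ E (- d) d).
  - by lra.
  - move=> e; rewrite in_itv/= => /Dpos De.
    by have [] := dE e De.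
  - by rewrite in_itv/= oppr_lt0 d0.
  - by move=> e; rewrite in_itv/= => /Dpos/EE; rewrite E0.
have D0' : 0 < D 0 by rewrite D0.
have [_ h1] := dE 0 D0'; have [_ h2] := dE0; move: h1; rewrite h2 q0 !powR1 D0.
move=> h; have p0 : p != 0 by rewrite gt_eqF//; lra.
have nun : nu != 0 by rewrite gt_eqF.
rewrite [RHS]h; field.
by rewrite p0 nun.
Qed.

(* Along u + e v, renormalized to the mass nu, convexity of |.|^p bounds the
   energy from above by a differentiable function of e that is minimal at 0. *)
Lemma energy_ground_state_euler ell p nu u v du dv : 2 < p -> 0 < ell -> 0 < nu ->
  energy_ground_state ell p nu u -> H1_graph ell v ->
  graph_weak_derivative ell u du -> graph_weak_derivative ell v dv ->
  ginner ell du dv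
  + (gintegral ell (pabs p) u - kinetic ell u) / nu * ginner ell u v
  - ginner ell (gpsgn p u) v = 0.
Proof.
move=> p2 l0 nu0 [uH um Emin] vH ud vd.
have uL2 := H1_graph_gL2 uH; have vL2 := H1_graph_gL2 vH.
have duL2 := graph_weak_derivative_gL2 ud.
have dvL2 := graph_weak_derivative_gL2 vd.
apply: (@renormalized_energy_min p nu _ _ _ (gintegral ell (fun y => y ^+ 2) v) _
  (gintegral ell (fun y => y ^+ 2) dv) _ p2 nu0) => e De.
set d := (X in nu / X) in De *.
have qe : 0 < nu / d by rewrite divr_gt0.
pose w := glinear 1 u e v; pose t := Num.sqrt (nu / d).
have wH : H1_graph ell w by exact: H1_graph_linear.
have wL2 := H1_graph_gL2 wH.
have t2 : t ^+ 2 = nu / d by rewrite sqr_sqrtr// ltW.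
have mw : mass ell w = d.
  rewrite mass_sqr (gintegral_sqr_linear _ _ uL2 vL2) -mass_sqr um /d.
  by rewrite expr1n !mul1r mulr1 -[2 * e * _]mulrAC [e ^+ 2 * _]mulrC.
have kw : kinetic ell w = kinetic ell u + 2 * ginner ell du dv * e
    + gintegral ell (fun y => y ^+ 2) dv * e ^+ 2.
  rewrite (kinetic_weak l0 (graph_weak_derivative_linear 1 e l0 ud vd)).
  rewrite (gintegral_sqr_linear _ _ duL2 dvL2) -(kinetic_weak l0 ud).
  by rewrite expr1n !mul1r mulr1 -[2 * e * _]mulrAC [e ^+ 2 * _]mulrC.
have := Emin (gscale t w) (H1_graph_scale t l0 wH) _.
rewrite mass_scale// mw t2 divfK ?gt_eqF// => /(_ erefl) h.
apply: (le_trans h); rewrite energyE kinetic_scale// gintegral_pabs_scale//;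
  last exact: sqrtr_ge0.
rewrite t2 kw; apply: lerB => //; apply: ler_wpM2l; first by rewrite invr_ge0 (le_trans _ (ltW p2)).
rewrite (_ : t `^ p = (nu / d) `^ (p / 2)); last first.
  by rewrite /t -powR12_sqrt ?ltW// -powRrM; congr (_ `^ _); field.
apply: ler_wpM2l; first exact: powR_ge0.
by apply: le_trans (gintegral_pabs_tangent e p2 l0 uH vH); rewrite mulrAC.
Qed.

End Graph_functionals.

(** * Energy ground states *)

Section Euler_Lagrange.
Context {R : realType}.
Local Notation mu := (@lebesgue_measure R).
Implicit Types (I J : set R) (f g u F dF : R -> R) (p lam ell t : R).

Lemma summable_patch I J f : measurable I -> measurable J -> J `<=` I ->
  summable J f -> summable I (f \_ J).
Proof.
move=> mI mJ JI fs; rewrite -restrict_EFin.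
apply/(@integrable_restrict _ _ _ mu J mJ I mI).
by rewrite setIC; apply: summable_sub fs => //; apply: measurableI.
Qed.

Lemma Rintegral_patch I J f : J `<=` I ->
  \int[mu]_(x in I) (f \_ J) x = \int[mu]_(x in J) f x.
Proof. by move=> JI; rewrite -Rintegral_mkcondr setIC setIidl. Qed.

(** These test functions suffice to recover the equation: since the slope is constant on [[0, t]],
    the kinetic term of the pairing reduces to a difference quotient of [u] based at the vertex, and
    the result is the equation integrated twice. *)
Definition hat t : R -> R := (fun x => 1 - x / t) \_ `[0, t].
Definition hat_derivative t : R -> R := (fun=> - t^-1) \_ `[0, t].

Lemma L2_patch I J f : measurable I -> measurable J -> J `<=` I -> L2 J f ->
  L2 I (f \_ J).
Proof.
move=> mI mJ JI /(L2P _ mJ)[mf fs]; apply/(L2P _ mI); split.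
  by apply: measurable_funTS; exact: (measurable_restrictT f mJ).1 mf.
rewrite (_ : (fun x => _) = (fun x => f x ^+ 2) \_ J); first exact: summable_patch.
by apply/funext => x; rewrite !patchE; case: ifP => //; rewrite expr0n.
Qed.

Lemma continuous_affine (a b : R) : continuous (fun x : R => a + b * x).
Proof.
by move=> x; apply: cvgD; [exact: cvg_cst|apply: cvgMr; exact: cvg_id].
Qed.

Lemma hat_L2 I t : edge_interval I -> 0 < t -> I t -> L2 I (hat t).
Proof.
move=> eI t0 It; have [mI _ _ _ _] := eI.
apply: L2_patch => //; first exact: edge_interval_sub.
apply: continuous_L2_itv; rewrite (_ : (fun x => _) = (fun x => 1 + (- t^-1) * x)).
  exact: continuous_affine.
by apply/funext => x; rewrite mulNr mulrC.
Qed.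

Lemma hat0 t : 0 < t -> hat t 0 = 1.
Proof.
by move=> t0; rewrite /hat patchE mem_set/= ?mul0r ?subr0// in_itv/= lexx ltW.
Qed.

Lemma hat_weak_derivative I t : edge_interval I -> 0 < t -> I t ->
  is_weak_derivative I (hat t) (hat_derivative t).
Proof.
move=> eI t0 It; have [mI _ Ige0 _ _] := eI.
split.
  apply: L2_patch => //; first exact: edge_interval_sub.
  by apply: continuous_L2_itv => x; exact: cvg_cst.
move=> x Ix; have x0 := Ige0 x Ix.
rewrite hat0// /hat_derivative -Rintegral_mkcondr.
have [xt|tx] := leP x t.
  rewrite setIidl; last by apply: subset_itvl; rewrite bnd_simp.
  rewrite Rintegral_itv_cst// subr0 /hat patchE mem_set/=.
    by rewrite mulNr mulrC.
  by rewrite in_itv/= x0.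
rewrite setIidr; last by apply: subset_itvl; rewrite bnd_simp ltW.
rewrite Rintegral_itv_cst ?ltW// subr0 mulNr mulVf ?gt_eqF// subrr.
rewrite /hat patchE memNset//= in_itv/= x0/=.
by apply/negP; rewrite -ltNge.
Qed.

Lemma hat_H1 I t : edge_interval I -> 0 < t -> I t -> H1 I (hat t).
Proof.
move=> eI t0 It; split; first exact: hat_L2.
by exists (hat_derivative t); exact: hat_weak_derivative.
Qed.

(* Distributional form of [- u'' + lam u - |u|^(p-2) u] tested against a hat. *)
Lemma hat_pairing p lam I u g t : 2 < p -> edge_interval I -> H1 I u ->
  is_weak_derivative I u g -> 0 < t -> I t ->
  \int[mu]_(x in I) (g x * hat_derivative t x)
  + lam * \int[mu]_(x in I) (u x * hat t x)
  - \int[mu]_(x in I) (psgn p (u x) * hat t x)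
  = - ((u t - u 0) / t)
    + \int[mu]_(x in `[0, t]) (force p lam (u x) * (1 - x / t)).
Proof.
move=> p2 eI uH ug t0 It; have [mI _ _ _ _] := eI.
have sub := edge_interval_sub eI It.
have mJ : measurable (`[0, t] : set R) by exact: measurable_itv.
have E1 : \int[mu]_(x in I) (g x * hat_derivative t x) = - ((u t - u 0) / t).
  rewrite (_ : (fun x => _) = (fun x => - t^-1 * g x) \_ `[0, t]); last first.
    apply/funext => x; rewrite /hat_derivative !patchE.
    by case: ifP => _; rewrite ?mulr0// mulrC.
  rewrite Rintegral_patch// RintegralZl//; last exact: L2_summable_itv ug.1.
  by rewrite (ug.2 t It); ring.
have E2 f : \int[mu]_(x in I) (f x * hat t x) =
    \int[mu]_(x in `[0, t]) (f x * (1 - x / t)).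
  rewrite -(Rintegral_patch _ sub); congr Rintegral; apply/funext => x.
  by rewrite /hat !patchE; case: ifP => _; rewrite ?mulr0.
have L2J f : L2 I f -> L2 `[0, t] f.
  move=> /(L2P _ mI)[mf fs]; apply/(L2P _ mJ).
  by split; [exact: measurable_funS mf|exact: summable_sub fs].
have aff : L2 (`[0, t] : set R) (fun x => 1 - x / t).
  apply: continuous_L2_itv; rewrite (_ : (fun x => _) = (fun x => 1 + (- t^-1) * x)).
    exact: continuous_affine.
  by apply/funext => x; rewrite mulNr mulrC.
have s1 := L2_summable_mul mJ (L2J _ uH.1) aff.
have s2 := L2_summable_mul mJ (L2J _ (psgn_L2 p2 eI uH)) aff.
rewrite E1 !E2 -addrA; congr (_ + _).
rewrite -RintegralZl// -RintegralB//; last exact: summableZ.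
by apply: eq_Rintegral => x _; rewrite /force; ring.
Qed.

Lemma solves_on_of_ode p lam I f F dF : ode_solution p lam I F dF ->
  (forall x, I x -> f x = F x) -> solves_on p lam I f dF.
Proof.
move=> [FdF cdF ode] fF; split.
  move=> x Ix; have := is_derivative_on_of_derive (fun y _ => FdF y) Ix.
  apply: cvg_trans; apply: near_eq_cvg; rewrite near_withinE.
  by apply: nearW => y Iy; rewrite !fF.
exists (fun x => force p lam (F x)).
  exact: is_derivative_on_of_derive.
by move=> x Ix; rewrite fF// /force /psgn; ring.
Qed.

(** Multiplied by -t, the hypothesis reads u(t) = u(0) + c t + the integral over [0, t] of (t - x)
    force(u(x)), which is the equation integrated twice with initial slope [c]. The Lipschitz
    retraction [cl] extends the force continuously to the line, continuity of [u] on [I] coming from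
    the weighted increment estimate. *)
Lemma weak_solution_regular p lam I u g c (cl : R -> R) : 2 < p -> edge_interval I ->
  (forall x, I (cl x)) -> (forall x, I x -> cl x = x) ->
  (forall x y, `|cl x - cl y| <= `|x - y|) ->
  is_weak_derivative I u g ->
  (forall t, 0 < t -> I t -> - ((u t - u 0) / t)
    + \int[mu]_(x in `[0, t]) (force p lam (u x) * (1 - x / t)) = - c) ->
  exists F dF, [/\ ode_solution p lam I F dF, forall x, I x -> u x = F x,
    dF 0 = c & forall x, I x ->
      dF x = c + \int[mu]_(y in `[0, x]) force p lam (u y)].
Proof.
move=> p2 eI clI clK cl1 ug test; have [mI I0 Ige0 Iconv _] := eI.
pose G := \int[mu]_(x in I) g x ^+ 2.
have G0 : 0 <= G by apply: Rintegral_ge0 => x _; exact: sqr_ge0.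
have uinc x y w : 0 < w -> I x -> I y ->
    `|u x - u y| <= (`|x - y| / w + w * G) / 2.
  move=> w0; wlog xy : x y / y <= x => [wl Ix Iy|Ix Iy].
    have [yx|/ltW xy] := leP y x; first exact: wl.
    by rewrite distrC [`|x - y|]distrC; exact: wl.
  have := @H1_increment_weighted _ I u g x y w eI w0 ug.
  by rewrite Ige0//= xy (ger0_norm (_ : 0 <= x - y)) ?subr_ge0//; apply.
have cv : continuous (fun x => u (cl x)).
  move=> x; apply/cvgrPdist_lt => e e0.
  pose w := e / (G + 1).
  have w0 : 0 < w by rewrite divr_gt0// ltr_wpDl.
  near=> y; apply: le_lt_trans (uinc (cl x) (cl y) w w0 _ _) _ => //.
  have h1 : `|cl x - cl y| / w < e.
    rewrite ltr_pdivrMr//; apply: le_lt_trans (cl1 x y) _.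
    near: y; exists (e * w) => //=; by rewrite mulr_gt0.
  have h2 : w * G <= e.
    have : w * (G + 1) = e by rewrite /w divfK// gt_eqF// ltr_wpDl.
    by rewrite mulrDr mulr1 => <-; rewrite lerDl ltW.
  by lra.
have cN : continuous (fun x => force p lam (u (cl x))).
  move=> x; apply: (@continuous_comp _ _ _ (fun x => u (cl x)) (force p lam)).
    exact: cv.
  exact: continuous_force.
have [A0 dA0] := antiderivative_exists cN.
pose A1 x := A0 x - A0 0.
have dA1 (x : R) : is_derive x 1 A1 (force p lam (u (cl x))).
  by have := deriv_sub (dA0 x) (deriv_const (A0 0) x); rewrite subr0.
have cA1 : continuous A1 by move=> x; exact: deriv_continuous (dA1 x).
have A10 : A1 0 = 0 by rewrite /A1 subrr.
have [B0 dB0] := antiderivative_exists cA1.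
pose F x := u 0 + c * x + (B0 x - B0 0).
pose dF x := c + A1 x.
have hF (x : R) : is_derive x 1 F (dF x).
  have := deriv_add (deriv_add (deriv_const (u 0) x) (deriv_scale c (deriv_id x)))
    (deriv_sub (dB0 x) (deriv_const (B0 0) x)).
  by move/is_derive_eq; apply; rewrite /dF; ring.
have hdF (x : R) : is_derive x 1 dF (force p lam (u (cl x))).
  by have := deriv_add (deriv_const c x) (dA1 x); rewrite add0r.
have intN x : I x ->
    \int[mu]_(y in `[0, x]) force p lam (u y) = A1 x.
  move=> Ix; have sub := edge_interval_sub eI Ix.
  rewrite (@eq_Rintegral _ _ _ mu `[0, x] (fun y => force p lam (u (cl y)))).
    by rewrite (Rintegral_FTC (Ige0 _ Ix) dA1 cN) A10 subr0.
  by move=> y; rewrite inE => /sub Iy; rewrite clK.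
have uF x : I x -> u x = F x.
  move=> Ix; have := Ige0 x Ix; rewrite le_eqVlt => /predU1P[<-|x0].
    by rewrite /F mulr0 subrr !addr0.
  have sub := edge_interval_sub eI Ix.
  have xn : x != 0 by rewrite gt_eqF.
  have := test x x0 Ix.
  rewrite (@eq_Rintegral _ _ _ mu `[0, x]
    (fun y => x^-1 * (force p lam (u (cl y)) * (x - y)))); last first.
    by move=> y; rewrite inE => /sub Iy; rewrite clK//; field.
  have cNx : continuous (fun y => force p lam (u (cl y)) * (x - y)).
    move=> y; apply: cvgM; first exact: cN.
    by apply: cvgB; [exact: cvg_cst|exact: cvg_id].
  (* Integration by parts: this primitive turns the double integral into [B0 x - B0 0], where [B0]
     is a primitive of [A1]. *)
  have dH (y : R) : is_derive y 1 (fun y => A1 y * (x - y) + B0 y)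
      (force p lam (u (cl y)) * (x - y)).
    have := deriv_add (deriv_mul (dA1 y) (deriv_sub (deriv_const x y) (deriv_id y)))
      (dB0 y).
    by move/is_derive_eq; apply; ring.
  rewrite RintegralZl//; last exact: continuous_integrable.
  rewrite (Rintegral_FTC (ltW x0) dH cNx) A10 /F => h.
  have : x * (- ((u x - u 0) / x) + x^-1 * (A1 x * (x - x) + B0 x - (0 * (x - 0) + B0 0)))
    = x * - c by rewrite h.
  rewrite (_ : x * _ = - (u x - u 0) + (B0 x - B0 0)); first by lra.
  by field.
exists F, dF; split.
- split; [exact: hF|by move=> x; exact: deriv_continuous (hdF x)|].
  by move=> x Ix; have := hdF x; rewrite clK// uF.
- exact: uF.
- by rewrite /dF A10 addr0.
- by move=> x Ix; rewrite intN.
Unshelve. all: by end_near. Qed.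

End Euler_Lagrange.

(** * From the Euler-Lagrange equation to the comparison of actions *)

Section Energy_ground_states.
Context {R : realType}.
Local Notation mu := (@lebesgue_measure R).
Implicit Types (u v du dv : gfun R) (p lam ell nu t : R) (I : set R).

Lemma clamp_half_line_lipschitz (x y : R) :
  `|Num.max 0 x - Num.max 0 y| <= `|x - y|.
Proof.
wlog xy : x y / y <= x => [wl|].
  have [/wl//|/ltW/wl h] := leP y x; by rewrite distrC [`|x - y|]distrC.
rewrite [in leRHS]ger0_norm ?subr_ge0// ger0_norm.
  by case: (leP 0 x) => ?; case: (leP 0 y) => ?; lra.
by case: (leP 0 x) => ?; case: (leP 0 y) => ?; lra.
Qed.

Lemma clamp_edge_lipschitz ell (x y : R) :
  `|Num.min ell (Num.max 0 x) - Num.min ell (Num.max 0 y)| <= `|x - y|.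
Proof.
apply: le_trans (clamp_half_line_lipschitz x y).
move: (Num.max 0 x) (Num.max 0 y) => {x y} x y.
wlog xy : x y / y <= x => [wl|].
  have [/wl//|/ltW/wl h] := leP y x; by rewrite distrC [`|x - y|]distrC.
rewrite [in leRHS]ger0_norm ?subr_ge0// ger0_norm.
  by case: (leP ell x) => ?; case: (leP ell y) => ?; lra.
by case: (leP ell x) => ?; case: (leP ell y) => ?; lra.
Qed.

Definition hat_residue p lam (u : R -> R) t : R :=
  - ((u t - u 0) / t)
    + \int[mu]_(x in `[0, t]) (force p lam (u x) * (1 - x / t)).

(** The three hats of a test function may have different lengths. Varying one length at a time shows
    that each residue is constant in [t], which is the equation on that edge with minus the residue
    as slope at the vertex; that the residues sum to zero is Kirchhoff. *)
Lemma energy_ground_state_solution ell p nu u : 2 < p -> 0 < ell -> 0 < nu ->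
  energy_ground_state ell p nu u -> exists lam, solution ell p lam u.
Proof.
move=> p2 l0 nu0 gs; have [uH _ _] := gs.
have [du ud] := H1_graph_weak uH.
pose lam := (gintegral ell (pabs p) u - kinetic ell u) / nu.
exists lam.
have euler v dv : H1_graph ell v -> graph_weak_derivative ell v dv ->
    ginner ell du dv + lam * ginner ell u v - ginner ell (gpsgn p u) v = 0.
  by move=> vH vd; exact: energy_ground_state_euler gs vH ud vd.
move: lam euler => lam euler {gs}.
have eH := edge_interval_half_line (R := R).
have eE := edge_interval_terminal_edge l0.
have [ud1 ud2 ud3] := ud; have [u1 u2 u3 v12 v23] := uH.
have Hp t : 0 < t -> half_line t by rewrite half_lineE; exact: ltW.
have Ep t : 0 < t -> t <= ell -> terminal_edge ell t.
  by rewrite terminal_edgeE => /ltW -> ->.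
have alg (a1 a2 a3 b1 b2 b3 c1 c2 c3 : R) : a1 + a2 + a3 + lam * (b1 + b2 + b3)
    - (c1 + c2 + c3) = (a1 + lam * b1 - c1) + (a2 + lam * b2 - c2)
    + (a3 + lam * b3 - c3) by ring.
have test t1 t2 t3 : 0 < t1 -> 0 < t2 -> 0 < t3 -> t3 <= ell ->
    hat_residue p lam (e1 u) t1 + hat_residue p lam (e2 u) t2
    + hat_residue p lam (e3 u) t3 = 0.
  move=> t10 t20 t30 t3l.
  have := euler (GFun (hat t1) (hat t2) (hat t3))
    (GFun (hat_derivative t1) (hat_derivative t2) (hat_derivative t3)).
  rewrite /ginner alg (hat_pairing lam p2 eH u1 ud1 t10 (Hp _ t10)).
  rewrite (hat_pairing lam p2 eH u2 ud2 t20 (Hp _ t20)).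
  rewrite (hat_pairing lam p2 eE u3 ud3 t30 (Ep _ t30 t3l)); apply.
    split; [exact: hat_H1 (Hp _ _)|exact: hat_H1 (Hp _ _)|exact: hat_H1 (Ep _ _ _)| |];
      by rewrite /= !hat0.
  by split; apply: hat_weak_derivative => //; [exact: Hp|exact: Hp|exact: Ep].
(* Unlike a hat, the constant 1 on the terminal edge does not vanish at [ell], so this test detects
   the Neumann condition. *)
have test1 : hat_residue p lam (e1 u) 1 + hat_residue p lam (e2 u) 1
    + \int[mu]_(x in `[0, ell]) force p lam (e3 u x) = 0.
  have mE : measurable (terminal_edge ell) by exact: measurable_itv.
  have := euler (GFun (hat 1) (hat 1) (fun=> 1))
    (GFun (hat_derivative 1) (hat_derivative 1) (fun=> 0)).
  rewrite /ginner alg (hat_pairing lam p2 eH u1 ud1 ltr01 (Hp _ ltr01)).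
  rewrite (hat_pairing lam p2 eH u2 ud2 ltr01 (Hp _ ltr01)).
  have s1 : summable (terminal_edge ell) (e3 u).
    by apply: L2_summable_itv u3.1.
  have s2 : summable (terminal_edge ell) (fun x => psgn p (e3 u x)).
    by apply: L2_summable_itv (psgn_L2 p2 eE u3).
  rewrite (_ : \int[mu]_(x in terminal_edge ell) (e3 du x * 0)
      + lam * \int[mu]_(x in terminal_edge ell) (e3 u x * 1)
      - \int[mu]_(x in terminal_edge ell) (psgn p (e3 u x) * 1)
      = \int[mu]_(x in `[0, ell]) force p lam (e3 u x)); last first.
    under eq_Rintegral do rewrite mulr0.
    under [X in _ * X]eq_Rintegral do rewrite mulr1.
    under [X in _ - X]eq_Rintegral do rewrite mulr1.
    rewrite -RintegralI3E Rintegral_itv_cst ?ltW// mul0r add0r.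
    by rewrite -RintegralZl// -RintegralB//; exact: summableZ.
  have c1 : is_weak_derivative (terminal_edge ell) (fun=> 1) (fun=> 0 : R).
    split; first by apply: continuous_L2_itv => x; exact: cvg_cst.
    move=> x; rewrite terminal_edgeE => /andP[x0 _].
    by rewrite Rintegral_itv_cst// mul0r addr0.
  have c1H : H1 (terminal_edge ell) (fun=> 1 : R).
    split; last by eexists; exact: c1.
    by apply: continuous_L2_itv => x; exact: cvg_cst.
  apply.
    by split; [exact: hat_H1 (Hp _ _)|exact: hat_H1 (Hp _ _)|exact: c1H| |];
      rewrite /= ?hat0.
  split; [| |exact: c1].
  - by apply: hat_weak_derivative => //; exact: Hp.
  - by apply: hat_weak_derivative => //; exact: Hp.
pose b1 := hat_residue p lam (e1 u) 1; pose b2 := hat_residue p lam (e2 u) 1.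
pose b3 := hat_residue p lam (e3 u) ell.
have b123 : b1 + b2 + b3 = 0 by exact: test.
have reg1 t : 0 < t -> half_line t -> hat_residue p lam (e1 u) t = - (- b1).
  by move=> t0 _; have := test t 1 ell t0 ltr01 l0 (lexx _); rewrite -/b2 -/b3; lra.
have reg2 t : 0 < t -> half_line t -> hat_residue p lam (e2 u) t = - (- b2).
  by move=> t0 _; have := test 1 t ell ltr01 t0 l0 (lexx _); rewrite -/b1 -/b3; lra.
have reg3 t : 0 < t -> terminal_edge ell t -> hat_residue p lam (e3 u) t = - (- b3).
  rewrite terminal_edgeE => t0 /andP[_ tl].
  by have := test 1 1 t ltr01 ltr01 t0 tl; rewrite -/b1 -/b2; lra.
have cH x : half_line (Num.max 0 x : R) by rewrite half_lineE le_max lexx.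
have cHK (x : R) : half_line x -> Num.max 0 x = x by rewrite half_lineE => /max_r.
have cE x : terminal_edge ell (Num.min ell (Num.max 0 x)).
  by rewrite terminal_edgeE le_min ge_min le_max lexx (ltW l0) lexx.
have cEK x : terminal_edge ell x -> Num.min ell (Num.max 0 x) = x.
  by rewrite terminal_edgeE => /andP[x0 xl]; rewrite max_r// min_r.
have [F1 [dF1 [ode1 uF1 dF10 _]]] :=
  weak_solution_regular p2 eH cH cHK clamp_half_line_lipschitz ud1 reg1.
have [F2 [dF2 [ode2 uF2 dF20 _]]] :=
  weak_solution_regular p2 eH cH cHK clamp_half_line_lipschitz ud2 reg2.
have [F3 [dF3 [ode3 uF3 dF30 dF3E]]] :=
  weak_solution_regular p2 eE cE cEK (clamp_edge_lipschitz ell) ud3 reg3.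
split => //; exists (GFun dF1 dF2 dF3); split.
- exact: solves_on_of_ode ode1 uF1.
- exact: solves_on_of_ode ode2 uF2.
- exact: solves_on_of_ode ode3 uF3.
- by rewrite /= dF10 dF20 dF30; lra.
- rewrite /= dF3E; last by rewrite terminal_edgeE lexx ltW.
  by move: test1; rewrite -/b1 -/b2; lra.
Qed.

(** The zero-energy identity at the vertex reads 0 <= g^2 = lam f^2 - 2 f^p / p with f > 0, which is
    impossible for lam <= 0. *)
Lemma positive_solution_lam_gt0 ell p lam u : 2 < p -> 0 < ell ->
  solution ell p lam u -> positive_on_graph ell u -> 0 < lam.
Proof.
move=> p2 l0 /(solution_split p2 l0)[f1 [g1 [f2 [g2 [f3 [g3 us]]]]]] [u0 _ _].
have := half_line_energy p2 (split_ode1 us) (split_H1_1 us) (lexx 0).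
have f0 : 0 < f1 0 by rewrite (split_eq1 us)//; apply: u0; rewrite half_lineE.
rewrite /potential => h.
have : 0 < pabs p (f1 0) / p by rewrite divr_gt0 ?pabs_gt0 ?gt_eqF//; lra.
by have := sqr_ge0 (g1 0); rewrite h; have := exprn_gt0 2 f0; nra.
Qed.

(** At an interior point of a half-line, here 1, the two extensions share both value and slope, and
    the zero-energy identity determines [lam] from them because the value is not 0. *)
Lemma solution_lam_unique ell p lam lam' u : 2 < p -> 0 < ell ->
  positive_on_graph ell u -> solution ell p lam u -> solution ell p lam' u ->
  lam = lam'.
Proof.
move=> p2 l0 [u0 _ _].
move=> /(solution_split p2 l0)[f1 [g1 [f2 [g2 [f3 [g3 us]]]]]].
move=> /(solution_split p2 l0)[f1' [g1' [f2' [g2' [f3' [g3' us']]]]]].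
have fE x : 0 <= x -> f1 x = f1' x.
  by move=> x0; rewrite (split_eq1 us)// (split_eq1 us').
have [d1 _ _] := split_ode1 us; have [d1' _ _] := split_ode1 us'.
have gE : g1 1 = g1' 1.
  have : is_derive (1 : R) 1 f1' (g1 1).
    apply: near_eq_deriv (d1 1); near=> t; apply: fE; apply: ltW.
    by near: t; exact: lt_nbhsr.
  by case=> _ <-; have [_ ->] := d1' 1.
have := half_line_energy p2 (split_ode1 us) (split_H1_1 us) ler01.
have := half_line_energy p2 (split_ode1 us') (split_H1_1 us') ler01.
rewrite gE fE ?ler01// /potential => -> h.
have f0 : f1' 1 != 0.
  by rewrite gt_eqF// (split_eq1 us')//; apply: u0; rewrite half_lineE.
have f20 : f1' 1 ^+ 2 != 0 by rewrite expf_neq0.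
by apply: (mulIf f20); move: h; lra.
Unshelve. all: by end_near. Qed.

Lemma gintegral_ge0 ell (F : R -> R) u : (forall y, 0 <= F y) ->
  0 <= gintegral ell F u.
Proof. by move=> F0; rewrite /gintegral !addr_ge0//; apply: Rintegral_ge0. Qed.

(** Young's inequality for t^2 and 1 with exponents p/2 and p/(p - 2). It says that along the ray
    through a point of the Nehari manifold the action is largest at that point. *)
Lemma fibre_max p t : 2 < p -> 0 <= t ->
  t ^+ 2 / 2 - t `^ p / p <= 2^-1 - p^-1.
Proof.
move=> p2 t0; have p0 : 0 < p by lra.
have := @conjugate_powR R (t ^+ 2) 1 (p / 2) (p / (p - 2)).
have q0 : 0 < p / 2 by lra.
have q1 : 0 < p / (p - 2) by rewrite divr_gt0//; lra.
rewrite sqr_ge0 ler01 => /(_ isT isT) h.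
have hpow : (t ^+ 2) `^ (p / 2) = t `^ p.
  by rewrite -powR_mulrn// -powRrM; congr (_ `^ _); field.
have := h q0 q1 _; rewrite hpow powR1 mulr1 => /(_ _)/wrap[].
  by field; rewrite !gt_eqF//; lra.
rewrite (_ : t `^ p / (p / 2) = 2 * (t `^ p / p)); last by field; rewrite gt_eqF.
rewrite (_ : 1 / (p / (p - 2)) = 1 - 2 * p^-1); last first.
  by field; rewrite !gt_eqF//; lra.
by lra.
Qed.

Lemma edge_interval_point I (x d : R) : edge_interval I -> 0 < d ->
  (exists2 y, I y & 0 < y) -> I x ->
  exists a b, [/\ a < b, I a, I b & forall c, a < c < b -> `|c - x| < d].
Proof.
move=> [_ I0 Ige0 Iconv _] d0 [y Iy y0] Ix.
have := Ige0 x Ix; rewrite le_eqVlt => /predU1P[x0|x0].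
  exists 0, (Num.min d y); split => //.
  - by rewrite lt_min d0.
  - by apply: (Iconv y) => //; rewrite ge_min lexx orbT le_min !ltW.
  - move=> c; rewrite lt_min -x0 subr0 => /andP[c0 /andP[cd _]].
    by rewrite gtr0_norm.
exists (Num.max 0 (x - d)), x; split => //.
- by rewrite gt_max x0/=; lra.
- by apply: (Iconv x) => //; rewrite le_max lexx ge_max/= ltW//=; lra.
- move=> c; rewrite gt_max => /andP[/andP[_ c1] c2].
  by rewrite ltr_norml; lra.
Qed.

Lemma Rintegral_sqr_eq0 I (f : R -> R) : edge_interval I ->
  (exists2 y, I y & 0 < y) -> continuous f -> summable I (fun x => f x ^+ 2) ->
  \int[mu]_(x in I) f x ^+ 2 = 0 -> forall x, I x -> f x = 0.
Proof.
move=> eI yI cf fs f0 x Ix; have [mI _ Ige0 Iconv _] := eI.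
apply/eqP/negPn/negP => fx0.
have [F dF] := antiderivative_exists (continuous_sqr cf).
have cF : continuous F by move=> y; exact: deriv_continuous (dF y).
have /cvgrPdist_lt/(_ `|f x|) := cf x; rewrite normr_gt0 => /(_ fx0) [d /= d0 fd].
have [a [b [ab Ia Ib abx]]] := edge_interval_point eI d0 yI Ix.
have [c acb E] := mean_value ab (fun y _ => cF y) (fun y _ => dF y).
have : F b - F a <= 0.
  rewrite -(Rintegral_FTC (ltW ab) dF (continuous_sqr cf)) -f0.
  apply: le_Rintegral_subset => //.
  - move=> t; rewrite /= in_itv/= => /andP[at_ tb].
    by apply: (Iconv b) => //; rewrite tb (le_trans (Ige0 a Ia)).
  - by move=> t _; exact: sqr_ge0.
have fc : f c != 0.
  apply/eqP => fc; have := fd c; rewrite /ball_/= fc subr0 ltxx distrC.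
  by move=> h; have := h (abx c acb).
rewrite E leNgt => /negP; apply; apply: mulr_gt0; last by rewrite subr_gt0.
by rewrite lt_neqAle sqr_ge0 eq_sym expf_neq0.
Qed.

Lemma solution_neq0_mass ell p lam u : 2 < p -> 0 < ell ->
  solution ell p lam u -> ~ eq_on_graph ell u (gzero R) -> 0 < mass ell u.
Proof.
move=> p2 l0 /(solution_split p2 l0)[f1 [g1 [f2 [g2 [f3 [g3 us]]]]]] un0.
have eH := edge_interval_half_line (R := R).
have eE := edge_interval_terminal_edge l0.
rewrite mass_sqr (split_gintegral us).
set A := \int[mu]_(x in _) _; set B := \int[mu]_(x in _) _.
set C := \int[mu]_(x in _) _.
have A0 : 0 <= A by apply: Rintegral_ge0 => x _; exact: sqr_ge0.
have B0 : 0 <= B by apply: Rintegral_ge0 => x _; exact: sqr_ge0.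
have C0 : 0 <= C by apply: Rintegral_ge0 => x _; exact: sqr_ge0.
rewrite ltNge; apply/negP => ABC; apply: un0.
have [A00 [B00 C00]] : A = 0 /\ (B = 0 /\ C = 0).
  by move: A0 B0 C0 ABC; move: A B C => A B C *; split; [lra|split; lra].
have mH : measurable (@half_line R) by exact: measurable_itv.
have mE : measurable (terminal_edge ell) by exact: measurable_itv.
have yH : exists2 y : R, half_line y & 0 < y by exists 1; rewrite ?half_lineE.
have yE : exists2 y : R, terminal_edge ell y & 0 < y.
  by exists ell; rewrite ?terminal_edgeE ?lexx ?ltW.
have z1 := Rintegral_sqr_eq0 eH yH (ode_continuous (split_ode1 us))
  (L2_summable_sqr mH (split_H1_1 us).1) A00.
have z2 := Rintegral_sqr_eq0 eH yH (ode_continuous (split_ode2 us))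
  (L2_summable_sqr mH (split_H1_2 us).1) B00.
have z3 := Rintegral_sqr_eq0 eE yE (ode_continuous (split_ode3 us))
  (L2_summable_sqr mE (split_H1_3 us).1) C00.
split => x; rewrite inE => Ix /=.
- by rewrite -(split_eq1 us) ?z1//; move: Ix; rewrite half_lineE.
- by rewrite -(split_eq2 us) ?z2//; move: Ix; rewrite half_lineE.
- by rewrite -(split_eq3 us) ?z3//; move: Ix; rewrite terminal_edgeE.
Qed.

(* A solution lies on its Nehari manifold, so rescaling it to the mass of the
   energy ground state can only decrease its action. *)
Lemma energy_ground_state_action_le ell p nu lam u v : 2 < p -> 0 < ell -> 0 < nu ->
  energy_ground_state ell p nu u -> solution ell p lam v ->
  ~ eq_on_graph ell v (gzero R) -> action ell p lam u <= action ell p lam v.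
Proof.
move=> p2 l0 nu0 [uH um Emin] vs vn0.
have m0 := solution_neq0_mass p2 l0 vs vn0.
have vH := vs.1; have vL2 := H1_graph_gL2 vH.
have [t t0 t2] : exists2 t : R, 0 <= t & t ^+ 2 * mass ell v = nu.
  exists (Num.sqrt (nu / mass ell v)); first exact: sqrtr_ge0.
  by rewrite sqr_sqrtr ?divfK ?gt_eqF// divr_ge0 ?ltW.
have nehari := solution_nehari p2 l0 vs.
have P0 : 0 <= gintegral ell (pabs p) v by apply: gintegral_ge0 => y; exact: pabs_ge0.
have := Emin (gscale t v) (H1_graph_scale t l0 vH) (etrans (mass_scale t vL2) t2).
rewrite !energyE (kinetic_scale t l0 vH) (gintegral_pabs_scale p2 l0 t0 vH).
rewrite /action -/(kinetic ell u) -/(kinetic ell v) -!mass_sqr um.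
rewrite -mass_sqr in nehari.
have fib := fibre_max p2 t0.
move: nehari P0 t2; move: (kinetic ell v) (mass ell v) (kinetic ell u) => Kv mv Ku.
rewrite -[gintegral ell (fun y => `|y| `^ p) u]/(gintegral ell (pabs p) u).
rewrite -[gintegral ell (fun y => `|y| `^ p) v]/(gintegral ell (pabs p) v).
move: (gintegral ell (pabs p) v) (gintegral ell (pabs p) u) => Pv Pu.
move=> nehari P0 t2 E; rewrite nehari.
have := ler_wpM2r P0 fib; rewrite mulrBl -nehari.
have : lam * t ^+ 2 * mv = lam * nu by rewrite -mulrA t2.
by move: E; rewrite -nehari; lra.
Qed.

End Energy_ground_states.

(** * Classification of the solutions *)

Section Potential_shape.
Context {R : realType}.
Implicit Types (p lam y z : R).

(* [well] is the constant solution, [peak] the maximum of the soliton. *)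
Definition well p lam : R := lam `^ (p - 2)^-1.
Definition peak p lam : R := (p * lam / 2) `^ (p - 2)^-1.

Lemma well_gt0 p lam : 0 < lam -> 0 < well p lam.
Proof. by move=> l0; exact: powR_gt0. Qed.

Lemma peak_gt0 p lam : 2 < p -> 0 < lam -> 0 < peak p lam.
Proof. by move=> p2 l0; apply: powR_gt0; rewrite divr_gt0// mulr_gt0//; lra. Qed.

Lemma well_pow p lam : 2 < p -> 0 < lam -> well p lam `^ (p - 2) = lam.
Proof.
move=> p2 l0; rewrite /well -powRrM mulVf; last by rewrite gt_eqF//; lra.
by rewrite powRr1// ltW.
Qed.

Lemma peak_pow p lam : 2 < p -> 0 < lam -> peak p lam `^ (p - 2) = p * lam / 2.
Proof.
move=> p2 l0; have : 0 <= p * lam / 2 by rewrite divr_ge0// mulr_ge0//; lra.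
rewrite /peak -powRrM mulVf; last by rewrite gt_eqF//; lra.
exact: powRr1.
Qed.

Lemma ltr_powR2 p y z : 2 < p -> 0 <= y -> 0 <= z ->
  (y `^ (p - 2) < z `^ (p - 2)) = (y < z).
Proof.
move=> p2 y0 z0; have q0 : 0 < p - 2 by lra.
have [yz|zy] := ltP y z; first by rewrite gt0_ltr_powR.
by apply/negbTE; rewrite -leNgt ge0_ler_powR// ltW.
Qed.

Lemma well_lt_peak p lam : 2 < p -> 0 < lam -> well p lam < peak p lam.
Proof.
move=> p2 l0; rewrite -(ltr_powR2 p2 (ltW (well_gt0 p l0)) (ltW (peak_gt0 p2 l0))).
by rewrite well_pow// peak_pow//; nra.
Qed.

Lemma potential_ge0E p lam y : 2 < p -> 0 <= y ->
  potential p lam y = y ^+ 2 * (lam / 2 - y `^ (p - 2) / p).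
Proof.
by move=> p2 y0; rewrite /potential pabs_sqr// ger0_norm//; ring.
Qed.

Lemma force_ge0E p lam y : 0 <= y -> force p lam y = y * (lam - y `^ (p - 2)).
Proof. by move=> y0; rewrite /force psgn_ge0E//; ring. Qed.

Lemma force_gt0 p lam y : 2 < p -> 0 < lam -> 0 < y -> y < well p lam ->
  0 < force p lam y.
Proof.
move=> p2 l0 y0; rewrite -(ltr_powR2 p2) ?powR_ge0 ?ltW// well_pow//.
by move=> h; rewrite force_ge0E ?ltW// mulr_gt0// subr_gt0.
Qed.

Lemma force_lt0 p lam y : 2 < p -> 0 < lam -> well p lam < y ->
  force p lam y < 0.
Proof.
move=> p2 l0 wy; have y0 : 0 < y := lt_trans (well_gt0 p l0) wy.
move: wy; rewrite -(ltr_powR2 p2) ?powR_ge0 ?ltW// well_pow//.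
by move=> h; rewrite force_ge0E ?ltW// pmulr_rlt0// subr_lt0.
Qed.

Lemma potential_gt0 p lam y : 2 < p -> 0 < lam -> 0 < y -> y < peak p lam ->
  0 < potential p lam y.
Proof.
move=> p2 l0 y0; rewrite -(ltr_powR2 p2) ?powR_ge0 ?ltW// peak_pow//.
move=> h; rewrite potential_ge0E ?ltW// mulr_gt0 ?exprn_gt0//.
by rewrite subr_gt0 ltr_pdivrMr; [move: h; lra|lra].
Qed.

Lemma potential_peak p lam : 2 < p -> 0 < lam -> potential p lam (peak p lam) = 0.
Proof.
move=> p2 l0; rewrite potential_ge0E ?powR_ge0// peak_pow//; field.
by rewrite gt_eqF//; lra.
Qed.

Lemma potential_lt0 p lam y : 2 < p -> 0 < lam -> peak p lam < y ->
  potential p lam y < 0.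
Proof.
move=> p2 l0 py; have y0 : 0 < y := lt_trans (peak_gt0 p2 l0) py.
move: py; rewrite -(ltr_powR2 p2) ?powR_ge0 ?ltW// peak_pow//.
move=> h; rewrite potential_ge0E ?ltW// pmulr_rlt0 ?exprn_gt0//.
by rewrite subr_lt0 ltr_pdivlMr; [move: h; lra|lra].
Qed.

Lemma potential_incr p lam y z : 2 < p -> 0 < lam -> 0 <= y -> y < z ->
  z <= well p lam -> potential p lam y < potential p lam z.
Proof.
move=> p2 l0 y0 yz zw; 
apply: (@deriv_gt0_lt _ (potential p lam) (force p lam) _ _ yz
  (fun x _ => @continuous_potential _ p lam p2 x)
  (fun x _ => deriv_potential lam x p2)) => x /andP[yx xz].
by apply: force_gt0 => //; [exact: le_lt_trans yx|exact: lt_le_trans zw].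
Qed.

Lemma potential_decr p lam y z : 2 < p -> 0 < lam -> well p lam <= y -> y < z ->
  potential p lam z < potential p lam y.
Proof.
move=> p2 l0 wy yz; 
apply: (@deriv_lt0_gt _ (potential p lam) (force p lam) _ _ yz
  (fun x _ => @continuous_potential _ p lam p2 x)
  (fun x _ => deriv_potential lam x p2)) => x /andP[yx xz].
by apply: force_lt0 => //; exact: le_lt_trans yx.
Qed.

Lemma potential_le_well p lam y : 2 < p -> 0 < lam -> 0 <= y ->
  potential p lam y <= potential p lam (well p lam).
Proof.
move=> p2 l0 y0; have [yw|yw|->//] := ltgtP y (well p lam).
- by apply: ltW; apply: potential_incr.
- by apply: ltW; apply: potential_decr.
Qed.

Lemma potential_norm p lam y : potential p lam `|y| = potential p lam y.
Proof.
have [y0|y0] := leP 0 y; first by rewrite ger0_norm.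
by rewrite ltr0_norm// potentialN.
Qed.

Lemma potential_le_norm p lam y z : 2 < p -> 0 < lam -> peak p lam < z ->
  potential p lam z <= potential p lam y -> `|y| <= z.
Proof.
move=> p2 l0 pz; rewrite -(potential_norm p lam y) => h.
rewrite leNgt; apply/negP => zy; move: h; apply/negP; rewrite -ltNge.
apply: potential_decr => //; apply: ltW.
exact: lt_trans (well_lt_peak p2 l0) pz.
Qed.

Lemma potential_ge0_le_peak p lam y : 2 < p -> 0 < lam ->
  0 <= potential p lam y -> y <= peak p lam.
Proof.
move=> p2 l0 h; rewrite leNgt; apply/negP => /(potential_lt0 p2 l0).
by rewrite ltNge h.
Qed.

Lemma potential_ge0_of_le p lam y : 2 < p -> 0 < lam -> `|y| <= peak p lam ->
  0 <= potential p lam y.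
Proof.
move=> p2 l0; rewrite -potential_norm; have := normr_ge0 y.
move: `|y| => z; rewrite le_eqVlt => /predU1P[<-|z0].
  by rewrite potential0.
rewrite le_eqVlt => /predU1P[->|zp]; first by rewrite potential_peak.
by apply: ltW; apply: potential_gt0.
Qed.

End Potential_shape.

(** * Shape and action of a solution on a half-line *)

Section Half_line_shape.
Context {R : realType}.
Local Notation mu := (@lebesgue_measure R).
Implicit Types (p lam ell K : R) (I : set R) (f df Phi : R -> R).

Lemma deriv_exp (c x : R) : is_derive x 1 (fun t : R => expR (c * t)) (c * expR (c * x)).
Proof.
have := @deriv_comp _ expR (fun t => c * t) _ _ _ (is_derive_expR (c * x))
  (deriv_scale c (deriv_id x)).
by move/is_derive_eq; apply; rewrite mulr1 mulrC.
Qed.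

(** With the factors exp(-K x) and exp(K x) the nonnegative function [D] becomes nonincreasing and
    nondecreasing respectively, so a zero propagates in both directions. *)
Lemma gronwall_zero (D dD : R -> R) (K a b : R) : a <= b ->
  (forall x, a <= x <= b -> is_derive (x : R) 1 D (dD x)) ->
  (forall x, a <= x <= b -> 0 <= D x /\ `|dD x| <= K * D x) ->
  (D a = 0 <-> D b = 0).
Proof.
move=> ab hd hD.
have da c x : a <= x <= b -> is_derive x 1 (fun t : R => D t * expR (c * t))
    (expR (c * x) * (dD x + c * D x)).
  move=> /hd h; have := deriv_mul h (deriv_exp c x).
  by move/is_derive_eq; apply; ring.
have ca c x (h : a <= x <= b) := deriv_continuous (da c x h).
have ia x : a < x < b -> a <= x <= b by move=> /andP[/ltW-> /ltW->].
have aa : a <= a <= b by rewrite lexx. have bb : a <= b <= b by rewrite lexx ab.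
split=> D0.
- have : D b * expR (- K * b) <= D a * expR (- K * a).
    apply: (deriv_le0_ge ab (ca (- K)) (fun x h => da (- K) x (ia x h))) => x /ia h.
    have [_] := hD x h; rewrite ler_norml => /andP[_ h2].
    by rewrite pmulr_rle0 ?expR_gt0//; lra.
  rewrite D0 mul0r pmulr_lle0 ?expR_gt0// => h; apply/eqP.
  by rewrite eq_le h; have [] := hD b bb.
- have : D a * expR (K * a) <= D b * expR (K * b).
    apply: (deriv_ge0_le ab (ca K) (fun x h => da K x (ia x h))) => x /ia h.
    have [_] := hD x h; rewrite ler_norml => /andP[h1 _].
    by rewrite pmulr_rge0 ?expR_gt0//; lra.
  rewrite D0 mul0r pmulr_lle0 ?expR_gt0// => h; apply/eqP.
  by rewrite eq_le h; have [] := hD a aa.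
Qed.

Lemma linear_growth_zero f df (K a b : R) : a <= b ->
  (forall x, a <= x <= b -> is_derive (x : R) 1 f (df x)) ->
  (forall x, a <= x <= b -> `|df x| <= K * `|f x|) ->
  (f a = 0 <-> f b = 0).
Proof.
move=> ab hd h; have sq y : f y = 0 <-> f y ^+ 2 = 0.
  by split=> [->|/eqP]; [rewrite expr0n|rewrite sqrf_eq0 => /eqP].
rewrite (sq a) (sq b).
apply: (@gronwall_zero (fun x => f x ^+ 2) (fun x => 2 * f x * df x) (2 * K)) => //.
  by move=> x /hd h1; exact: deriv_sqr.
move=> x hx; split; first exact: sqr_ge0.
rewrite !normrM (ger0_norm (ler0n _ 2)) -!mulrA ler_pM2l//.
rewrite (_ : K * f x ^+ 2 = `|f x| * (K * `|f x|)).
  by apply: ler_wpM2l => //; exact: h.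
by rewrite -[f x ^+ 2]real_normK ?num_real//; ring.
Qed.

Lemma deriv_neg_lt f df (x d : R) : (forall t : R, is_derive t 1 f (df t)) ->
  continuous df -> df x < 0 -> 0 < d -> exists2 y, x < y < x + d & f y < f x.
Proof.
move=> fdf cdf a0 d0.
have /cvgrPdist_lt/(_ (- df x)) := cdf x; rewrite oppr_gt0 => /(_ a0)[e /= e0 he].
pose m := Num.min d e; have m0 : 0 < m by rewrite lt_min d0.
have md : m <= d by rewrite ge_min lexx.
have me : m <= e by rewrite ge_min lexx orbT.
exists (x + m / 2); first by move: m0 md; clear; lra.
have xm : x < x + m / 2 by move: m0; clear; lra.
apply: (@deriv_lt0_gt _ f df _ _ xm (fun t _ => deriv_continuous (fdf t))
  (fun t _ => fdf t)) => t /andP[xt tm].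
have /he : `|x - t| < e by rewrite ltr0_norm; move: xt tm me m0; clear; lra.
by rewrite ltr_norml => /andP[+ _]; clear; lra.
Qed.

(** The square root of a negative number is 0, so [speed] vanishes where the potential is negative.
    Its primitive [Phi] is thus defined on the whole line, and constant above the peak. *)
Definition speed p lam y : R := Num.sqrt (2 * potential p lam y).

Lemma speed_ge0 p lam y : 0 <= speed p lam y.
Proof. exact: sqrtr_ge0. Qed.

Lemma speedN p lam y : speed p lam (- y) = speed p lam y.
Proof. by rewrite /speed potentialN. Qed.

Lemma continuous_speed p lam : 2 < p -> continuous (speed p lam).
Proof.
move=> p2 y; rewrite /speed; apply: (@continuous_comp _ _ _
  (fun y => 2 * potential p lam y) Num.sqrt); last exact: sqrt_continuous.
by apply: cvgMr; exact: continuous_potential.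
Qed.

Section Half_line_cases.
Context p lam f df (p2 : 2 < p) (lam0 : 0 < lam)
  (ode : ode_solution p lam (@half_line R) f df) (fH1 : H1 (@half_line R) f).

Lemma half_line_speed x : 0 <= x -> speed p lam (f x) = `|df x|.
Proof. by move=> x0; rewrite /speed -(half_line_energy p2 ode fH1 x0) sqrtr_sqr. Qed.

Lemma half_line_zero x : 0 <= x -> (f 0 = 0 <-> f x = 0).
Proof.
move=> x0; have [fdf _ _] := ode.
apply: (linear_growth_zero x0 (fun t _ => fdf t)) => t /andP[t0 _].
exact: half_line_deriv_le p2 ode fH1 _ t0.
Qed.

Lemma half_line_gt0 x : 0 < f 0 -> 0 <= x -> 0 < f x.
Proof.
move=> f0 x0; rewrite ltNge; apply/negP => fx.
have [|c /andP[c0 _] fc] := intermediate_value (v := 0) x0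
    (fun t _ => ode_continuous ode (x := t)).
  by rewrite ge_min le_max fx (ltW f0) orbT.
by move: f0; rewrite ((half_line_zero c0).2 fc) ltxx.
Qed.

Lemma half_line_le_peak x : 0 <= x -> f x <= peak p lam.
Proof.
move=> x0; apply: (potential_ge0_le_peak p2 lam0).
have := half_line_energy p2 ode fH1 x0; have := sqr_ge0 (df x).
by move=> h1 h2; move: h1; rewrite h2 pmulr_rge0.
Qed.

Lemma half_line_crit x : 0 < f 0 -> 0 <= x -> df x = 0 -> f x = peak p lam.
Proof.
move=> f0 x0 dfx; apply: le_anti; rewrite half_line_le_peak//=.
rewrite leNgt; apply/negP => fp.
have := potential_gt0 p2 lam0 (half_line_gt0 f0 x0) fp.
have := half_line_energy p2 ode fH1 x0; rewrite dfx expr0n/= => h.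
by rewrite -(pmulr_rgt0 _ (ltr0n _ 2)) -h ltxx.
Qed.

Lemma half_line_peak x : 0 <= x -> f x = peak p lam -> df x = 0.
Proof.
move=> x0 fx; have := half_line_energy p2 ode fH1 x0.
by rewrite fx potential_peak// mulr0 => /eqP; rewrite sqrf_eq0 => /eqP.
Qed.

(** A critical point y has the peak value. The minimum of [f] over [0, y] is below the peak, so it
    is not attained at y, nor at 0 where the slope is negative; being interior, it would be a
    critical point below the peak. *)
Lemma half_line_decreasing x : 0 < f 0 -> f 0 < peak p lam -> df 0 < 0 ->
  0 <= x -> df x < 0.
Proof.
move=> f0 fp df0 x0; have [fdf cdf _] := ode.
suff nz y : 0 <= y -> df y != 0.
  rewrite ltNge; apply/negP => dfx.
  have [|c /andP[c0 _] dfc] := intermediate_value (v := 0) x0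
      (fun t _ => cdf t).
    by rewrite ge_min le_max dfx (ltW df0) orbT.
  by have := nz c c0; rewrite dfc eqxx.
move=> y0; apply/eqP => dfy.
have fy := half_line_crit f0 y0 dfy.
have [|c] := EVT_min y0 (f := f).
  by apply: continuous_on_within => t _; exact: deriv_continuous (fdf t).
rewrite in_itv/= => /andP[c0 cy] hc.
have fc0 : f c <= f 0 by apply: hc; rewrite in_itv/= lexx.
have fcp : f c < peak p lam := le_lt_trans fc0 fp.
have cy' : c < y.
  by rewrite lt_neqAle cy andbT; apply/eqP => e; move: fcp; rewrite e fy ltxx.
move: c0; rewrite le_eqVlt => /predU1P[e|c0].
  have y0' : 0 < y - c by rewrite subr_gt0.
  have [|z /andP[z1 z2]] := deriv_neg_lt (x := c) fdf cdf _ y0'; first by rewrite -e.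
  rewrite ltNge hc// in_itv/=; apply/andP; split; last by move: z2; rewrite addrC subrK => /ltW.
  by move: z1; rewrite -e; exact: ltW.
have := @derive1_at_min _ f 0 y c y0 (fun t _ => @ex_derive _ _ _ _ _ _ _ (fdf t)).
rewrite in_itv/= c0 cy' => /(_ isT) h.
have {h} := h _; case => [t|_ dfc].
  by rewrite in_itv/= => /andP[t0 ty]; apply: hc; rewrite in_itv/= !ltW.
have [_ dfc'] := fdf c.
have dc : df c = 0 by rewrite -dfc'.
by move: fcp; rewrite half_line_crit ?ltxx// ltW.
Qed.

(** Without a critical point [f] would increase forever from a positive value, against its decay to
    0. *)
Lemma half_line_reaches_peak : 0 < f 0 -> 0 < df 0 ->
  exists2 c, 0 <= c & f c = peak p lam.
Proof.
move=> f0 df0; have [fdf cdf _] := ode.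
have [[c c0 dfc]|nz] := pselect (exists2 c, 0 <= c & df c = 0).
  by exists c => //; exact: half_line_crit.
have dpos x : 0 <= x -> 0 < df x.
  move=> x0; rewrite ltNge; apply/negP => dfx; apply: nz.
  have [|c /andP[c0 _] dfc] := intermediate_value (v := 0) x0
      (fun t _ => cdf t); last by exists c.
  by rewrite ge_min le_max dfx (ltW df0) orbT.
have [fl _] := half_line_cvg0 p2 ode fH1.
suff : f 0 <= 0 by rewrite leNgt f0.
apply: cvgr_to_ge fl _; near=> x.
have x0 : 0 <= x by near: x; exact: nbhs_pinfty_ge.
apply: (deriv_ge0_le x0 (fun t _ => deriv_continuous (fdf t))
  (fun t _ => fdf t)) => t /andP[t0 _].
by rewrite ltW// dpos// ltW.
Unshelve. all: by end_near. Qed.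

Context Phi (dPhi : forall y : R, is_derive y 1 Phi (speed p lam y)) (Phi0 : Phi 0 = 0).

Let density (x : R) : R := (2^-1 - p^-1) * pabs p (f x).
(** The virial identity and zero energy give [density] = f'^2 - (f f')' / 2, while f'^2 >= s
    speed(f) f' for s = 1 or -1. Hence the derivative of [branch s] never exceeds [density], with
    equality where s f' >= 0. *)
Let branch (s x : R) : R := s * Phi (f x) - 2^-1 * (f x * df x).

Let deriv_branch (s x : R) : 0 <= x -> is_derive x 1 (branch s)
  (density x - (df x ^+ 2 - s * (speed p lam (f x) * df x))).
Proof.
move=> x0; have [fdf _ _] := ode.
have hx : half_line x by rewrite half_lineE.
have := deriv_sub (deriv_scale s (@deriv_comp _ Phi f _ _ _ (dPhi (f x)) (fdf x)))
  (deriv_scale 2^-1 (deriv_virial p2 ode hx)).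
move/is_derive_eq; apply.
have := half_line_energy p2 ode fH1 x0; rewrite /potential /density.
set S := speed _ _ _; set P := pabs _ _; set F := f x ^+ 2; set D := df x ^+ 2.
move: (s * (S * df x)) => Y.
rewrite (_ : 2 * (lam * F / 2 - P / p) = lam * F - 2 * (p^-1 * P)); first by lra.
by field; exact: lt0r_neq0 (lt_trans (ltr0n _ 2) p2).
Qed.

Let speed_df (s x : R) : 0 <= x -> `|s| = 1 ->
  0 <= df x ^+ 2 - s * (speed p lam (f x) * df x).
Proof.
move=> x0 s1; rewrite (half_line_speed x0) subr_ge0.
apply: le_trans (ler_norm _) _; rewrite !normrM s1 mul1r normr_id -expr2.
by rewrite real_normK// num_real.
Qed.

Let density_primitive : exists2 N : R -> R,
  (forall x : R, is_derive x 1 N (density x)) &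
  forall x, 0 <= x ->
    N x - N 0 <= (2^-1 - p^-1) * \int[mu]_(t in @half_line R) pabs p (f t).
Proof.
have cden : continuous density.
  by move=> x; apply: cvgMr; exact: (continuous_pabs_comp p2 (ode_continuous ode)).
have [N dN] := antiderivative_exists cden; exists N => // x x0.
rewrite -(Rintegral_FTC x0 dN cden).
have [_ _ fps] := half_line_summable p2 ode fH1.
rewrite -RintegralZl//; last exact: measurable_itv.
apply: le_Rintegral_subset => //; first exact: measurable_itv.
- by move=> t /=; rewrite in_itv/= half_lineE => /andP[].
- move=> t _; rewrite mulr_ge0 ?pabs_ge0// subr_ge0 lef_pV2 ?posrE//.
  + exact: ltW.
  + exact: lt_trans p2.
- by apply: summableZ => //; exact: measurable_itv.
Qed.

Let branch_cvg0 s : branch s x @[x --> +oo] --> 0.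
Proof.
have [f0 df0] := half_line_cvg0 p2 ode fH1.
rewrite (_ : 0 = s * Phi 0 - 2^-1 * (0 * 0)); last by rewrite Phi0; ring.
apply: cvgB; apply: cvgMr; last exact: cvgM.
by apply: (@cvg_comp _ _ _ f Phi _ _ _ f0); exact: deriv_continuous (dPhi 0).
Qed.

(** The comparison is used with sign 1 on [0, c] and sign -1 beyond, where [branch] tends to 0. If
    [f c] is the peak this exhibits a full soliton's 2 Phi(M); [c = 0] gives the bound attained by
    decreasing solutions. *)
Lemma half_line_action_ge (c : R) : 0 <= c ->
  2 * Phi (f c) - Phi (f 0) + 2^-1 * (f 0 * df 0) <=
  (2^-1 - p^-1) * \int[mu]_(x in @half_line R) pabs p (f x).
Proof.
move=> c0; have [N dN Nle] := density_primitive.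
have mono (s a b : R) : `|s| = 1 -> 0 <= a -> a <= b ->
    branch s b - branch s a <= N b - N a.
  move=> s1 a0 ab; suff : N a - branch s a <= N b - branch s b by lra.
  apply: (@deriv_ge0_le _ (fun t => N t - branch s t)
    (fun t => density t - (density t - (df t ^+ 2 - s * (speed p lam (f t) * df t))))
    _ _ ab).
  - move=> t /andP[at0 _]; have t0 := le_trans a0 at0.
    exact: deriv_continuous (deriv_sub (dN t) (deriv_branch s t0)).
  - move=> t /andP[at0 _]; have t0 := le_trans a0 (ltW at0).
    exact: deriv_sub (dN t) (deriv_branch s t0).
  - move=> t /andP[at0 _]; have t0 := le_trans a0 (ltW at0).
    by have := speed_df t0 s1; lra.
have h1 := mono 1 0 c (normr1 _) (lexx _) c0.
have N1 : `|- 1 : R| = 1 by rewrite normrN normr1.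
set nn := (X in _ <= X); set v := (X in X <= _).
have lim : v + branch (- 1) x @[x --> +oo] --> v + 0.
  by apply: cvgD; [exact: cvg_cst|exact: branch_cvg0].
rewrite addr0 in lim; apply: cvgr_to_le lim _; near=> x.
have cx : c <= x by near: x; apply: nbhs_pinfty_ge; exact: num_real.
have h2 := mono (- 1) c x N1 c0 cx.
have h3 := Nle x (le_trans c0 cx).
move: h1 h2; rewrite /v /nn; move: h3; rewrite /branch.
move: (_ * \int[mu]_(t in _) _) => J.
by move: (N x) (N 0) (N c) (Phi _) (Phi _) (Phi _) (f 0 * _) (f c * _) (f x * _) => *; lra.
Unshelve. all: by end_near. Qed.

Lemma half_line_action_eq : (forall x : R, 0 <= x -> df x <= 0) ->
  (2^-1 - p^-1) * \int[mu]_(x in @half_line R) pabs p (f x)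
  = Phi (f 0) + 2^-1 * (f 0 * df 0).
Proof.
move=> dneg; have [_ _ fps] := half_line_summable p2 ode fH1.
have cden : continuous density.
  by move=> x; apply: cvgMr; exact: (continuous_pabs_comp p2 (ode_continuous ode)).
have [N dN] := antiderivative_exists cden.
rewrite -RintegralZl//; last exact: measurable_itv.
have NE x : 0 <= x -> N x = branch (- 1) x + (N 0 - branch (- 1) 0).
  move=> x0; suff : N x - branch (- 1) x = N 0 - branch (- 1) 0 by lra.
  apply: (@deriv_eq0_cst _ (fun t => N t - branch (- 1) t)
    (fun t => density t - (density t - (df t ^+ 2 - - 1 * (speed p lam (f t) * df t))))
    _ _ x0).
  - by move=> t /andP[t0 _]; exact: deriv_continuous (deriv_sub (dN t) (deriv_branch _ t0)).
  - by move=> t /andP[/ltW t0 _]; exact: deriv_sub (dN t) (deriv_branch _ t0).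
  - move=> t /andP[/ltW t0 _]; rewrite (half_line_speed t0) ler0_norm ?dneg//; ring.
rewrite (half_line_FTC (F := N) (l := 0 + (N 0 - branch (- 1) 0)) dN)//.
- by rewrite /branch; ring.
- by apply: summableZ => //; exact: measurable_itv.
- have : branch (- 1) x + (N 0 - branch (- 1) 0) @[x --> +oo] -->
      0 + (N 0 - branch (- 1) 0).
    by apply: cvgD; [exact: branch_cvg0|exact: cvg_cst].
  apply: cvg_trans; apply: near_eq_cvg; near=> x.
  have x0 : 0 <= x by near: x; exact: nbhs_pinfty_ge.
  by rewrite -NE.
Unshelve. all: by end_near. Qed.

End Half_line_cases.
End Half_line_shape.

(** * Oscillations on the terminal edge *)

Section Edge_shape.
Context {R : realType}.
Local Notation mu := (@lebesgue_measure R).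
Implicit Types (p lam ell : R) (I : set R) (f df Phi : R -> R).

Lemma interior_min_crit f df (a b c : R) :
  (forall x : R, is_derive x 1 f (df x)) -> a < c < b ->
  (forall x, a <= x <= b -> f c <= f x) -> df c = 0.
Proof.
move=> fdf /andP[ac cb] hc; have ab : a <= b by rewrite ltW// (lt_trans ac).
have := @derive1_at_min _ f a b c ab (fun t _ => @ex_derive _ _ _ _ _ _ _ (fdf t)).
rewrite in_itv/= ac cb => /(_ isT) h.
have {h} := h _; case => [t|_ dfc].
  by rewrite in_itv/= => /andP[t0 ty]; apply: hc; rewrite !ltW.
by have [_ dfc'] := fdf c; rewrite -dfc'.
Qed.

Lemma interior_max_crit f df (a b c : R) :
  (forall x : R, is_derive x 1 f (df x)) -> a < c < b ->
  (forall x, a <= x <= b -> f x <= f c) -> df c = 0.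
Proof.
move=> fdf acb hc; apply/eqP; rewrite -oppr_eq0; apply/eqP.
apply: (@interior_min_crit (fun x => - f x) (fun x => - df x) a b c) => //.
by move=> x /hc; rewrite lerN2.
Qed.

Lemma pabsM p (t y : R) : 0 <= t -> pabs p (t * y) = t `^ p * pabs p y.
Proof. by move=> t0; rewrite /pabs normrM powRM// ger0_norm. Qed.

Lemma force_eq0_norm p lam y : 2 < p -> 0 < lam -> peak p lam < `|y| ->
  force p lam y != 0.
Proof.
move=> p2 l0 py; have wy := lt_trans (well_lt_peak p2 l0) py.
have [y0|y0] := leP 0 y.
  by rewrite lt_eqF// force_lt0//; rewrite ger0_norm in wy.
by rewrite -[y]opprK forceN oppr_eq0 lt_eqF// force_lt0// -ltr0_norm.
Qed.

Section Oscillation.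
Context p lam I f df (z a b : R) (p2 : 2 < p) (lam0 : 0 < lam)
  (ode : ode_solution p lam I f df) (zp : peak p lam < z) (ab : a < b)
  (Iab : forall x, a <= x <= b -> I x)
  (fz : forall x, a <= x <= b -> `|f x| <= z).

Lemma oscillation_extrema :
  (forall x, a <= x <= b -> df x = 0 -> `|f x| = z) -> df a = 0 -> df b = 0 ->
  exists c d, [/\ a <= c <= b, a <= d <= b, f c = z, f d = - z
    & df c = 0 /\ df d = 0].
Proof.
move=> crit dfa dfb; have [fdf cdf dfF] := ode.
have aa : a <= a <= b by rewrite lexx ltW. have bb : a <= b <= b by rewrite lexx ltW.
have z0 : 0 < z := lt_trans (peak_gt0 p2 lam0) zp.
have cf : {within `[a, b], continuous f}.
  by apply: continuous_on_within => t _; exact: deriv_continuous (fdf t).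
have [c] := EVT_min (ltW ab) cf; have [d] := EVT_max (ltW ab) cf.
rewrite !in_itv/= => hd dmax hc cmin.
have {}cmin x : a <= x <= b -> f c <= f x by move=> h; apply: cmin; rewrite in_itv.
have {}dmax x : a <= x <= b -> f x <= f d by move=> h; apply: dmax; rewrite in_itv.
have ends (P : R -> Prop) x : a <= x <= b -> P a -> P b ->
    (a < x < b -> P x) -> P x.
  move=> /andP[]; rewrite le_eqVlt => /predU1P[<-//|ax].
  by rewrite le_eqVlt => /predU1P[->//|xb] _ _; apply; rewrite ax xb.
have dfc : df c = 0.
  by apply: (ends (fun x => df x = 0)) => // h; exact: (interior_min_crit fdf h).
have dfd : df d = 0.
  by apply: (ends (fun x => df x = 0)) => // h; exact: (interior_max_crit fdf h).
suff cd : f c != f d.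
  have := crit c hc dfc; have := crit d hd dfd.
  have := cmin d hd; rewrite le_eqVlt (negbTE cd)/=.
  have [fc0|fc0] := leP 0 (f c); have [fd0|fd0] := leP 0 (f d).
  - by rewrite !ger0_norm// => h <-; move: h => /[swap] ->; rewrite ltxx.
  - by move=> /(le_lt_trans fc0)/ltW/le_lt_trans/(_ fd0); rewrite ltxx.
  - rewrite (ltr0_norm fc0) (ger0_norm fd0) => _ fd fc.
    by exists d, c; split => //; rewrite -fc opprK.
  - by rewrite !ltr0_norm// => h <- /oppr_inj; move: h => /[swap] ->; rewrite ltxx.
apply/eqP => cd.
have cst x : a <= x <= b -> f x = f c.
  by move=> hx; apply: le_anti; rewrite cmin// cd dmax.
pose m := (a + b) / 2.
have hm : a < m < b by rewrite /m; move: (ab); lra.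
have hm' : a <= m <= b by case/andP: hm => /ltW-> /ltW->.
have cst0 x : a < x < b -> df x = 0.
  move=> hx; apply: (interior_min_crit fdf hx) => y hy.
  by rewrite !cst//; case/andP: hx => /ltW-> /ltW->.
have := force_eq0_norm p2 lam0 (y := f m); rewrite crit// ?cst0// => /(_ zp)/eqP; apply.
have := dfF m (Iab hm').
have hz : \forall x \near m, (0 : R) = df x.
  near=> x; rewrite cst0//; near: x; exact: near_in_itvoo.
move=> [_ <-]; have [_] := near_eq_deriv hz (deriv_const 0 m); by [].
Unshelve. all: by end_near. Qed.

(** The factor t = peak / z brings [f] into the range where the potential is nonnegative. Since [f]
    is critical at both ends it satisfies a Nehari identity on [a, b], so by [fibre_max] the action
    of t f is at most the right-hand side. By the arithmetic-geometric inequality the action density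
    of t f dominates |speed(t f) t f'|, whose integral bounds the variation of Phi(t f). *)
Lemma oscillation_action_ge Phi : (forall y : R, is_derive y 1 Phi (speed p lam y)) ->
  df a = 0 -> df b = 0 ->
  `|Phi (peak p lam / z * f b) - Phi (peak p lam / z * f a)| <=
  (2^-1 - p^-1) * \int[mu]_(x in `[a, b]) pabs p (f x).
Proof.
move=> dPhi dfa dfb; have [fdf cdf dfF] := ode; have cf := ode_continuous ode.
have z0 : 0 < z := lt_trans (peak_gt0 p2 lam0) zp.
set t := peak p lam / z.
have t0 : 0 < t by rewrite divr_gt0// peak_gt0.
have := virial_itv p2 ode (ltW ab) Iab; rewrite dfa dfb !mulr0 subrr.
pose e x := 2^-1 * t ^+ 2 * df x ^+ 2 + 2^-1 * t ^+ 2 * lam * f x ^+ 2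
  - p^-1 * t `^ p * pabs p (f x).
have eE x : e x = t ^+ 2 * df x ^+ 2 / 2 + potential p lam (t * f x).
  rewrite /e /potential pabsM ?(ltW t0)//; ring.
have c1 := continuous_sqr cdf; have c2 := continuous_sqr cf.
have c3 := continuous_pabs_comp p2 cf.
have ce : continuous e.
  move=> x; apply: cvgB; last by apply: cvgMr; exact: c3.
  by apply: cvgD; apply: cvgMr; [exact: c1|exact: c2].
have [G dG] := antiderivative_exists ce.
have mI : measurable (`[a, b] : set R) by exact: measurable_itv.
have s1 : summable `[a, b] (fun x => df x ^+ 2) := continuous_integrable a b c1.
have s2 : summable `[a, b] (fun x => f x ^+ 2) := continuous_integrable a b c2.
have s3 : summable `[a, b] (fun x => pabs p (f x)) := continuous_integrable a b c3.
have := Rintegral_FTC (ltW ab) dG ce.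
rewrite /e RintegralB//; last 2 first.
- by apply: summableD => //; exact: summableZ.
- exact: summableZ.
rewrite RintegralD//; try exact: summableZ.
rewrite !RintegralZl//.
have P0 : 0 <= \int[mu]_(x in `[a, b]) pabs p (f x).
  by apply: Rintegral_ge0 => x _; exact: pabs_ge0.
move: P0; move: (\int[mu]_(x in _) _) (\int[mu]_(x in _) _) (\int[mu]_(x in _) _).
move=> Q K P P0 GE vir.
have Gle : G b - G a <= (2^-1 - p^-1) * P.
  rewrite -GE; apply: le_trans (ler_wpM2r P0 (fibre_max p2 (ltW t0))).
  rewrite le_eqVlt; apply/orP; left; apply/eqP.
  rewrite (_ : K = P - lam * Q); last by move: vir; lra.
  by ring.
apply: le_trans Gle.
have mono s : `|s| = 1 -> s * (Phi (t * f b) - Phi (t * f a)) <= G b - G a.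
  move=> ns; suff : G a - s * Phi (t * f a) <= G b - s * Phi (t * f b) by lra.
  have dd (x : R) : is_derive x 1 (fun x => G x - s * Phi (t * f x))
      (e x - s * (speed p lam (t * f x) * (t * df x))).
    exact: deriv_sub (dG x) (deriv_scale s (@deriv_comp _ Phi
      (fun x => t * f x) _ _ _ (dPhi _) (deriv_scale t (fdf x)))).
  apply: (deriv_ge0_le (ltW ab) (fun x _ => deriv_continuous (dd x)) (fun x _ => dd x)).
  move=> x /andP[ax xb]; rewrite eE subr_ge0.
  apply: le_trans (ler_norm _) _; rewrite normrM ns mul1r normrM.
  have H0 : 0 <= potential p lam (t * f x).
    apply: potential_ge0_of_le => //; rewrite normrM (gtr0_norm t0) /t.
    rewrite mulrAC -mulrA ger_pMr ?peak_gt0// ler_pdivrMr// mul1r.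
    by apply: fz; rewrite !ltW.
  have := sqr_sqrtr (mulr_ge0 (ler0n _ 2) H0).
  rewrite (ger0_norm (speed_ge0 _ _ _)) -/(speed p lam (t * f x)).
  have : `|t * df x| ^+ 2 = t ^+ 2 * df x ^+ 2 by rewrite real_normK ?num_real// exprMn.
  move: (speed _ _ _) (potential _ _ _) (`|t * df x|) (t ^+ 2 * _) => S H X Y <- h.
  have := sqr_ge0 (S - X); rewrite sqrrB h; lra.
rewrite ler_norml; have := mono 1 (normr1 _); have := mono (- 1).
by rewrite normrN normr1 => /(_ erefl); lra.
Qed.

End Oscillation.
End Edge_shape.

(** * Dichotomy: action at least that of a soliton, or type A up to sign *)

Section Classification.
Context {R : realType}.
Local Notation mu := (@lebesgue_measure R).
Implicit Types (p lam ell : R) (f g Phi : R -> R) (u : gfun R).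

(** The terminal edge of a type A solution. The slope [2 * speed p lam (f 0)] is the Kirchhoff
    condition when both half-lines leave the vertex with slope [- speed p lam (f 0)]. *)
Record edge_profile p lam ell f g : Prop := EdgeProfile {
  profile_ode : ode_solution p lam (terminal_edge ell) f g;
  profile_start : 0 < f 0 < peak p lam;
  profile_slope : g 0 = 2 * speed p lam (f 0);
  profile_end : g ell = 0;
  profile_incr : forall x, 0 <= x < ell -> 0 < g x }.

Record branch_A p lam ell u f1 g1 f2 g2 f3 g3 : Prop := BranchA {
  branch_split : split_solution p lam ell u f1 g1 f2 g2 f3 g3;
  branch_profile : edge_profile p lam ell f3 g3;
  branch_slope1 : g1 0 = - speed p lam (f3 0);
  branch_slope2 : g2 0 = - speed p lam (f3 0) }.

Lemma speed_sqr p lam y : 0 <= potential p lam y ->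
  speed p lam y ^+ 2 = 2 * potential p lam y.
Proof. by move=> h; rewrite sqr_sqrtr// mulr_ge0. Qed.

Lemma odd_speed_primitive p lam Phi : (forall y : R, is_derive y 1 Phi (speed p lam y)) ->
  Phi 0 = 0 -> forall y, 0 <= y -> Phi (- y) = - Phi y.
Proof.
move=> dPhi Phi0 y y0; suff : Phi y + Phi (0 - y) = Phi 0 + Phi (0 - 0).
  by rewrite sub0r subr0 Phi0; lra.
have dd (x : R) : is_derive x 1 (fun x => Phi x + Phi (0 - x))
    (speed p lam x + - speed p lam (0 - x)).
  exact: deriv_add (dPhi x) (deriv_reflect (dPhi (0 - x))).
apply: (deriv_eq0_cst y0 (fun x _ => deriv_continuous (dd x)) (fun x _ => dd x)).
by move=> x _; rewrite sub0r speedN subrr.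
Qed.

Lemma edge_energy p lam ell f g x : 2 < p -> ode_solution p lam (terminal_edge ell) f g ->
  0 <= x <= ell ->
  g x ^+ 2 = 2 * potential p lam (f x) + (g 0 ^+ 2 - 2 * potential p lam (f 0)).
Proof.
move=> p2 ode /andP[x0 xl].
suff : g x ^+ 2 / 2 - potential p lam (f x) = g 0 ^+ 2 / 2 - potential p lam (f 0) by lra.
by apply: (ode_energy p2 ode x0) => t /andP[t0 tx]; rewrite terminal_edgeE t0 (le_trans tx).
Qed.

Section Split_cases.
Context p lam ell u f1 g1 f2 g2 f3 g3 Phi (p2 : 2 < p) (lam0 : 0 < lam) (ell0 : 0 < ell)
  (us : split_solution p lam ell u f1 g1 f2 g2 f3 g3)
  (dPhi : forall y : R, is_derive y 1 Phi (speed p lam y)) (Phi0 : Phi 0 = 0).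

Local Notation nn1 := ((2^-1 - p^-1) * \int[mu]_(x in @half_line R) pabs p (f1 x)).
Local Notation nn2 := ((2^-1 - p^-1) * \int[mu]_(x in @half_line R) pabs p (f2 x)).
Local Notation nn3 := ((2^-1 - p^-1) * \int[mu]_(x in `[0, ell]) pabs p (f3 x)).

Lemma split_action_edges : action ell p lam u = nn1 + nn2 + nn3.
Proof. by rewrite (split_action p2 ell0 us) (split_gintegral us) !mulrDr. Qed.

Let pgap : 0 <= 2^-1 - p^-1.
Proof.
rewrite subr_ge0 lef_pV2 ?posrE//; first exact: ltW.
by apply: lt_trans p2.
Qed.

Let density_ge0 (I : set R) f :
  0 <= (2^-1 - p^-1) * \int[mu]_(x in I) pabs p (f x).
Proof. by apply: mulr_ge0 pgap _; apply: Rintegral_ge0 => x _; exact: pabs_ge0. Qed.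

Let nn3_ge0 : 0 <= nn3 := density_ge0 `[0, ell] f3.

Let f10 : f1 0 = f3 0. Proof. by rewrite (split_vertex12 us) (split_vertex23 us). Qed.
Let f20 : f2 0 = f3 0. Proof. by rewrite (split_vertex23 us). Qed.

(* A second critical point on the terminal edge forces a full oscillation, which
   costs at least the action of a soliton. *)
Let oscillating_action x1 : 0 < f3 0 < peak p lam -> g3 0 ^+ 2 = 4 * (2 * potential p lam (f3 0)) ->
  0 <= x1 < ell -> g3 x1 = 0 -> 2 * Phi (peak p lam) <= nn3.
Proof.
move=> /andP[a0 ap] slope /andP[x10 x1l] gx1; have ode := split_ode3 us.
have hp := potential_gt0 p2 lam0 a0 ap.
have ener x : 0 <= x <= ell ->
    g3 x ^+ 2 = 2 * potential p lam (f3 x) + 6 * potential p lam (f3 0).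
  by move=> hx; rewrite (edge_energy p2 ode hx) slope; ring.
have ell2 : 0 <= ell <= ell by rewrite lexx ltW.
(* The conserved quantity keeps the potential at or above -3 times its vertex value, and this bound
   is attained at the Neumann end. Hence |f3| is maximal there, above the peak. *)
pose z : R := `|f3 ell|.
have Hz : potential p lam z = - 3 * potential p lam (f3 0).
  rewrite /z potential_norm; have := ener ell ell2; rewrite (split_neumann us) expr0n/=.
  by move: (potential _ _ _) (potential _ _ _) => A B; lra.
have zp : peak p lam < z.
  rewrite ltNge; apply/negP => h; have := @potential_ge0_of_le _ p lam z p2 lam0.
  rewrite normr_id => /(_ h); rewrite Hz; move: hp; move: (potential _ _ _) => A; lra.
have z0 : 0 < z := lt_trans (peak_gt0 p2 lam0) zp.
have fz x : 0 <= x <= ell -> `|f3 x| <= z.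
  move=> hx; apply: (potential_le_norm p2 lam0 zp); rewrite Hz.
  have := sqr_ge0 (g3 x); rewrite (ener x hx).
  by move: (potential _ _ _) (potential _ _ _) => A B; lra.
have crit x : 0 <= x <= ell -> g3 x = 0 -> `|f3 x| = z.
  move=> hx gx; apply: le_anti; rewrite fz//=.
  rewrite leNgt; apply/negP => fxz.
  have Hx : potential p lam `|f3 x| = potential p lam z.
    rewrite potential_norm Hz; have := ener x hx; rewrite gx expr0n/=.
    by move: (potential _ _ _) (potential _ _ _) => A B; lra.
  have pf : peak p lam < `|f3 x|.
    rewrite ltNge; apply/negP => h; have := @potential_ge0_of_le _ p lam _ p2 lam0 h.
    rewrite -potential_norm Hx Hz; move: hp; move: (potential _ _ _) => A; lra.
  have := potential_decr p2 lam0 (ltW (lt_trans (well_lt_peak p2 lam0) pf)) fxz.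
  by rewrite Hx ltxx.
have sub x : x1 <= x <= ell -> 0 <= x <= ell.
  by move=> /andP[h ->]; rewrite andbT (le_trans x10).
have Isub x : x1 <= x <= ell -> terminal_edge ell x by move=> /sub; rewrite terminal_edgeE.
have [c [d [hc hd fc fd [gc gd]]]] := oscillation_extrema p2 lam0 ode zp x1l Isub
  (fun x h => crit x (sub x h)) gx1 (split_neumann us).
have main a b : a < b -> 0 <= a -> b <= ell -> g3 a = 0 -> g3 b = 0 ->
    `|Phi (peak p lam / z * f3 b) - Phi (peak p lam / z * f3 a)| <= nn3.
  move=> ab a0' bl ga gb.
  have hI x : a <= x <= b -> 0 <= x <= ell.
    by move=> /andP[h1 h2]; rewrite (le_trans a0') ?(le_trans h2).
  have hI' x : a <= x <= b -> terminal_edge ell x by move=> /hI; rewrite terminal_edgeE.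
  have := oscillation_action_ge p2 lam0 ode zp ab hI'
    (fun x h => fz x (hI x h)) dPhi ga gb.
  move/le_trans; apply; apply: ler_wpM2l => //.
  apply: le_Rintegral_subset; [exact: measurable_itv|exact: measurable_itv| | |].
  - by move=> x /=; rewrite !in_itv/= => /hI.
  - by move=> x _; exact: pabs_ge0.
  - exact: continuous_integrable 0 ell (continuous_pabs_comp p2 (ode_continuous ode)).
have zM : peak p lam / z * z = peak p lam by rewrite divfK// gt_eqF.
have odd := odd_speed_primitive dPhi Phi0 (ltW (peak_gt0 p2 lam0)).
have cl : 0 <= c <= ell := sub c hc. have dl : 0 <= d <= ell := sub d hd.
have [cd|dc|e] := ltgtP c d.
- have := main c d cd; case/andP: cl => -> _; case/andP: dl => _ -> /(_ isT isT gc gd).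
  rewrite fc fd mulrN zM odd => /(le_trans _); apply.
  by rewrite -normrN; apply: le_trans (ler_norm _); lra.
- have := main d c dc; case/andP: dl => -> _; case/andP: cl => _ -> /(_ isT isT gd gc).
  rewrite fc fd mulrN zM odd => /(le_trans _); apply.
  by apply: le_trans (ler_norm _); lra.
- by move: fd; rewrite -e fc => h; move: z0; lra.
Qed.

Lemma split_classification : 0 < f3 0 ->
  2 * Phi (peak p lam) <= action ell p lam u \/
  branch_A p lam ell u f1 g1 f2 g2 f3 g3.
Proof.
move=> a0; have ode1 := split_ode1 us; have ode2 := split_ode2 us; have ode3 := split_ode3 us.
have h1 := split_H1_1 us; have h2 := split_H1_2 us.
have a1 : 0 < f1 0 by rewrite f10. have a2 : 0 < f2 0 by rewrite f20.
have s1 := half_line_speed p2 ode1 h1 (lexx 0).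
have s2 := half_line_speed p2 ode2 h2 (lexx 0).
have e1' := half_line_energy p2 ode1 h1 (lexx 0).
have ap := half_line_le_peak p2 lam0 ode1 h1 (lexx 0).
have kir := split_kirchhoff us.
have ge1 c := half_line_action_ge p2 ode1 h1 dPhi Phi0 (c := c).
have ge2 c := half_line_action_ge p2 ode2 h2 dPhi Phi0 (c := c).
rewrite f10 in s1 e1' ap ge1; rewrite f20 in s2 ge2.
have sum_le (P F x y A B C : R) : 0 <= C -> 0 <= x + y ->
    2 * F - F + 2^-1 * y <= B -> 2 * P - F + 2^-1 * x <= A -> 2 * P <= A + B + C.
  by lra.
rewrite split_action_edges.
(* Both half-lines start at the same height, so their initial slopes have the same modulus. If one
   of them is positive the sum of the two is nonnegative, and the boundary terms have the favourable
   sign. *)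
have [g1p|g1n] := ltP 0 (g1 0).
  left; have [c c0 fc] := half_line_reaches_peak p2 lam0 ode1 h1 a1 g1p.
  have := ge1 c c0; have := ge2 0 (lexx _); rewrite fc f20.
  have : 0 <= g1 0 + g2 0.
    by move: s2; rewrite s1 gtr0_norm// => ->; have := ler_norm (- g2 0); rewrite normrN; lra.
  move=> /(mulr_ge0 (ltW a0)); move: nn3_ge0.
  by rewrite mulrDr; exact: sum_le.
have [g2p|g2n] := ltP 0 (g2 0).
  left; have [c c0 fc] := half_line_reaches_peak p2 lam0 ode2 h2 a2 g2p.
  have := ge2 c c0; have := ge1 0 (lexx _); rewrite fc f10.
  have : 0 <= g1 0 + g2 0.
    by move: s1; rewrite s2 gtr0_norm// => ->; have := ler_norm (- g1 0); rewrite normrN; lra.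
  move=> /(mulr_ge0 (ltW a0)); move: nn3_ge0.
  by rewrite mulrDr [f3 0 * _ + _]addrC [X in X + nn3]addrC; exact: sum_le.
(* Starting at the peak, both half-lines have slope 0 and each alone costs [Phi (peak p lam)]. *)
have [aM|aM] := eqVneq (f3 0) (peak p lam).
  left; have z1 : g1 0 = 0 by apply: (half_line_peak p2 lam0 ode1 h1) => //; rewrite f10.
  have z2 : g2 0 = 0 by apply: (half_line_peak p2 lam0 ode2 h2) => //; rewrite f20.
  have := ge1 0 (lexx _); have := ge2 0 (lexx _); rewrite f10 f20 z1 z2 aM.
  by move=> hB hA; apply: (sum_le _ _ _ _ _ _ _ nn3_ge0 _ hB hA); rewrite mulr0 addr0.
have {aM} ap' : f3 0 < peak p lam by rewrite lt_neqAle aM.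
have S1 : g1 0 = - speed p lam (f3 0) by rewrite s1 ler0_norm// opprK.
have S2 : g2 0 = - speed p lam (f3 0) by rewrite s2 ler0_norm// opprK.
have S3 : g3 0 = 2 * speed p lam (f3 0) by move: kir; rewrite S1 S2; lra.
have Hp := potential_gt0 p2 lam0 a0 ap'.
have Sp : 0 < speed p lam (f3 0) by rewrite sqrtr_gt0 mulr_gt0.
have S3' : g3 0 ^+ 2 = 4 * (2 * potential p lam (f3 0)).
  by rewrite S3 exprMn speed_sqr ?(ltW Hp)//; ring.
have ap2 : 0 < f3 0 < peak p lam by rewrite a0.
have [[x hx gx]|nz] := pselect (exists2 x, 0 <= x < ell & g3 x = 0).
  left; apply: le_trans (oscillating_action ap2 S3' hx gx) _.
  have tail (A B C : R) : 0 <= A -> 0 <= B -> C <= A + B + C by lra.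
  exact: (tail _ _ _ (density_ge0 (@half_line R) f1) (density_ge0 (@half_line R) f2)).
right; split => //; split => //; first exact: split_neumann us.
move=> x /andP[x0 xl]; rewrite ltNge; apply/negP => gx; apply: nz.
have [_ cg _] := ode3.
have [|c /andP[c0 cx] gc] := intermediate_value (v := 0) x0 (fun t _ => cg t).
  by rewrite ge_min le_max gx S3 mulr_ge0 ?(ltW Sp)// orbT.
by exists c => //; rewrite c0 (le_lt_trans cx).
Qed.

End Split_cases.

(** A zero at the vertex forces zero slopes there, by the half-line bound on the derivative and
    Kirchhoff. The terminal edge then has zero energy as well, so |f'| <= sqrt(lam) |f| on it. *)
Lemma solution_zero p lam ell u f1 g1 f2 g2 f3 g3 : 2 < p -> 0 < lam -> 0 < ell ->
  split_solution p lam ell u f1 g1 f2 g2 f3 g3 -> f3 0 = 0 ->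
  eq_on_graph ell u (gzero R).
Proof.
move=> p2 lam0 ell0 us a0.
have f10 : f1 0 = 0 by rewrite (split_vertex12 us) (split_vertex23 us).
have f20 : f2 0 = 0 by rewrite (split_vertex23 us).
have d1 := half_line_deriv_le p2 (split_ode1 us) (split_H1_1 us) (lexx 0).
have d2 := half_line_deriv_le p2 (split_ode2 us) (split_H1_2 us) (lexx 0).
rewrite f10 normr0 mulr0 normr_le0 in d1; rewrite f20 normr0 mulr0 normr_le0 in d2.
have g30 : g3 0 = 0.
  by have := split_kirchhoff us; rewrite (eqP d1) (eqP d2) !add0r.
split => x; rewrite inE ?half_lineE ?terminal_edgeE /= => hx.
- rewrite -(split_eq1 us hx).
  exact: (half_line_zero p2 (split_ode1 us) (split_H1_1 us) hx).1.
- rewrite -(split_eq2 us hx).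
  exact: (half_line_zero p2 (split_ode2 us) (split_H1_2 us) hx).1.
- rewrite -(split_eq3 us hx); have [fdf _ _] := split_ode3 us.
  case/andP: (hx) => x0 xl.
  apply: (linear_growth_zero (K := Num.sqrt lam) x0 (fun t _ => fdf t) _).1 => //.
  move=> t /andP[t0 tx]; have ht : 0 <= t <= ell by rewrite t0 (le_trans tx).
  rewrite -(@ler_pXn2r _ 2)// ?nnegrE// ?mulr_ge0// ?sqrtr_ge0//.
  rewrite exprMn sqr_sqrtr ?(ltW lam0)// !real_normK ?num_real//.
  rewrite (edge_energy p2 (split_ode3 us) ht) a0 g30 expr0n/= potential0//.
  have : 0 <= pabs p (f3 t) / p by rewrite divr_ge0 ?pabs_ge0// (le_trans _ (ltW p2)).
  by rewrite /potential; lra.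
Qed.

Lemma ode_solutionN p lam I f g : ode_solution p lam I f g ->
  ode_solution p lam I (fun x => - f x) (fun x => - g x).
Proof.
move=> [fg cg gF]; split.
- by move=> x; exact: deriv_opp (fg x).
- by move=> x; apply: cvgN; exact: cg.
- by move=> x /gF h; rewrite forceN; exact: deriv_opp h.
Qed.

Lemma split_solutionN p lam ell u f1 g1 f2 g2 f3 g3 : 0 < ell ->
  split_solution p lam ell u f1 g1 f2 g2 f3 g3 ->
  split_solution p lam ell (gscale (- 1) u) (fun x => - f1 x) (fun x => - g1 x)
    (fun x => - f2 x) (fun x => - g2 x) (fun x => - f3 x) (fun x => - g3 x).
Proof.
move=> ell0 us.
have H1N I f : edge_interval I -> H1 I f -> H1 I (fun x => - f x).
  move=> eI [f2' [g fg]]; have E (h : R -> R) : (fun x : R => - h x) = (fun x => - 1 * h x + 0 * h x).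
    by apply/funext => x; ring.
  have mI : measurable I by case: eI.
  split; first by rewrite E; exact: L2_linear.
  by exists (fun x => - g x); rewrite !E; exact: is_weak_derivative_linear.
have eH := edge_interval_half_line (R := R).
have eE := edge_interval_terminal_edge ell0.
case: us => q1 q2 q3 h1 h2 h3 eq1 eq2 eq3 v12 v23 kir neu.
split; try exact: ode_solutionN; try exact: H1N.
- by move=> x /eq1 ->; rewrite /= mulN1r.
- by move=> x /eq2 ->; rewrite /= mulN1r.
- by move=> x /eq3 ->; rewrite /= mulN1r.
- by rewrite v12.
- by rewrite v23.
- by move: kir; lra.
- by rewrite neu oppr0.
Qed.

Lemma solution_classification p lam ell u Phi : 2 < p -> 0 < lam -> 0 < ell ->
  (forall y : R, is_derive y 1 Phi (speed p lam y)) -> Phi 0 = 0 ->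
  solution ell p lam u -> ~ eq_on_graph ell u (gzero R) ->
  2 * Phi (peak p lam) <= action ell p lam u \/
  exists (s : R) f1 g1 f2 g2 f3 g3, [/\ s = 1 \/ s = - 1,
    action ell p lam (gscale s u) = action ell p lam u
    & branch_A p lam ell (gscale s u) f1 g1 f2 g2 f3 g3].
Proof.
move=> p2 lam0 ell0 dPhi Phi0 usol un0.
have [f1 [g1 [f2 [g2 [f3 [g3 us]]]]]] := solution_split p2 ell0 usol.
have [a0|a0|a0] := ltgtP (f3 0) 0.
- have vs := split_solutionN ell0 us.
  have aE : action ell p lam (gscale (- 1) u) = action ell p lam u.
    rewrite (split_action_edges p2 ell0 us) (split_action_edges p2 ell0 vs).
    have E f : (fun x => pabs p (- f x)) = (fun x => pabs p (f x)).
      by apply/funext => x; rewrite pabsN.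
    by rewrite (E f1) (E f2) (E f3).
  have := split_classification p2 lam0 ell0 vs dPhi Phi0; rewrite oppr_gt0 => /(_ a0)[].
    by rewrite aE; left.
  by right; exists (- 1); do 6 eexists; split; [right|exact: aE|eassumption].
- have [|A] := split_classification p2 lam0 ell0 us dPhi Phi0 a0; first by left.
  by right; exists 1, f1, g1, f2, g2, f3, g3; split; rewrite ?gscale1//; left.
- by exfalso; apply: un0; exact: solution_zero us a0.
Qed.

End Classification.

(** * Action of the type A solutions *)

Section Inverse.
Context {R : realType}.
Implicit Types (f df : R -> R) (a b : R).

Lemma deriv_gt0_incr f df a b :
  (forall x, a <= x <= b -> {for x, continuous f}) ->
  (forall x, a < x < b -> is_derive x 1 f (df x)) ->
  (forall x, a < x < b -> 0 < df x) ->
  forall x y, a <= x -> x < y -> y <= b -> f x < f y.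
Proof.
move=> cf fdf df0 x y ax xy yb.
have sub t : x < t < y -> a < t < b.
  by move=> /andP[h1 h2]; rewrite (le_lt_trans ax) ?(lt_le_trans h2).
apply: (deriv_gt0_lt xy _ (fun t h => fdf t (sub t h)) (fun t h => df0 t (sub t h))).
by move=> t /andP[h1 h2]; apply: cf; rewrite (le_trans ax) ?(le_trans h2).
Qed.

(** Composing the inverse with the clamp [cl] to [f a, f b] makes it continuous on the whole line.
    The derivative of [f] is positive in the open interval only: it vanishes at an end in the
    applications to the potential and to the cosine. *)
Lemma inverse_exists f df a b : a < b ->
  (forall x, a <= x <= b -> {for x, continuous f}) ->
  (forall x, a < x < b -> is_derive x 1 f (df x)) ->
  (forall x, a < x < b -> 0 < df x) ->
  exists g : R -> R, [/\ continuous g,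
    forall y, a <= g y <= b,
    forall x, a <= x <= b -> g (f x) = x,
    forall y, f a <= y <= f b -> f (g y) = y
    & forall y : R, f a < y < f b -> is_derive y 1 g (df (g y))^-1].
Proof.
move=> ab cf fdf df0; have incr := deriv_gt0_incr cf fdf df0.
have fab : f a < f b by exact: incr.
pose cl y := Num.min (f b) (Num.max (f a) y).
have clE y : f a <= y <= f b -> cl y = y.
  by move=> /andP[h1 h2]; rewrite /cl (max_idPr h1) (min_idPr h2).
have cl_itv y : f a <= cl y <= f b.
  by rewrite /cl le_min (ltW fab) le_max lexx/= ge_min lexx.
have ccl : continuous cl.
  move=> y; rewrite /cl; apply: continuous_min; first exact: cvg_cst.
  by apply: continuous_max; [exact: cvg_cst|exact: cvg_id].
have ex y : exists x, a <= x <= b /\ f x = cl y.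
  have [|x hx fx] := intermediate_value (ltW ab) cf (v := cl y).
    by rewrite min_l ?max_r ?(ltW fab)// cl_itv.
  by exists x.
pose g y := sval (cid (ex y)).
have g_itv y : a <= g y <= b by rewrite /g; case: cid => x [].
have fg y : f (g y) = cl y by rewrite /g; case: cid => x [].
have gf x : a <= x <= b -> g (f x) = x.
  move=> /andP[ax xb]; have := fg (f x); rewrite clE; last first.
    apply/andP; split.
    - by move: ax; rewrite le_eqVlt => /predU1P[->//|ax]; rewrite ltW// incr.
    - by move: xb; rewrite le_eqVlt => /predU1P[->//|xb]; rewrite ltW// incr.
  have /andP[ag gb] := g_itv (f x).
  by have [h|h|//] := ltgtP (g (f x)) x => e;
    [have := incr _ _ ag h xb|have := incr _ _ ax h gb]; rewrite e ltxx.
have cg : continuous g.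
  move=> y; apply/cvgrPdist_lt => e e0.
  have /andP[ag gb] := g_itv y.
  have up : \forall z \near y, g z < g y + e.
    have [h|h] := ltP b (g y + e).
      by near=> z; apply: le_lt_trans h; have /andP[] := g_itv z.
    have lt : cl y < f (g y + e) by rewrite -fg incr// ltrDl.
    near=> z; rewrite ltNge; apply/negP => h2.
    have : cl z < f (g y + e) by near: z; exact: (cvgr_lt _ (ccl y)).
    have /andP[_ gzb] := g_itv z.
    rewrite -fg ltNge; apply/negP; rewrite negbK.
    by move: h2; rewrite le_eqVlt => /predU1P[->//|h2]; rewrite ltW// incr// (le_trans ag)// lerDl ltW.
  have dn : \forall z \near y, g y - e < g z.
    have [h|h] := ltP (g y - e) a.
      by near=> z; apply: lt_le_trans h _; have /andP[] := g_itv z.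
    have lt : f (g y - e) < cl y by rewrite -fg incr// ltrBlDr ltrDl.
    near=> z; rewrite ltNge; apply/negP => h2.
    have : f (g y - e) < cl z by near: z; exact: (cvgr_gt _ (ccl y)).
    have /andP[agz _] := g_itv z.
    rewrite -fg ltNge; apply/negP; rewrite negbK.
    by move: h2; rewrite le_eqVlt => /predU1P[->//|h2]; rewrite ltW// incr// lerBlDr (le_trans gb)// lerDl ltW.
  near=> z; rewrite ltr_norml.
  have h1 : g z < g y + e by near: z.
  have h2 : g y - e < g z by near: z.
  by move: h1 h2; clear; move: (g z) (g y) => u v; lra.
exists g; split => // [y hy|y /andP[fy yf]]; first by rewrite fg clE.
have /andP[ag gb] := g_itv y.
have fgy : f (g y) = y by rewrite fg clE// !ltW.
have hg : a < g y < b.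
  move: ag gb; rewrite !le_eqVlt => /predU1P[e|->] /predU1P[e'|->]//.
  - by move: ab; rewrite e e' ltxx.
  - by move: fy; rewrite -fgy -e ltxx.
  - by move: yf; rewrite -fgy e' ltxx.
rewrite -[X in is_derive X]fgy; apply: is_derive_inverse.
- near=> x; apply: gf.
  have /andP[/ltW-> /ltW->//] : a < x < b by near: x; exact: near_in_itvoo.
- near=> x; apply: cf.
  have /andP[/ltW-> /ltW->//] : a < x < b by near: x; exact: near_in_itvoo.
- exact: fdf.
- by rewrite gt_eqF// df0.
Unshelve. all: by end_near. Qed.

End Inverse.

(** * Elementary inequalities for the logarithm *)

Section Logarithm_bounds.
Context {R : realType}.
Implicit Types (x n t s B : R).

Lemma ln_le_geometric s : 1 <= s -> 2 * ln s <= s - s^-1.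
Proof.
move=> s1; pose F t : R := t - t^-1 - 2 * ln t.
suff : F 1 <= F s by rewrite /F ln1 invr1; lra.
have pos x : 1 <= x -> 0 < x by move=> h; exact: lt_le_trans ltr01 h.
have dd x : 1 <= x -> is_derive (x : R) 1 F (1 - - 1 / x ^+ 2 - 2 * x^-1).
  move=> /pos x0; apply: deriv_sub; last exact: deriv_scale (is_derive1_ln x0).
  exact: deriv_sub (deriv_id x) (deriv_inv (lt0r_neq0 x0) (deriv_id x)).
apply: (@deriv_ge0_le _ F (fun x => 1 - - 1 / x ^+ 2 - 2 * x^-1) _ _ s1) => [x /andP[x1 _]|x /andP[/ltW x1 _]|x /andP[/ltW x1 _]].
- exact: deriv_continuous (dd x x1).
- exact: dd.
- have x0 := pos x x1.
  rewrite (_ : _ - _ = ((x - 1) / x) ^+ 2) ?sqr_ge0//; field.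
  exact: lt0r_neq0.
Qed.

Lemma ln_le_mean x : 0 <= x -> 2 * (1 + x) * ln (1 + x) <= x * (2 + x).
Proof.
move=> x0; pose s := Num.sqrt (1 + x).
have s0 : 0 < s by rewrite sqrtr_gt0; lra.
have sE : 1 + x = s ^+ 2 by rewrite sqr_sqrtr//; lra.
have /ln_le_geometric : 1 <= s ^+ 2 by rewrite -sE; lra.
rewrite sE (_ : x = s ^+ 2 - 1); last by rewrite -sE; ring.
move: (ln _) => L h.
have := ler_wpM2l (sqr_ge0 s) h.
rewrite (_ : s ^+ 2 * (s ^+ 2 - _) = s ^+ 2 * s ^+ 2 - 1); first by lra.
by field; exact: lt0r_neq0.
Qed.

Lemma ln_ge_pade x : 0 <= x -> 2 * x <= (2 + x) * ln (1 + x).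
Proof.
move=> x0; pose F t : R := 0 - 2 + 4 / (2 + t) + ln (1 + t) - ln 1.
suff : F 0 <= F x.
  rewrite /F !addr0 ln1 => h.
  have := ler_wpM2l (addr_ge0 (ler0n _ 2) x0) h.
  rewrite (_ : (2%:R + x) * (0 - 2 + 4 / (2 + x) + ln (1 + x) - 0) =
    (2 + x) * ln (1 + x) - 2 * x); last by field; apply: lt0r_neq0; lra.
  by rewrite (_ : 0 - 2 + 4 / 2 + 0 - 0 = 0 :> R) ?mulr0; [lra|field].
have dd (y : R) : 0 <= y -> is_derive y 1 F
    (- (2 + y) ^- 2 * 4 + (1 + y)^-1).
  move=> y0; have n2 : 2 + y != 0 by apply: lt0r_neq0; lra.
  have p1 : 0 < 1 + y by lra.
  have d1 := deriv_scale 4 (deriv_inv n2 (deriv_add (deriv_const 2 y) (deriv_id y))).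
  have d2 := @deriv_comp _ (@ln R) (fun t => 1 + t) _ _ _ (is_derive1_ln p1)
    (deriv_add (deriv_const 1 y) (deriv_id y)).
  have := deriv_sub (deriv_add (deriv_add (deriv_const (0 - 2) y) d1) d2)
    (deriv_const (ln 1) y).
  move/is_derive_eq; apply; field.
  by rewrite n2 lt0r_neq0.
apply: (@deriv_ge0_le _ F (fun y => - (2 + y) ^- 2 * 4 + (1 + y)^-1) _ _ x0) => [y /andP[y0 _]|y /andP[/ltW y0 _]|y /andP[/ltW y0 _]].
- exact: deriv_continuous (dd y y0).
- exact: dd.
- rewrite (_ : _ * 4 + _ = (y / (2 + y)) ^+ 2 / (1 + y)).
    by rewrite divr_ge0 ?sqr_ge0//; lra.
  by field; apply/andP; split; apply: lt0r_neq0; lra.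
Qed.

(** For n = p - 2 the power is (peak / well)^2, see [peak_well_ratio]. The bound [ln_ge_pade] puts
    its logarithm above 4 / (n + 4), so it remains to bound ln (1 + 1/n), respectively ln 2, from
    above. *)
Lemma power_lower_bound n : 0 < n ->
  (1 <= n -> 1 + n^-1 <= (1 + n / 2) `^ (2 / n)) /\
  (n <= 1 -> 2 <= (1 + n / 2) `^ (2 / n)).
Proof.
move=> n0; have b0 : 0 < 1 + n / 2 by lra.
have key y : 0 < y -> (n + 4) * ln y <= 4 -> y <= (1 + n / 2) `^ (2 / n).
  move=> y0 h; rewrite -ler_ln ?posrE ?powR_gt0// ln_powR.
  have n2 : 0 <= n / 2 by lra.
  have := ln_ge_pade n2; move: (ln y) (ln (1 + n / 2)) h => u v h h2.
  rewrite -(@ler_pM2l _ ((n + 4) / 2)); last by lra.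
  rewrite mulrCA (_ : 2 / n * ((n + 4) / 2 * v) = 2 / n * ((2 + n / 2) * v)); last by field; exact: lt0r_neq0.
  have h3 : 2 / n * (2 * (n / 2)) <= 2 / n * ((2 + n / 2) * v).
    by apply: ler_wpM2l h2; rewrite divr_ge0 ?ltW.
  apply: le_trans h3; rewrite (_ : 2 / n * (2 * (n / 2)) = 2); first by lra.
  by field; exact: lt0r_neq0.
split=> n1; apply: key => //.
- by rewrite addr_gt0// invr_gt0.
- have i0 : 0 <= n^-1 by rewrite invr_ge0 ltW.
  have := ln_le_mean i0; move: (ln _) => L h.
  have := ler_wpM2l (sqr_ge0 n) h.
  rewrite (_ : n ^+ 2 * (n^-1 * _) = 2 * n + 1); last by field; exact: lt0r_neq0.
  rewrite (_ : n ^+ 2 * (2 * _ * L) = 2 * n * (n + 1) * L); last by field; exact: lt0r_neq0.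
  move=> h2; have : 2 * n * (n + 1) * ((n + 4) * L) <= 2 * n * (n + 1) * 4 by nra.
  by rewrite ler_pM2l// mulr_gt0//; lra.
- have := ln_le_mean (@ler01 R); rewrite (_ : 1 + 1 = 2 :> R); last by ring.
  by move: (ln _) => L h; nra.
Qed.

(** The logarithmic form of [concentration_top], with n = p - 2 and 1 + t = (y / peak)^n. The left
    side is at most t / sqrt(1 + t) by [ln_le_geometric], the right side at least 2 n t / (n + (n +
    1) t) by [ln_ge_pade]. *)
Lemma soliton_top_bound n t : 0 < n -> 0 <= t ->
  (n + 2) * (1 + n / 2) `^ (2 / n) * t <= 3 * n ->
  ln (1 + t) <= n * ln (1 + 2 * t / (n * (1 + t))).
Proof.
move=> n0 t0; have [b1 b2] := power_lower_bound n0.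
move: b1 b2; move: (_ `^ _) => B b1 b2 hB.
(* Comparing the two logarithm bounds amounts to this quadratic inequality, true for [t] up to a
   threshold. The two lower bounds on the power [B] place [t] below it, for large and for small
   [n]. *)
have quad : (n + (n + 1) * t) ^+ 2 <= 4 * n ^+ 2 * (1 + t).
  have [n1|n1] := leP 1 n.
  - have h : (n + 1) * (n + 2) * t <= 3 * n ^+ 2.
      have h1 : (n + 2) * (1 + n^-1) * t <= 3 * n.
        by apply: le_trans hB; rewrite ler_wpM2r// ler_wpM2l ?b1//; lra.
      have := ler_wpM2l (ltW n0) h1.
      by rewrite (_ : n * _ = (n + 1) * (n + 2) * t); [lra|field; exact: lt0r_neq0].
    have n2 : 0 < (n + 2) ^+ 2 by rewrite exprn_gt0//; lra.
    have n1' : 0 < n + 1 by lra.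
    rewrite -(ler_pM2r n2) -(ler_pM2r n1').
    have h1 : (n + 1) * (n + 2) * t * ((n + 1) ^+ 2 * t * (n + 2))
        <= 3 * n ^+ 2 * ((n + 1) ^+ 2 * t * (n + 2)).
      by apply: ler_wpM2r h; rewrite !mulr_ge0 ?sqr_ge0//; lra.
    have h2 : (n + 1) * (n + 2) * t * (n * (n ^+ 2 + n + 4))
        <= 3 * n ^+ 2 * (n * (n ^+ 2 + n + 4)).
      by apply: ler_wpM2r h; rewrite mulr_ge0 ?(ltW n0)//; have := sqr_ge0 n; lra.
    have h3 : 0 <= n ^+ 2 * (n ^+ 2 + n + 1).
      by rewrite mulr_ge0 ?sqr_ge0//; have := sqr_ge0 n; lra.
    lra.
  - have n1' := ltW n1.
    have h : 2 * (n + 2) * t <= 3 * n.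
      apply: le_trans hB; rewrite ler_wpM2r// [2 * _]mulrC ler_wpM2l//; [lra|exact: b2].
    have n2 : 0 < 4 * (n + 2) ^+ 2 by rewrite mulr_gt0// exprn_gt0//; lra.
    have h1 : (2 * (n + 2) * t) ^+ 2 * (n + 1) ^+ 2 <= (3 * n) ^+ 2 * (n + 1) ^+ 2.
      by rewrite ler_wpM2r ?sqr_ge0// lerXn2r ?nnegrE ?mulr_ge0//; lra.
    have h2 : 2 * (n + 2) * t * (4 * n * (1 - n) * (n + 2))
        <= 3 * n * (4 * n * (1 - n) * (n + 2)).
      by apply: ler_wpM2r h; rewrite !mulr_ge0//; lra.
    have h3 : 0 <= n ^+ 2 * (15 * n ^+ 2 + 42 * n + 15).
      by rewrite mulr_ge0 ?sqr_ge0//; have := sqr_ge0 n; lra.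
    by rewrite -(ler_pM2r n2); lra.
pose s := Num.sqrt (1 + t).
have s0 : 0 < s by rewrite sqrtr_gt0; lra.
have sE : s ^+ 2 = 1 + t by rewrite sqr_sqrtr//; lra.
have D0 : 0 < n + (n + 1) * t by nra.
have Ds : n + (n + 1) * t <= 2 * n * s.
  rewrite -(@ler_pXn2r _ 2)// ?nnegrE ?(ltW D0)// ?mulr_ge0 ?(ltW s0) ?(ltW n0)//.
  by rewrite [leRHS]exprMn sE; move: quad; lra.
have h1 : s * ln (1 + t) <= t.
  have : 1 <= s by rewrite -(@ler_pXn2r _ 2)// ?nnegrE ?(ltW s0)// sE expr1n; lra.
  move=> /ln_le_geometric/(ler_wpM2l (ltW s0)).
  rewrite -sE lnXn// mulrBr mulfV ?lt0r_neq0// -expr2 sE mulr2n mulrDl mul1r; lra.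
set x := 2 * t / (n * (1 + t)).
have p0 : 0 < n * (1 + t) by rewrite mulr_gt0//; lra.
have x0 : 0 <= x by rewrite divr_ge0 ?(ltW p0)// mulr_ge0.
have := ler_wpM2l (ltW p0) (ln_ge_pade x0).
rewrite [in X in _ <= X]mulrA (_ : n * (1 + t) * (2 * x) = 4 * t); last first.
  by rewrite /x; field; rewrite !lt0r_neq0//; lra.
rewrite (_ : n * (1 + t) * (2 + x) = 2 * (n + (n + 1) * t)); last first.
  by rewrite /x; field; rewrite !lt0r_neq0//; lra.
move: (ln (1 + x)) (ln (1 + t)) h1 => L l h1 h2.
rewrite -(ler_pM2l (mulr_gt0 s0 D0)).
have h3 := ler_wpM2l (ltW D0) h1.
have h4 := ler_wpM2r t0 Ds.
have h5 : n * s * (4 * t) <= n * s * (2 * (n + (n + 1) * t) * L).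
  by apply: ler_wpM2l h2; rewrite mulr_ge0 ?ltW.
by lra.
Qed.

End Logarithm_bounds.

(** * Comparison of concentrations at two heights *)

Section Concentration.
Context {R : realType}.
Implicit Types (p lam m y z : R).

(* [- force y / |y|^p] for [y > 0]. *)
Definition concentration p lam y : R := (1 - lam / y `^ (p - 2)) / y.

Lemma concentrationE p lam y : 0 < y ->
  concentration p lam y = y^-1 - lam * y `^ (1 - p).
Proof.
move=> y0; rewrite /concentration mulrBl mul1r.
have -> : y `^ (1 - p) = (y `^ (p - 2))^-1 / y.
  rewrite -[y^-1]powR_inv1 ?(ltW y0)// -powRN -powRD; first by congr (_ `^ _); ring.
  by rewrite lt0r_neq0 ?implybT.
by rewrite mulrA.
Qed.

Lemma force_concentration p lam y : 2 < p -> 0 < y ->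
  - force p lam y = pabs p y * concentration p lam y.
Proof.
move=> p2 y0; rewrite force_ge0E ?ltW// pabs_sqr// gtr0_norm// /concentration.
have q : y `^ (p - 2) != 0 by rewrite gt_eqF// powR_gt0.
move: (y `^ (p - 2)) q => a a0; field; rewrite a0 andbT; exact: lt0r_neq0.
Qed.

Lemma concentration_incr p lam y z : 2 < p -> 0 < lam -> 0 < y -> y < z ->
  z `^ (p - 2) <= (p - 1) * lam -> concentration p lam y < concentration p lam z.
Proof.
move=> p2 l0 y0 yz hz; have z0 := lt_trans y0 yz.
rewrite !concentrationE//.
pose F t := t^-1 - lam * t `^ (1 - p).
pose dF t := - 1 / t ^+ 2 - lam * ((1 - p) * t `^ (1 - p - 1)).
have dd (t : R) : 0 < t -> is_derive t 1 F (dF t).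
  move=> t0; apply: deriv_sub; last exact: deriv_scale (is_derive1_powR (1 - p) t0).
  exact: deriv_inv (lt0r_neq0 t0) (deriv_id t).
have tp t : y <= t -> 0 < t by exact: lt_le_trans.
apply: (@deriv_gt0_lt _ F dF _ _ yz) => [t /andP[h _]|t /andP[/ltW h _]|t /andP[/ltW h tz]].
- exact: deriv_continuous (dd t (tp t h)).
- exact: dd (tp t h).
- have t0 := tp t h; rewrite /dF.
  have -> : t `^ (1 - p - 1) = (t `^ (p - 2))^-1 / t ^+ 2.
    rewrite -powR_mulrn ?(ltW t0)// -!powRN -powRD; first by congr (_ `^ _); ring.
    by rewrite lt0r_neq0 ?implybT.
  have q0 : 0 < t `^ (p - 2) by rewrite powR_gt0.
  have : t `^ (p - 2) < (p - 1) * lam.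
    apply: lt_le_trans hz; rewrite ltr_powR2// ltW//.
  move: (t `^ (p - 2)) q0 => a a0 h2.
  rewrite (_ : _ - _ = ((p - 1) * lam - a) / (a * t ^+ 2)).
    by rewrite divr_gt0 ?subr_gt0// mulr_gt0// exprn_gt0.
  by field; rewrite !lt0r_neq0.
Qed.

Lemma peak_well_ratio p lam : 2 < p -> 0 < lam ->
  peak p lam ^+ 2 = (1 + (p - 2) / 2) `^ (2 / (p - 2)) * well p lam ^+ 2.
Proof.
move=> p2 l0; rewrite -!powR_mulrn ?powR_ge0// /peak /well -!powRrM.
rewrite (_ : p * lam / 2 = (1 + (p - 2) / 2) * lam); last by field.
rewrite powRM ?(ltW l0)//; last by lra.
by congr (_ `^ _ * _ `^ _); ring.
Qed.

(** The concentration eventually decreases, so a bound on [y] is indispensable. A profile meets the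
    one assumed here: its potential is at least -3 times that of the vertex, which is at most the
    value at the well. In terms of the relative excess [t] of y^(p-2) over peak^(p-2) it becomes the
    hypothesis of [soliton_top_bound]. *)
Lemma concentration_top p lam y : 2 < p -> 0 < lam -> peak p lam <= y ->
  - 3 * potential p lam (well p lam) <= potential p lam y ->
  concentration p lam (peak p lam) <= concentration p lam y.
Proof.
move=> p2 l0 My; have M0 := peak_gt0 p2 l0; have y0 := lt_le_trans M0 My.
have n0 : 0 < p - 2 by lra. have p0 : 0 < p by lra.
have w0 := well_gt0 p l0.
pose t := y `^ (p - 2) / (p * lam / 2) - 1.
have q0 : 0 < p * lam / 2 by rewrite divr_gt0// mulr_gt0.
have yE : y `^ (p - 2) = p * lam / 2 * (1 + t).
  by rewrite /t [1 + _]addrC subrK mulrC divfK// gt_eqF.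
have t0 : 0 <= t.
  rewrite subr_ge0 ler_pdivlMr// mul1r -(peak_pow p2 l0).
  by apply: ge0_ler_powR; rewrite ?nnegrE ?(ltW n0) ?(ltW M0) ?(ltW y0).
have t1 : 0 < 1 + t by lra.
rewrite !potential_ge0E ?(ltW y0) ?(ltW w0)// well_pow// yE => hH.
have h1 : y ^+ 2 * t * p <= 3 * (p - 2) * well p lam ^+ 2.
  have c0 : 0 < 2 * p / lam by rewrite divr_gt0// mulr_gt0.
  move: hH; rewrite -(ler_pM2l c0).
  rewrite (_ : 2 * p / lam * (y ^+ 2 * _) = - (y ^+ 2 * t * p)); last first.
    by field; rewrite !lt0r_neq0.
  rewrite (_ : 2 * p / lam * _ = - (3 * (p - 2) * well p lam ^+ 2)); last first.
    by field; rewrite !lt0r_neq0.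
  by rewrite lerN2.
have hb : (p - 2 + 2) * (1 + (p - 2) / 2) `^ (2 / (p - 2)) * t <= 3 * (p - 2).
  rewrite subrK; have w2 : 0 < well p lam ^+ 2 by rewrite exprn_gt0.
  rewrite -(ler_pM2r w2); apply: le_trans h1.
  rewrite (_ : p * _ * t * _ = (1 + (p - 2) / 2) `^ (2 / (p - 2)) * well p lam ^+ 2 * (t * p)); last by ring.
  rewrite -(peak_well_ratio p2 l0) -[leRHS]mulrA ler_wpM2r ?mulr_ge0 ?(ltW p0)//.
  by rewrite lerXn2r ?nnegrE ?(ltW M0) ?(ltW y0).
have := soliton_top_bound n0 t0 hb; set x := 2 * t / _ => hln.
have x0 : 0 <= x by rewrite divr_ge0 ?mulr_ge0 ?(ltW n0) ?(ltW t1).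
have yx : y <= peak p lam * (1 + x).
  rewrite -ler_ln ?posrE ?mulr_gt0//; last by lra.
  rewrite lnM ?posrE//; last by lra.
  rewrite -(ler_pM2l n0) mulrDr -!ln_powR yE (peak_pow p2 l0).
  by rewrite lnM ?posrE// lerD2l ln_powR.
rewrite /concentration peak_pow// yE ler_pdivrMr// [leRHS]mulrAC ler_pdivlMr//.
have E : lam / (p * lam / 2 * (1 + t)) = 2 / (p * (1 + t)).
  by field; rewrite !lt0r_neq0.
have E' : lam / (p * lam / 2) = 2 / p by field; rewrite !lt0r_neq0.
rewrite E E'; have c0 : 0 <= 1 - 2 / p by rewrite subr_ge0 ler_pdivrMr//; lra.
apply: le_trans (ler_wpM2l c0 yx) _; rewrite mulrCA [leRHS]mulrC ler_pM2l//.
rewrite le_eqVlt; apply/orP; left; apply/eqP; rewrite /x; field.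
by rewrite !lt0r_neq0.
Qed.

(** The concentration increases up to the turning point y^(p-2) = (p - 1) lam, which lies above the
    peak. If [y] is past it, the comparison goes from [m] up to the peak by monotonicity and from
    the peak to [y] by [concentration_top]. *)
Lemma concentration_lt p lam m y : 2 < p -> 0 < lam ->
  0 < m -> m < peak p lam -> m < y ->
  - 3 * potential p lam (well p lam) <= potential p lam y ->
  concentration p lam m < concentration p lam y.
Proof.
move=> p2 l0 m0 mM my hy; have M0 := peak_gt0 p2 l0; have y0 := lt_trans m0 my.
have [h|h] := leP (y `^ (p - 2)) ((p - 1) * lam).
  exact: concentration_incr.
have Mp : peak p lam `^ (p - 2) <= (p - 1) * lam by rewrite peak_pow//; nra.
apply: lt_le_trans (concentration_incr p2 l0 m0 mM Mp) _.
apply: concentration_top => //; apply: ltW.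
by rewrite -(ltr_powR2 p2) ?(ltW M0) ?(ltW y0)//; exact: le_lt_trans h.
Qed.

End Concentration.

(** * Upper bound for the action of a profile *)

Section Profile.
Context {R : realType}.
Local Notation mu := (@lebesgue_measure R).
Context (p lam ell : R) (f g : R -> R) (p2 : 2 < p) (lam0 : 0 < lam) (ell0 : 0 < ell)
  (prof : edge_profile p lam ell f g).
Implicit Types x y : R.

Local Notation H := (potential p lam).
Local Notation h := (potential p lam (f 0)).
Local Notation W := (well p lam).
Local Notation M := (peak p lam).

Let fdf : forall x : R, is_derive x 1 f (g x). Proof. by have [] := profile_ode prof. Qed.
Let cg : continuous g. Proof. by have [] := profile_ode prof. Qed.
Let gF x : 0 <= x <= ell -> is_derive x 1 g (force p lam (f x)).
Proof. by have [_ _ gF] := profile_ode prof => hx; apply: gF; rewrite terminal_edgeE. Qed.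
Let cf : continuous f := ode_continuous (profile_ode prof).

Lemma potential_mono_le y z : 0 <= y -> y <= z -> z <= W -> H y <= H z.
Proof.
move=> y0; rewrite le_eqVlt => /predU1P[->//|yz] zw.
by rewrite ltW// potential_incr.
Qed.

Lemma potential_anti_le y z : W <= y -> y <= z -> H z <= H y.
Proof.
move=> wy; rewrite le_eqVlt => /predU1P[->//|yz].
by rewrite ltW// potential_decr.
Qed.

Lemma profile_h_gt0 : 0 < h.
Proof. by have /andP[a0 aM] := profile_start prof; exact: potential_gt0. Qed.

Lemma profile_energy x : 0 <= x <= ell -> g x ^+ 2 = 2 * H (f x) + 6 * h.
Proof.
move=> hx; rewrite (edge_energy p2 (profile_ode prof) hx) (profile_slope prof).
by rewrite exprMn speed_sqr ?(ltW profile_h_gt0)//; ring.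
Qed.

Lemma profile_mono x y : 0 <= x -> x < y -> y <= ell -> f x < f y.
Proof.
apply: (deriv_gt0_incr (fun t _ => cf (x := t)) (fun t _ => fdf t)).
by move=> t /andP[t0 tl]; apply: (profile_incr prof); rewrite ltW.
Qed.

Lemma profile_mono_le x y : 0 <= x -> x <= y -> y <= ell -> f x <= f y.
Proof.
move=> x0; rewrite le_eqVlt => /predU1P[->//|xy] yl.
by rewrite ltW// profile_mono.
Qed.

Lemma profile_gt0 x : 0 <= x <= ell -> 0 < f x.
Proof.
move=> /andP[x0 xl]; have /andP[a0 _] := profile_start prof.
exact: lt_le_trans a0 (profile_mono_le (lexx 0) x0 xl).
Qed.

Lemma profile_top : H (f ell) = - 3 * h.
Proof.
have := @profile_energy ell; rewrite lexx ltW// => /(_ isT).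
by rewrite (profile_end prof) expr0n/=; lra.
Qed.

Lemma profile_top_peak : M < f ell.
Proof.
rewrite ltNge; apply/negP => hle; have := @potential_ge0_of_le _ p lam (f ell) p2 lam0.
have fl : 0 < f ell by apply: profile_gt0; rewrite lexx ltW.
rewrite gtr0_norm// => /(_ hle).
by rewrite profile_top; have := profile_h_gt0; lra.
Qed.

(** A profile that starts at or above the well is already on the descending side of the potential.
    Otherwise it climbs to the well, then comes down to a negative potential at the Neumann end,
    passing the vertex value on the way. *)
Lemma profile_crossing : exists2 x, 0 <= x < ell &
  [/\ W <= f x, H (f x) = h & forall t, 0 <= t <= x -> h <= H (f t)].
Proof.
have [aw|wa] := ltP (f 0) W; last first.
  exists 0; first by rewrite lexx.
  by split=> // t; rewrite andbC => /le_anti ->.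
have wl : W < f ell := lt_trans (well_lt_peak p2 lam0) profile_top_peak.
have [|xw /andP[xw0 xwl] fxw] := intermediate_value (v := W) (ltW ell0) (fun t _ => cf (x := t)).
  by rewrite ge_min le_max (ltW aw) (ltW wl) orbT.
have /andP[a0 _] := profile_start prof.
have [||x /andP[x1 x2] fx] := @intermediate_value _ (fun t => H (f t)) _ _ h xwl.
- by move=> t _; apply: (@continuous_comp _ _ _ f H); [exact: cf|exact: continuous_potential].
- rewrite ge_min le_max fxw (potential_le_well p2 lam0 (ltW a0)) profile_top andbT.
  by apply/orP; right; have := profile_h_gt0; lra.
have x0 := le_trans xw0 x1.
have xl : x < ell.
  rewrite lt_neqAle x2 andbT; apply/eqP => e.
  by move: fx; rewrite e profile_top; have := profile_h_gt0; lra.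
have Wx : W <= f x by rewrite -fxw profile_mono_le.
exists x; first by rewrite x0.
split => // t /andP[t0 tx].
have [tw|wt] := leP (f t) W.
  apply: potential_mono_le => //; first exact: ltW.
  by apply: profile_mono_le => //; exact: le_trans x2.
by rewrite -fx; apply: potential_anti_le; [exact: ltW|exact: profile_mono_le].
Qed.

Context (Phi : R -> R) (dPhi : forall y : R, is_derive y 1 Phi (speed p lam y)).

Let density x := (2^-1 - p^-1) * pabs p (f x).

Let virial_density x y : 2^-1 * (y + f x * force p lam (f x)) + density x
  = 2^-1 * y + H (f x).
Proof.
rewrite /density force_mul// /potential; move: (pabs _ _) (f x ^+ 2) => P F.
by field; apply: lt0r_neq0; exact: lt_trans p2.
Qed.

(** The left-hand side is the action of a type A branch, each decreasing half-line contributing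
    Phi(f 0) - f 0 speed(f 0) / 2. *)
Lemma profile_action_lt :
  2 * Phi (f 0) - f 0 * speed p lam (f 0)
  + (2^-1 - p^-1) * \int[mu]_(x in `[0, ell]) pabs p (f x) < 2 * Phi M.
Proof.
have [x2 /andP[x20 x2l] [Wx2 Hx2 Hge]] := profile_crossing.
have hp := profile_h_gt0.
have cden : continuous density.
  by move=> x; apply: cvgMr; exact: continuous_pabs_comp.
have [N dN] := antiderivative_exists cden.
rewrite -RintegralZl; [|exact: measurable_itv|
  exact: continuous_integrable 0 ell (continuous_pabs_comp p2 cf)].
rewrite (Rintegral_FTC (ltW ell0) dN cden).
have M0 := peak_gt0 p2 lam0. have w0 := well_gt0 p lam0.
(* [L] increases up to the point [x2] of the well with the potential of the vertex.
   Beyond it [f] is replaced by [m], where the potential is [g^2 / 8]. *)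
pose L x := 2 * Phi (f x) - 2^-1 * (f x * g x) - N x.
have L_le : L 0 <= L x2.
  pose dL x := 2 * (speed p lam (f x) * g x)
    - 2^-1 * (g x * g x + f x * force p lam (f x)) - density x.
  have dd x : 0 <= x <= ell -> is_derive x 1 L (dL x).
    move=> hx; have d1 := @deriv_comp _ Phi f _ _ _ (dPhi (f x)) (fdf x).
    exact: deriv_sub (deriv_sub (deriv_scale 2 d1)
      (deriv_scale 2^-1 (deriv_mul (fdf x) (gF hx)))) (dN x).
  have sub x : 0 <= x <= x2 -> 0 <= x <= ell.
    by move=> /andP[-> h1]; rewrite (le_trans h1) ?ltW.
  have sub' x : 0 < x < x2 -> 0 <= x <= x2 by move=> /andP[/ltW-> /ltW->].
  apply: (@deriv_ge0_le _ L dL _ _ x20).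
  - by move=> x /sub hx; exact: deriv_continuous (dd x hx).
  - by move=> x /sub'/sub; exact: dd.
  - move=> x /sub' hx; have hx' := sub x hx; have Hh := Hge x hx.
    have g0 : 0 <= g x.
      by rewrite ltW// (profile_incr prof)//; case/andP: hx => -> h1; rewrite (le_lt_trans h1).
    have := virial_density x (g x * g x); rewrite -expr2 => E.
    rewrite /dL -expr2 -addrA -opprD E.
    have := profile_energy hx'; have := speed_sqr (le_trans (ltW hp) Hh).
    have := speed_ge0 p lam (f x).
    move: (speed _ _ _) (g x) (H (f x)) (h) g0 Hh hp => s G A B g0 AB B0 s0 s2 G2.
    (* From g^2 = 2 H + 6 h and h <= H one gets s <= G <= 2 s. The derivative of [L] is 2 s G - G^2
       / 2 - s^2 / 2, which (G - s) (2 s - G) >= 0 makes nonnegative. *)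
    have sG : s <= G by rewrite -(@ler_pXn2r _ 2)// s2 G2; lra.
    have Gs : G <= 2 * s.
      by rewrite -(@ler_pXn2r _ 2)// ?nnegrE ?mulr_ge0// exprMn s2 G2; lra.
    have e1 : 0 <= (G - s) * (2 * s - G) by rewrite mulr_ge0 ?subr_ge0.
    have e2 : 0 <= s * G by rewrite mulr_ge0.
    have e3 : 0 <= s ^+ 2 := sqr_ge0 s.
    have -> : A = s ^+ 2 / 2 by rewrite s2; field.
    lra.
have WM := well_lt_peak p2 lam0.
have nforce y : W < y < M -> 0 < - force p lam y.
  by move=> /andP[Wy _]; rewrite oppr_gt0 force_lt0.
have [G [cG G_itv GK KG dG]] := @inverse_exists _ (fun y => - H y)
  (fun y => - force p lam y) _ _ WM
  (fun y _ => deriv_continuous (deriv_opp (deriv_potential lam y p2)))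
  (fun y _ => deriv_opp (deriv_potential lam y p2)) nforce.
(* Equivalently [speed p lam (m x) = g x / 2]: [m x] is the vertex value above the well for which
   [g x] would be the Kirchhoff slope. It equals [f] at [x2], where g^2 = 8 h, and the peak at
   [ell], where g = 0. *)
pose m x := G (- (g x ^+ 2 / 8)).
pose K x := 2 * Phi (m x) - 2^-1 * (m x * g x) - N x.
have Kx2 : K x2 = L x2.
  rewrite /K /L; suff -> : m x2 = f x2 by [].
  rewrite /m (@profile_energy x2) ?x20 ?ltW// Hx2.
  rewrite (_ : - _ = - H (f x2)); last by rewrite Hx2; field.
  apply: GK; rewrite Wx2/=; apply: (potential_ge0_le_peak p2 lam0).
  by rewrite Hx2 ltW.
have Kl : K ell = 2 * Phi M - N ell.
  rewrite /K /m (profile_end prof) mulr0 mulr0 subr0 expr0n/= mul0r oppr0.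
  have -> // : G 0 = M.
  by rewrite -[X in G X]oppr0 -(potential_peak p2 lam0) GK// lexx andbT; exact: ltW.
have K_lt : K x2 < K ell.
  have cm : continuous m.
    move=> x; apply: (@continuous_comp _ _ _ (fun x => - (g x ^+ 2 / 8)) G); last exact: cG.
    by apply: cvgN; apply: cvgMl; exact: continuous_sqr.
  have cPhi : continuous Phi by move=> y; exact: deriv_continuous (dPhi y).
  have cN : continuous N by move=> y; exact: deriv_continuous (dN y).
  have cK : continuous K.
    move=> x; apply: cvgB; last exact: cN.
    apply: cvgB; apply: cvgMr; last by apply: cvgM; [exact: cm|exact: cg].
    by apply: (@continuous_comp _ _ _ m Phi); [exact: cm|exact: cPhi].
  pose dm x := (- force p lam (m x))^-1 * - (2 * g x * force p lam (f x) / 8).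
  pose dK x := 2 * (speed p lam (m x) * dm x)
    - 2^-1 * (dm x * g x + m x * force p lam (f x)) - density x.
  have inside x : x2 < x < ell -> [/\ 0 < g x, W < f x,
      H (f x) < h, W < m x < M & H (m x) = g x ^+ 2 / 8].
    move=> /andP[x2x xl]; have x0 := le_lt_trans x20 x2x.
    have hx : 0 <= x <= ell by rewrite !ltW.
    have g0 : 0 < g x by apply: (profile_incr prof); rewrite ltW.
    have Wf : W < f x by apply: le_lt_trans Wx2 _; exact: profile_mono x20 x2x (ltW xl).
    have Hh : H (f x) < h.
      by rewrite -Hx2 potential_decr//; exact: profile_mono x20 x2x (ltW xl).
    have hW : h <= H W by rewrite -Hx2; exact: potential_anti_le.
    have gg : 0 < g x ^+ 2 / 8 by rewrite divr_gt0// exprn_gt0.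
    have gW : g x ^+ 2 / 8 < H W.
      by rewrite (profile_energy hx); move: Hh hW; move: (H (f x)) h (H W) => A B C; lra.
    have mE : H (m x) = g x ^+ 2 / 8.
      apply: oppr_inj; apply: KG; rewrite lerN2 (ltW gW)/= potential_peak// oppr0.
      by rewrite oppr_le0 ltW.
    split=> //; have /andP[h1 h2] := G_itv (- (g x ^+ 2 / 8)).
    rewrite !lt_neqAle h1 h2 !andbT; apply/andP; split; apply/eqP => e.
    - by move: gW; rewrite -mE -e ltxx.
    - by move: gg; rewrite -mE e potential_peak// ltxx.
  have dd x : x2 < x < ell -> is_derive x 1 K (dK x).
    move=> hx; have [g0 Wf Hh Wm mE] := inside x hx.
    have hx' : 0 <= x <= ell.
      by case/andP: hx => /ltW h1 /ltW ->; rewrite andbT (le_trans x20).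
    have hin : - H W < - (g x ^+ 2 / 8) < - H M.
      rewrite !ltrN2 potential_peak// divr_gt0 ?exprn_gt0//= -mE andbT.
      by apply: potential_decr => //; case/andP: Wm.
    have d8 : is_derive x 1 (fun x => - (g x ^+ 2 / 8))
        (- (2 * g x * force p lam (f x) / 8)).
      apply: deriv_opp; have := deriv_scale 8^-1 (deriv_sqr (gF hx')).
      by under eq_fun do rewrite mulrC; move/is_derive_eq; apply; rewrite mulrC.
    have d1 : is_derive x 1 m (dm x).
      exact: (@deriv_comp _ G (fun x => - (g x ^+ 2 / 8)) _ _ _ (dG _ hin) d8).
    have d2 := @deriv_comp _ Phi m _ _ _ (dPhi (m x)) d1.
    exact: deriv_sub (deriv_sub (deriv_scale 2 d2)
      (deriv_scale 2^-1 (deriv_mul d1 (gF hx')))) (dN x).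
  apply: (@deriv_gt0_lt _ K dK _ _ x2l (fun x _ => cK x) dd) => x hx.
  have [g0 Wf Hh /andP[Wm mM] mE] := inside x hx.
  have hx' : 0 <= x <= ell.
    by case/andP: hx => /ltW h1 /ltW ->; rewrite andbT (le_trans x20).
  have m0 : 0 < m x := lt_trans w0 Wm.
  have f0 : 0 < f x := lt_trans w0 Wf.
  have sE : speed p lam (m x) = g x / 2.
    rewrite /speed mE (_ : 2 * _ = (g x / 2) ^+ 2); last by field.
    by rewrite sqrtr_sqr ger0_norm// divr_ge0// ltW.
  have mf : m x < f x.
    rewrite ltNge; apply/negP => fm.
    have := potential_anti_le (ltW Wf) fm; rewrite mE (profile_energy hx').
    by move: Hh; move: (H (f x)) h => A B; lra.
  have Hf3 : - 3 * H W <= H (f x).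
    have := profile_energy hx'; have := sqr_ge0 (g x).
    have : h <= H W by rewrite -Hx2; exact: potential_anti_le.
    by move: (H (f x)) (h) (H W) (g x ^+ 2) => A B C D; lra.
  have conc := concentration_lt p2 lam0 m0 mM mf Hf3.
  have km : 0 < - force p lam (m x) by rewrite oppr_gt0 force_lt0.
  have Em : - force p lam (m x) = pabs p (m x) * concentration p lam (m x).
    exact: force_concentration.
  have Ef : - force p lam (f x) = pabs p (f x) * concentration p lam (f x).
    exact: force_concentration.
  have Vm : 2 * H (m x) - m x * force p lam (m x) = 2 * (2^-1 - p^-1) * pabs p (m x).
    rewrite force_mul// /potential; move: (pabs _ _) (m x ^+ 2) => P F.
    by field; apply: lt0r_neq0; exact: lt_trans p2.
  have Pf := pabs_gt0 p (lt0r_neq0 f0); have Pm := pabs_gt0 p (lt0r_neq0 m0).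
  have c0 : 0 < 2^-1 - p^-1.
    by rewrite subr_gt0 ltf_pV2 ?posrE//; apply: lt_trans p2.
  have cm0 : 0 < concentration p lam (m x) by move: km; rewrite Em pmulr_rgt0.
  (* The derivative of [K] has the sign of the difference of the concentrations at [f] and at [m],
     and [m x < f x]. *)
  suff -> : dK x = (2^-1 - p^-1) * pabs p (f x) *
     ((concentration p lam (f x) - concentration p lam (m x)) / concentration p lam (m x)).
    by apply: mulr_gt0; [exact: mulr_gt0|rewrite divr_gt0// subr_gt0].
  rewrite /dK /density sE /dm Em -[force p lam (f x)]opprK Ef.
  have : g x ^+ 2 = 8 * H (m x) by rewrite mE; field.
  move: Vm; rewrite -[force p lam (m x)]opprK Em.
  move: (concentration p lam (m x)) cm0 (pabs p (m x)) Pm => a a0 P P0.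
  move: (concentration p lam (f x)) (pabs p (f x)) (m x) (H (m x)) => b Q y A.
  move: (g x) (2^-1 - p^-1) => v c Vm v2.
  have {Vm} AE : A = c * P - 2^-1 * (y * P * a).
    by move: Vm; rewrite (_ : y * - (P * a) = - (y * P * a)); [lra|ring].
  rewrite (_ : _ - _ = v ^+ 2 * Q * b / (8 * P * a) + 2^-1 * y * Q * b - c * Q).
    by rewrite v2 AE; field; rewrite !lt0r_neq0.
  by field; rewrite !lt0r_neq0.
have : L 0 < 2 * Phi M - N ell by rewrite -Kl (le_lt_trans L_le)// -Kx2.
rewrite /L (profile_slope prof) [f 0 * (2 * _)]mulrCA.
by move: (f 0 * speed p lam (f 0)) (Phi (f 0)) (Phi M) => *; lra.
Qed.

End Profile.

(** * Action of the type A branch; uniqueness for the Cauchy problem *)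

Section Branch.
Context {R : realType}.
Local Notation mu := (@lebesgue_measure R).
Implicit Types (p lam ell : R) (f g Phi : R -> R) (u : gfun R).

Lemma branch_A_action_lt p lam ell u f1 g1 f2 g2 f3 g3 Phi :
  2 < p -> 0 < lam -> 0 < ell ->
  (forall y : R, is_derive y 1 Phi (speed p lam y)) -> Phi 0 = 0 ->
  branch_A p lam ell u f1 g1 f2 g2 f3 g3 ->
  action ell p lam u < 2 * Phi (peak p lam).
Proof.
move=> p2 lam0 ell0 dPhi Phi0 [us prof s1 s2].
have /andP[a0 aM] := profile_start prof.
have S0 : 0 < speed p lam (f3 0) by rewrite sqrtr_gt0 mulr_gt0// potential_gt0.
have f10 : f1 0 = f3 0 by rewrite (split_vertex12 us) (split_vertex23 us).
have f20 : f2 0 = f3 0 by rewrite (split_vertex23 us).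
have E f g : ode_solution p lam (@half_line R) f g -> H1 (@half_line R) f ->
    f 0 = f3 0 -> g 0 = - speed p lam (f3 0) ->
    (2^-1 - p^-1) * \int[mu]_(x in @half_line R) pabs p (f x)
    = Phi (f3 0) - 2^-1 * (f3 0 * speed p lam (f3 0)).
  move=> ode fH f0 g0; rewrite (half_line_action_eq p2 ode fH dPhi Phi0).
    by rewrite f0 g0 mulrN mulrN.
  move=> x x0; apply/ltW/(half_line_decreasing p2 lam0 ode fH) => //; rewrite ?f0//.
  by rewrite g0 oppr_lt0.
rewrite (split_action_edges p2 ell0 us).
have e1 := E _ _ (split_ode1 us) (split_H1_1 us) f10 s1.
have e2 := E _ _ (split_ode2 us) (split_H1_2 us) f20 s2.
rewrite [X in X + _ + _]e1 [X in _ + X + _]e2.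
apply: le_lt_trans (profile_action_lt p2 lam0 ell0 prof dPhi).
rewrite lerD2r; move: {e1 e2 E} (f3 0 * _) (Phi _) => A B; lra.
Qed.

Lemma force_lipschitz p lam (B y z : R) : 2 < p -> 0 < y -> 0 < z -> y <= B -> z <= B ->
  `|force p lam y - force p lam z| <= (`|lam| + (p - 1) * B `^ (p - 2)) * `|y - z|.
Proof.
move=> p2.
wlog zy : y z / z <= y => [wl|].
  move=> y0 z0 yB zB; have [zy|/ltW yz] := leP z y; first exact: wl.
  by rewrite distrC [`|y - z|]distrC; exact: wl.
move=> y0 z0 yB zB; move: zy; rewrite le_eqVlt => /predU1P[->|zy].
  by rewrite !subrr !normr0 mulr0.
pose F t := lam * t - t `^ (p - 1).
have FE t : 0 < t -> force p lam t = F t.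
  by move=> t0; rewrite /force /F (psgn_ge0E _ (ltW t0)) ?powRSr// ltW.
have dF (t : R) : 0 < t -> is_derive t 1 F (lam * 1 - (p - 1) * t `^ (p - 1 - 1)).
  by move=> t0; apply: deriv_sub (deriv_scale lam (deriv_id t)) (is_derive1_powR (p - 1) t0).
have pos t : z <= t -> 0 < t by exact: lt_le_trans.
have posle t : z <= t <= y -> 0 < t by move=> /andP[/pos].
have poslt t : z < t < y -> 0 < t by move=> /andP[/ltW/pos].
have [c /andP[zc cy] FEc] := mean_value zy
  (fun t ht => deriv_continuous (dF t (posle t ht))) (fun t ht => dF t (poslt t ht)).
rewrite !FE// FEc normrM ler_wpM2r//.
have c0 := lt_trans z0 zc.
apply: le_trans (ler_normB _ _) _; rewrite mulr1 lerD2l normrM ger0_norm; last by lra.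
rewrite (_ : p - 1 - 1 = p - 2); last by ring.
rewrite ler_wpM2l//; first by lra.
have cB : c <= B := ltW (lt_le_trans cy yB).
rewrite ger0_norm ?powR_ge0//; apply: ge0_ler_powR cB; rewrite ?nnegrE ?(ltW c0)//.
  by lra.
by rewrite (le_trans (ltW y0)).
Qed.

(** Gronwall for the squared distance in phase space, the force being Lipschitz on bounded sets of
    positive numbers. The equivalence lets data be carried backwards too, from a contact point to
    the vertex. *)
Lemma ode_unique p lam I J f g F G (B a b : R) : 2 < p -> a <= b ->
  ode_solution p lam I f g -> ode_solution p lam J F G ->
  (forall x, a <= x <= b -> [/\ I x, J x, 0 < f x <= B & 0 < F x <= B]) ->
  (f a = F a /\ g a = G a <-> f b = F b /\ g b = G b).
Proof.
move=> p2 ab [fg cg gF] [FG cG GF] hB.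
pose D x := (f x - F x) ^+ 2 + (g x - G x) ^+ 2.
pose dD x := 2 * (f x - F x) * (g x - G x)
  + 2 * (g x - G x) * (force p lam (f x) - force p lam (F x)).
have D0 x : f x = F x /\ g x = G x <-> D x = 0.
  rewrite /D; split=> [[-> ->]|/eqP]; first by rewrite !subrr expr0n addr0.
  by rewrite paddr_eq0 ?sqr_ge0// !sqrf_eq0 !subr_eq0 => /andP[/eqP-> /eqP->].
rewrite (D0 a) (D0 b); pose K : R := `|lam| + (p - 1) * B `^ (p - 2).
have K0 : 0 <= K by rewrite addr_ge0 ?mulr_ge0 ?powR_ge0//; lra.
have dd x : a <= x <= b -> is_derive x 1 D (dD x).
  move=> /hB[Ix Jx _ _].
  exact: deriv_add (deriv_sqr (deriv_sub (fg x) (FG x)))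
    (deriv_sqr (deriv_sub (gF x Ix) (GF x Jx))).
apply: (gronwall_zero (K := 1 + K) ab dd) => x hx.
have [_ _ /andP[f0 fB] /andP[F0 FB]] := hB x hx.
have := force_lipschitz lam p2 f0 F0 fB FB; rewrite -/K /D /dD.
move: (f x - F x) (g x - G x) (_ - _) => u v w hw.
split; first by rewrite addr_ge0 ?sqr_ge0.
apply: le_trans (ler_normD _ _) _; rewrite !normrM (ger0_norm (ler0n _ 2)).
rewrite -[u ^+ 2]real_normK ?num_real// -[v ^+ 2]real_normK ?num_real//.
move: hw (normr_ge0 u) (normr_ge0 v) (normr_ge0 w).
move: `|u| `|v| `|w| => {}u {}v {}w hw u0 v0 w0.
have h1 : v * w <= v * (K * u) by apply: ler_wpM2l.
have h2 : 0 <= (1 + K) * (u - v) ^+ 2 by rewrite mulr_ge0 ?sqr_ge0//; lra.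
lra.
Qed.

End Branch.

(** * Uniqueness of the type A solution *)

Section Trigonometry.
Context {R : realType}.
Implicit Types x y b : R.

Lemma nonneg_of_deriv (F dF : R -> R) : F 0 = 0 ->
  (forall x : R, is_derive x 1 F (dF x)) -> (forall x, 0 <= x -> 0 <= dF x) ->
  forall x, 0 <= x -> 0 <= F x.
Proof.
move=> F0 FdF dF0 x x0; rewrite -F0.
apply: (deriv_ge0_le x0 (fun t _ => deriv_continuous (FdF t)) (fun t _ => FdF t)).
by move=> t /andP[/ltW t0 _]; exact: dF0.
Qed.

Lemma sin_le x : 0 <= x -> sin x <= x.
Proof.
pose F (t : R) := t - sin t.
have dd (y : R) : is_derive y 1 F (1 - cos y) := deriv_sub (deriv_id y) (is_derive_sin y).
move=> x0; rewrite -subr_ge0; apply: (nonneg_of_deriv _ dd) x0.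
- by rewrite /F sin0 subrr.
- by move=> y _; rewrite subr_ge0 cos_le1.
Qed.

Lemma cos_ge_quadratic x : 0 <= x -> 1 - x ^+ 2 / 2 <= cos x.
Proof.
pose F (t : R) := cos t - (1 - 2^-1 * t ^+ 2).
have dd (y : R) : is_derive y 1 F (y - sin y).
  have := deriv_sub (is_derive_cos y) (deriv_sub (deriv_const 1 y)
    (deriv_scale 2^-1 (deriv_sqr (deriv_id y)))).
  by move/is_derive_eq; apply; field.
move=> x0; rewrite -subr_ge0 [x ^+ 2 / 2]mulrC; apply: (nonneg_of_deriv _ dd) x0.
- by rewrite /F cos0 expr0n/= mulr0 subr0 subrr.
- by move=> y /sin_le; rewrite subr_ge0.
Qed.

Lemma sin_ge_cubic x : 0 <= x -> x - x ^+ 3 / 6 <= sin x.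
Proof.
pose F (t : R) := sin t - (t - 6^-1 * (t * t ^+ 2)).
have dd (y : R) : is_derive y 1 F (cos y - (1 - y ^+ 2 / 2)).
  have := deriv_sub (is_derive_sin y) (deriv_sub (deriv_id y)
    (deriv_scale 6^-1 (deriv_mul (deriv_id y) (deriv_sqr (deriv_id y))))).
  by move/is_derive_eq; apply; field.
move=> x0; rewrite -subr_ge0 [x ^+ 3 / 6]mulrC exprS; apply: (nonneg_of_deriv _ dd) x0.
- by rewrite /F sin0 mul0r mulr0 subr0 subrr.
- by move=> y /cos_ge_quadratic; rewrite subr_ge0.
Qed.

Lemma cos_le_quartic x : 0 <= x -> cos x <= 1 - x ^+ 2 / 2 + (x ^+ 2) ^+ 2 / 24.
Proof.
pose F (t : R) := 1 - 2^-1 * t ^+ 2 + 24^-1 * (t ^+ 2) ^+ 2 - cos t.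
have dd (y : R) : is_derive y 1 F (sin y - (y - y ^+ 3 / 6)).
  have := deriv_sub (deriv_add (deriv_sub (deriv_const 1 y)
    (deriv_scale 2^-1 (deriv_sqr (deriv_id y))))
    (deriv_scale 24^-1 (deriv_sqr (deriv_sqr (deriv_id y))))) (is_derive_cos y).
  by move/is_derive_eq; apply; field.
move=> x0; rewrite -subr_ge0 [x ^+ 2 / 2]mulrC [_ / 24]mulrC; apply: (nonneg_of_deriv _ dd) x0.
- by rewrite /F cos0 !expr0n/= !mulr0 subr0 addr0 subrr.
- by move=> y /sin_ge_cubic; rewrite subr_ge0.
Qed.

(** At pi/2 the quartic upper bound of the cosine is nonnegative, a quadratic inequality for y =
    (pi/2)^2. As y < 4, y is at most the lower root 6 - 2 sqrt(3), which is less than 8/3. *)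
Lemma pihalf_sqr_lt : 3 * (pi / 2) ^+ 2 < 8 :> R.
Proof.
have /andP[P0 P2] := pihalf_02 R.
have := cos_le_quartic (ltW P0); rewrite cos_pihalf.
have : (pi / 2) ^+ 2 < 4 :> R by rewrite expr2; nra.
by move: ((pi / 2) ^+ 2) => y; rewrite expr2; nra.
Qed.

(** By sin x <= 1 and x <= pi/2 - cos x, the derivative is positive as soon as 1 - 3 (pi/2) c + 6
    c^2 > 0 for c = cos x; the discriminant of this quadratic is negative by [pihalf_sqr_lt]. *)
Lemma phase_incr b b' : 0 <= b -> b < b' -> b' <= pi / 2 ->
  b ^+ 2 * (1 + 3 * cos b ^+ 2) < b' ^+ 2 * (1 + 3 * cos b' ^+ 2).
Proof.
move=> b0 bb' b'P.
pose F x : R := x ^+ 2 * (1 + 3 * cos x ^+ 2).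
pose dF x : R := 2 * x * (1 + 3 * cos x ^+ 2 - 3 * x * cos x * sin x).
have dd (x : R) : is_derive x 1 F (dF x).
  have := deriv_mul (deriv_sqr (deriv_id x)) (deriv_add (deriv_const 1 x)
    (deriv_scale 3 (deriv_sqr (is_derive_cos x)))).
  by move/is_derive_eq; apply; rewrite /dF; ring.
apply: (@deriv_gt0_lt _ F dF _ _ bb' (fun x _ => deriv_continuous (dd x)) (fun x _ => dd x)).
move=> x /andP[bx xb']; have x0 := le_lt_trans b0 bx; have xP := lt_le_trans xb' b'P.
have c0 : 0 < cos x.
  by apply: cos_gt0_pihalf; rewrite xP andbT (lt_trans _ x0)// oppr_lt0 divr_gt0// pi_gt0.
have cx : cos x <= pi / 2 - x.
  have -> : cos x = sin (pi / 2 - x).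
    by rewrite -opprB sinN sinBpihalf opprK.
  by apply: sin_le; rewrite subr_ge0 ltW.
rewrite /dF mulr_gt0 ?mulr_gt0//.
have s1 := sin_le1 x; have P2 := pihalf_sqr_lt.
have h1 : x * cos x * sin x <= x * cos x.
  by rewrite ler_piMr// mulr_ge0// ltW.
have h2 : x * cos x <= (pi / 2 - cos x) * cos x by rewrite ler_pM2r//; lra.
rewrite (_ : 3 * x * cos x * sin x = 3 * (x * cos x * sin x)); last by ring.
move: P2 h1 h2; move: (pi / 2) (cos x) (x * cos x) (x * cos x * sin x) => P c A B P2 h1 h2.
have := sqr_ge0 (12 * c - 3 * P); nra.
Qed.

(** The function y |-> acos(-y), obtained by inverting minus the cosine, which is increasing as
    [inverse_exists] demands. *)
Lemma arc_exists : exists arc : R -> R, [/\ continuous arc,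
  forall y, 0 <= arc y <= pi,
  forall x, 0 <= x <= pi -> arc (- cos x) = x,
  forall y, -1 <= y <= 1 -> - cos (arc y) = y
  & forall y : R, -1 < y < 1 -> is_derive y 1 arc (sin (arc y))^-1].
Proof.
have dd (x : R) : is_derive x 1 (fun x => - cos x) (sin x).
  by have := deriv_opp (is_derive_cos x); rewrite opprK.
have [arc [c1 c2 c3 c4 c5]] := inverse_exists (pi_gt0 R)
  (fun x _ => deriv_continuous (dd x)) (fun x _ => dd x) (fun x hx => sin_gt0_pi hx).
exists arc; split => // y hy.
- by apply: c4; rewrite cos0 cospi opprK.
- by apply: c5; rewrite cos0 cospi opprK.
Qed.

Lemma first_zero (D : R -> R) a b : continuous D -> a <= b -> 0 < D a -> D b <= 0 ->
  exists c, [/\ a < c <= b, D c = 0 & forall x, a <= x < c -> 0 < D x].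
Proof.
move=> cD ab Da Db.
pose S := [set x | a <= x <= b /\ D x <= 0].
have Sb : S b by split; rewrite ?ab ?lexx.
have Slb x : S x -> a <= x by move=> [/andP[]].
have hS : has_inf S by split; [exists b|exists a].
have ac : a <= inf S by apply: lb_le_inf; [exists b|].
have cb : inf S <= b by apply: ge_inf => //; exists a.
have lt_pos x : a <= x < inf S -> 0 < D x.
  move=> /andP[ax xc]; rewrite ltNge; apply/negP => Dx.
  have : S x by split => //; rewrite ax (ltW (lt_le_trans xc cb)).
  by move=> /(ge_inf hS.2); rewrite leNgt xc.
have Dc : D (inf S) <= 0.
  rewrite leNgt; apply/negP => Dc.
  have /cvgrPdist_lt/(_ _ Dc)[e /= e0 he] := cD (inf S).
  have [x Sx xe] := inf_adherent e0 hS.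
  have xc : inf S <= x by apply: ge_inf => //; exists a.
  have /he : `|inf S - x| < e by rewrite ler0_norm ?subr_le0//; lra.
  rewrite ltr_norml => /andP[_]; case: Sx => _ Dx; move: Dx; lra.
have aneq : a < inf S.
  by rewrite lt_neqAle ac andbT; apply/eqP => e; move: Dc; rewrite -e leNgt Da.
exists (inf S); split => //; first by rewrite aneq.
apply: le_anti; rewrite Dc/= leNgt; apply/negP => Dn.
have [|x /andP[ax xc] Dx] := intermediate_value (v := 0) ac (fun t _ => cD t).
  by rewrite ge_min le_max (ltW Da) Dc orbT.
move: xc; rewrite le_eqVlt => /predU1P[e|xc]; first by move: Dn; rewrite -e Dx ltxx.
by have := lt_pos x; rewrite ax xc Dx ltxx => /(_ isT).
Qed.

End Trigonometry.

(** * Convexity estimates for the potential above the well *)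

Section Well_depth.
Context {R : realType}.
Context (p lam : R) (p2 : 2 < p) (lam0 : 0 < lam).
Implicit Types q y z : R.

Local Notation w := (well p lam).

Definition depth y : R := potential p lam w - potential p lam y.
(** The second derivative of [depth] at positive [y]. *)
Definition stiffness y : R := (p - 1) * y `^ (p - 2) - lam.

Lemma powR_pred q y : 0 < y -> y `^ (q - 1) = y `^ q / y.
Proof.
move=> y0; rewrite powRB ?powRr1 ?(ltW y0)//.
by rewrite lt0r_neq0 ?implybT.
Qed.

Lemma deriv_depth y : is_derive y 1 depth (- force p lam y).
Proof.
have := deriv_sub (deriv_const (potential p lam w) y) (deriv_potential lam y p2).
by rewrite sub0r.
Qed.

Lemma deriv_force y : 0 < y -> is_derive y 1 (fun t => - force p lam t) (stiffness y).
Proof.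
move=> y0; have d1 := is_derive1_powR (p - 2) y0.
have := deriv_mul (deriv_id y) (deriv_sub d1 (deriv_const lam y)).
move=> h.
apply: (@near_eq_deriv _ (fun t => t * (t `^ (p - 2) - lam))).
  near=> t; rewrite force_ge0E; first by ring.
  by rewrite ltW//; near: t; exact: lt_nbhsr.
move: h; move/is_derive_eq; apply; rewrite powR_pred//.
by rewrite /stiffness; field; exact: lt0r_neq0.
Unshelve. all: by end_near. Qed.

Lemma deriv_stiffness y : 0 < y ->
  is_derive y 1 stiffness ((p - 1) * (p - 2) * y `^ (p - 2) / y).
Proof.
move=> y0; have := deriv_sub (deriv_scale (p - 1) (is_derive1_powR (p - 2) y0))
  (deriv_const lam y).
move/is_derive_eq; apply; rewrite powR_pred//.
by field; exact: lt0r_neq0.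
Qed.

Lemma well_le_pow y : w <= y -> lam <= y `^ (p - 2).
Proof.
move=> wy; rewrite -{1}(well_pow p2 lam0); apply: ge0_ler_powR => //.
- by have h := p2; lra.
- by rewrite nnegrE ltW// well_gt0.
- by rewrite nnegrE (le_trans _ wy)// ltW// well_gt0.
Qed.

Let n0 : 0 < p - 2. Proof. by have h := p2; lra. Qed.
Let pos y : w <= y -> 0 < y := lt_le_trans (well_gt0 p lam0).

Lemma stiffness_gt0 y : w <= y -> 0 < stiffness y.
Proof.
move=> /well_le_pow; rewrite /stiffness; move: (y `^ _) => a h.
by have := n0; have := lam0; nra.
Qed.

Lemma force_le0 y : w <= y -> 0 <= - force p lam y.
Proof.
move=> wy; rewrite force_ge0E ?(ltW (pos wy))// -mulrN mulr_ge0 ?(ltW (pos wy))//.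
by rewrite opprB subr_ge0 well_le_pow.
Qed.

Lemma depth_gt0 y : w < y -> 0 < depth y.
Proof. by move=> wy; rewrite subr_gt0; apply: potential_decr. Qed.

Lemma depth_ge0 y : w <= y -> 0 <= depth y.
Proof. by move=> wy; rewrite subr_ge0; apply: potential_le_well => //; rewrite ltW// pos. Qed.

Lemma force_well : force p lam w = 0.
Proof. by rewrite force_ge0E ?(ltW (well_gt0 _ lam0))// well_pow// subrr mulr0. Qed.

(** Both sides vanish at the well, and their difference has derivative 2 stiffness' depth >= 0. The
    inequality expresses that -force / sqrt(depth) is nondecreasing. *)
Lemma force_sqr_le y : w <= y -> force p lam y ^+ 2 <= 2 * stiffness y * depth y.
Proof.
move=> wy; pose k t : R := - force p lam t.
pose E t := 2 * (stiffness t * depth t) - k t ^+ 2.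
suff : E w <= E y.
  rewrite /E /k force_well /depth subrr mulr0 oppr0 expr0n/= subr0 mulr0 sqrrN.
  by rewrite subr_ge0 mulrA.
pose dE t := 2 * ((p - 1) * (p - 2) * t `^ (p - 2) / t * depth t + stiffness t * k t)
  - 2 * k t * stiffness t.
have dd (t : R) : w <= t -> is_derive t 1 E (dE t).
  move=> /pos t0; exact: deriv_sub (deriv_scale 2 (deriv_mul (deriv_stiffness t0)
    (deriv_depth t))) (deriv_sqr (deriv_force t0)).
apply: (@deriv_ge0_le _ E dE _ _ wy) => [t /andP[h _]|t /andP[/ltW h _]|t /andP[/ltW h _]].
- exact: deriv_continuous (dd t h).
- exact: dd.
- rewrite /dE (_ : _ - _ = 2 * ((p - 1) * (p - 2) * t `^ (p - 2) / t * depth t)); last by ring.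
  have t0 := pos h; apply: mulr_ge0 => //; apply: mulr_ge0 (depth_ge0 h).
  rewrite divr_ge0 ?(ltW t0)// mulr_ge0 ?powR_ge0// mulr_ge0 ?(ltW n0)//.
  by have h2 := p2; lra.
Qed.

(** The companion estimate, expressing that -force / depth is nonincreasing: -force exceeds neither
    a linear nor a quadratic growth in sqrt(depth) in the respective sense. *)
Lemma force_sqr_ge y : w <= y -> stiffness y * depth y <= force p lam y ^+ 2.
Proof.
move=> wy; pose k t : R := - force p lam t.
pose E t := k t ^+ 2 / stiffness t - depth t.
suff : E w <= E y.
  rewrite /E /k force_well /depth subrr oppr0 expr0n/= mul0r add0r sqrrN.
  by rewrite subr_ge0 ler_pdivlMr ?stiffness_gt0// mulrC.
pose dE t := (2 * k t * stiffness t * stiffness t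
  - k t ^+ 2 * ((p - 1) * (p - 2) * t `^ (p - 2) / t)) / stiffness t ^+ 2 - k t.
have dd (t : R) : w <= t -> is_derive t 1 E (dE t).
  move=> h; have t0 := pos h.
  exact: deriv_sub (deriv_div (lt0r_neq0 (stiffness_gt0 h)) (deriv_sqr (deriv_force t0))
    (deriv_stiffness t0)) (deriv_depth t).
apply: (@deriv_ge0_le _ E dE _ _ wy) => [t /andP[h _]|t /andP[/ltW h _]|t /andP[/ltW h _]].
- exact: deriv_continuous (dd t h).
- exact: dd.
- have t0 := pos h; have s0 := stiffness_gt0 h; have k0 := force_le0 h.
  have al := well_le_pow h.
  have kE : k t = t * (t `^ (p - 2) - lam).
    by rewrite /k force_ge0E ?(ltW t0)//; ring.
  rewrite /dE (_ : _ - _ = k t * (stiffness t ^+ 2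
    - k t * ((p - 1) * (p - 2) * t `^ (p - 2) / t)) / stiffness t ^+ 2); last first.
    by field; rewrite !lt0r_neq0.
  apply: divr_ge0; last exact: sqr_ge0.
  apply: mulr_ge0 => //; rewrite kE /stiffness.
  move: (t `^ (p - 2)) al => a al.
  (* With a = t^(p-2), the numerator is a polynomial in a - lam >= 0 with nonnegative
     coefficients. *)
  rewrite (_ : _ - _ = (p - 2) ^+ 2 * lam ^+ 2 + (p - 2) * (p - 1) * lam * (a - lam)
     + (p - 1) * (a - lam) ^+ 2); last by field; exact: lt0r_neq0.
  have p1 : 0 <= p - 1 by have h2 := p2; lra.
  have al' : 0 <= a - lam by rewrite subr_ge0.
  by rewrite !addr_ge0 ?mulr_ge0 ?sqr_ge0 ?(ltW n0) ?(ltW lam0).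
Qed.

Lemma force_depth_ratio_incr y z : w < y -> y <= z ->
  - force p lam y / Num.sqrt (depth y) <= - force p lam z / Num.sqrt (depth z).
Proof.
move=> wy yz; pose s t : R := Num.sqrt (depth t).
have s0 t : w < t -> 0 < s t by move=> wt; rewrite sqrtr_gt0 depth_gt0.
have sE t : w < t -> s t ^+ 2 = depth t by move=> wt; rewrite sqr_sqrtr// ltW// depth_gt0.
pose F t : R := - force p lam t / s t.
pose dF t : R := (stiffness t * s t - - force p lam t * (- force p lam t / (2 * s t))) / s t ^+ 2.
have dd (t : R) : w < t -> is_derive t 1 F (dF t).
  move=> wt; have t0 := pos (ltW wt).
  exact: deriv_div (lt0r_neq0 (s0 t wt)) (deriv_force t0)
    (deriv_sqrt (depth_gt0 wt) (deriv_depth t)).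
apply: (@deriv_ge0_le _ F dF _ _ yz) => [t /andP[h _]|t /andP[h _]|t /andP[h _]].
- exact: deriv_continuous (dd t (lt_le_trans wy h)).
- exact: dd (lt_trans wy h).
- have wt := lt_trans wy h; have := s0 t wt; have := sE t wt.
  have := force_sqr_le (ltW wt); rewrite /dF.
  move: (s t) (depth t) => r d h1 h2 r0.
  rewrite (_ : _ / r ^+ 2 = (2 * stiffness t * r ^+ 2 - force p lam t ^+ 2) / (2 * r ^+ 3)).
    by rewrite divr_ge0 ?subr_ge0 ?h2// mulr_ge0// exprn_ge0// ltW.
  by field; exact: lt0r_neq0.
Qed.

Lemma force_depth_ratio_decr y z : w < y -> y <= z ->
  - force p lam z / depth z <= - force p lam y / depth y.
Proof.
move=> wy yz; pose F t : R := - force p lam t / depth t.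
pose dF t : R := (stiffness t * depth t - - force p lam t * - force p lam t) / depth t ^+ 2.
have dd (t : R) : w < t -> is_derive t 1 F (dF t).
  move=> wt; have t0 := pos (ltW wt).
  exact: deriv_div (lt0r_neq0 (depth_gt0 wt)) (deriv_force t0) (deriv_depth t).
apply: (@deriv_le0_ge _ F dF _ _ yz) => [t /andP[h _]|t /andP[h _]|t /andP[h _]].
- exact: deriv_continuous (dd t (lt_le_trans wy h)).
- exact: dd (lt_trans wy h).
- have wt := lt_trans wy h; rewrite /dF mulrNN -expr2 mulr_le0_ge0 ?invr_ge0 ?sqr_ge0//.
  by rewrite subr_le0 force_sqr_ge// ltW.
Qed.

End Well_depth.

(** * Comparison of phases in the potential well *)

Section Phase.
Context {R : realType}.
Context (p lam ell : R) (p2 : 2 < p) (lam0 : 0 < lam) (ell0 : 0 < ell) (arc : R -> R)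
  (arc_cont : continuous arc) (arc_itv : forall y, 0 <= arc y <= pi)
  (arcK : forall x, 0 <= x <= pi -> arc (- cos x) = x)
  (cosK : forall y, -1 <= y <= 1 -> - cos (arc y) = y)
  (deriv_arc : forall y : R, -1 < y < 1 -> is_derive y 1 arc (sin (arc y))^-1).
Implicit Types (f g : R -> R) (x h : R).

Local Notation H := (potential p lam).
Local Notation W := (well p lam).

(* In the well, [depth f] and half the squared slope sum to [amplitude ^+ 2], so
   the solution is [sqrt (depth f) = amplitude * cos (phase)]. *)
Definition amplitude h : R := Num.sqrt (H W + 3 * h).
Definition phase f x : R := arc (- (Num.sqrt (depth p lam (f x)) / amplitude (H (f 0)))).

Section Single.
Context f g (prof : edge_profile p lam ell f g).

Local Notation h := (H (f 0)).
Local Notation amp := (amplitude h).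
Local Notation s x := (Num.sqrt (depth p lam (f x))).

Let hp : 0 < h := profile_h_gt0 p2 lam0 prof.

Lemma profile_h_le_well : h <= H W.
Proof.
by have /andP[a0 _] := profile_start prof; apply: potential_le_well => //; exact: ltW.
Qed.

Lemma amplitude_sqr : amp ^+ 2 = H W + 3 * h.
Proof.
rewrite sqr_sqrtr// addr_ge0//; last by rewrite mulr_ge0// ltW.
exact: le_trans (ltW hp) profile_h_le_well.
Qed.

Lemma amplitude_gt0 : 0 < amp.
Proof. by rewrite sqrtr_gt0; have := profile_h_le_well; have := hp; lra. Qed.

Lemma depth_energy x : 0 <= x <= ell ->
  depth p lam (f x) = amp ^+ 2 - g x ^+ 2 / 2.
Proof.
move=> hx; rewrite amplitude_sqr /depth (profile_energy p2 lam0 prof hx).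
by move: (H (f x)) h (H W) => A B C; lra.
Qed.

Lemma sqrt_depth_le x : 0 <= x <= ell -> s x <= amp.
Proof.
move=> hx; rewrite ler_wsqrtr//; rewrite depth_energy// amplitude_sqr.
by rewrite gerBl divr_ge0 ?sqr_ge0.
Qed.

Let ratio x : 0 <= s x / amp. Proof. by rewrite divr_ge0 ?sqrtr_ge0. Qed.

Let ratio_le1 x : 0 <= x <= ell -> s x / amp <= 1.
Proof. by move=> hx; rewrite ler_pdivrMr ?amplitude_gt0// mul1r sqrt_depth_le. Qed.

Lemma cos_phase x : 0 <= x <= ell -> cos (phase f x) = s x / amp.
Proof.
move=> hx; rewrite -[LHS]opprK cosK ?opprK// lerN2 ratio_le1//=.
by rewrite (le_trans _ (ler01)) // oppr_le0.
Qed.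

Lemma phase_itv x : 0 <= x <= ell -> 0 <= phase f x <= pi / 2.
Proof.
move=> hx; have /andP[h1 h2] := arc_itv (- (s x / amp)).
rewrite h1/= leNgt; apply/negP => h3.
have : cos (phase f x) < cos (pi / 2).
  rewrite ltr_cos// in_itv/=; last by rewrite h1.
  by have := pi_gt0 R; lra.
by rewrite cos_phase// cos_pihalf ltNge ratio.
Qed.

Lemma phase_end : phase f ell = 0.
Proof.
rewrite /phase depth_energy ?lexx ?ltW// (profile_end prof) expr0n/= mul0r subr0.
rewrite sqrtr_sqr gtr0_norm ?amplitude_gt0// divff ?lt0r_neq0 ?amplitude_gt0//.
by rewrite -[X in - X]cos0 arcK// lexx pi_ge0.
Qed.

Lemma phase_continuous : continuous (phase f).
Proof.
have cf := ode_continuous (profile_ode prof).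
move=> x; apply: (@continuous_comp _ _ _
  (fun x => - (s x / amp)) arc); last exact: arc_cont.
apply: cvgN; apply: cvgMl; apply: (@continuous_comp _ _ _
  (fun x => depth p lam (f x)) Num.sqrt); last exact: sqrt_continuous.
by apply: cvgB; [exact: cvg_cst|apply: (@continuous_comp _ _ _ f H);
  [exact: cf|exact: continuous_potential]].
Qed.

(** The amplitude cancels, so the rate depends on the height [f x] alone. Two profiles of different
    energy can then be compared through the monotonicity of -force / sqrt(depth) and of -force /
    depth. *)
Lemma deriv_phase x : 0 <= x < ell -> W < f x ->
  is_derive x 1 (phase f) (- (- force p lam (f x) / s x / Num.sqrt 2)).
Proof.
move=> /andP[x0 xl] Wx; have hx : 0 <= x <= ell by rewrite x0 ltW.
have [fdf _ _] := profile_ode prof.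
have g0 : 0 < g x by apply: (profile_incr prof); rewrite x0.
have d0 := depth_gt0 p2 lam0 Wx.
have s0 : 0 < s x by rewrite sqrtr_gt0.
have sE : s x ^+ 2 = depth p lam (f x) by rewrite sqr_sqrtr// ltW.
have a0 := amplitude_gt0.
have dE := depth_energy hx.
have lt1 : s x / amp < 1.
  rewrite ltr_pdivrMr// mul1r -(@ltr_pXn2r _ 2)// ?nnegrE ?(ltW s0) ?(ltW a0)//.
  by rewrite sE dE gtrBl divr_gt0// exprn_gt0.
have hin : -1 < - (s x / amp) < 1.
  by rewrite ltrN2 lt1/= (lt_trans _ (@ltr01 R))// oppr_lt0 divr_gt0.
have d1 := @deriv_comp _ (depth p lam) f _ _ _ (deriv_depth lam p2 (f x)) (fdf x).
have d2 := deriv_opp (deriv_mul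
  (@deriv_sqrt _ (fun t => depth p lam (f t)) _ _ d0 d1) (deriv_const (amp^-1) x)).
have := @deriv_comp _ arc (fun x => - (s x / amp)) _ _ _ (deriv_arc hin) d2.
move/is_derive_eq; apply.
have ph : 0 < phase f x < pi.
  have /andP[h1 h2] := phase_itv hx; have pi0 := pi_gt0 R.
  rewrite (_ : phase f x < pi); last by move: h2 pi0; lra.
  rewrite andbT lt_neqAle h1 andbT; apply/eqP => e.
  by move: lt1; rewrite -cos_phase// -e cos0 ltxx.
have sin0' := sin_gt0_pi ph.
have r0 : 0 < Num.sqrt 2 :> R by rewrite sqrtr_gt0.
have gE : g x = Num.sqrt 2 * amp * sin (phase f x).
  apply/eqP; rewrite -(@eqrXn2 _ 2)// ?(ltW g0)// ?mulr_ge0 ?(ltW sin0') ?(ltW a0) ?(ltW r0)//.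
  rewrite !exprMn sqr_sqrtr// sin2cos2 cos_phase// exprMn exprVn sE dE.
  by apply/eqP; field; exact: lt0r_neq0.
rewrite -/(phase f x) gE; have r2 : Num.sqrt 2 ^+ 2 = 2 :> R by rewrite sqr_sqrtr.
move: (Num.sqrt 2) r0 r2 (sin _) sin0' (s x) s0 amp a0 => r r0 r2 S S0 t t0 a a0.
rewrite (_ : 2 * t = r ^+ 2 * t); last by rewrite r2.
by field; rewrite !lt0r_neq0.
Qed.

End Single.

Lemma cos_decr_pihalf (x y : R) : 0 <= x -> x < y -> y <= pi / 2 -> cos y < cos x.
Proof.
move=> x0 xy yP; have yp : y <= pi by have := pi_gt0 R; lra.
by rewrite ltr_cos// in_itv/= ?x0 ?(ltW (le_lt_trans x0 xy))//= (le_trans (ltW xy)).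
Qed.

(** The case complementary to [profile_no_crossing]. The higher start [F 0] has less potential, so
    it lies above the well and [F] has the smaller amplitude. Relative to the amplitude, the phase
    of [F] at [x2] is smaller than that of [f]; while smaller, it decreases at least as fast, so the
    two cannot both be 0 at [ell]. *)
Lemma phase_no_slower f g F G : edge_profile p lam ell f g -> edge_profile p lam ell F G ->
  f 0 < F 0 -> H (F 0) < H (f 0) -> False.
Proof.
move=> Pf PF ff hh.
have /andP[a0 aM] := profile_start Pf; have /andP[b0 bM] := profile_start PF.
have hf0 := profile_h_gt0 p2 lam0 Pf; have hF0 := profile_h_gt0 p2 lam0 PF.
have [x2 /andP[x20 x2l] [Wx2 Hx2 _]] := profile_crossing p2 lam0 ell0 Pf.
have WF : W < F 0.
  rewrite ltNge; apply/negP => FW; move: hh; apply/negP; rewrite -leNgt.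
  by apply: ltW; apply: potential_incr => //; exact: ltW.
have af := amplitude_gt0 Pf; have aF := amplitude_gt0 PF.
have afE := amplitude_sqr Pf; have aFE := amplitude_sqr PF.
set A := amplitude (H (f 0)) in af afE *; set B := amplitude (H (F 0)) in aF aFE *.
have BA : B < A.
  by rewrite -(@ltr_pXn2r _ 2)// ?nnegrE ?(ltW af) ?(ltW aF)// afE aFE; lra.
(* Where positive, [D] is nondecreasing, so it cannot fall from [D x2 > 0] to
   [D ell = 0]. *)
pose D x := phase f x / A - phase F x / B.
have cD : continuous D.
  by move=> x; apply: cvgB; apply: cvgMl; [exact: (phase_continuous Pf)|exact: (phase_continuous PF)].
have Dl : D ell = 0 by rewrite /D (phase_end Pf) (phase_end PF) !mul0r subrr.
have x2l' : x2 <= ell := ltW x2l.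
have hx2 : 0 <= x2 <= ell by rewrite x20.
have h00 : (0 : R) <= 0 <= ell by rewrite lexx ltW.
suff Dx2 : 0 < D x2.
  have [c [/andP[x2c cl] Dc pos]] := first_zero cD x2l' Dx2 (eq_ind_r (fun z => z <= 0) (lexx 0) Dl).
  suff : D x2 <= D c by rewrite Dc leNgt Dx2.
  pose qf x := - force p lam (f x) / Num.sqrt (depth p lam (f x)).
  pose qF x := - force p lam (F x) / Num.sqrt (depth p lam (F x)).
  pose dD x := - (qf x / Num.sqrt 2) / A - - (qF x / Num.sqrt 2) / B.
  have inside x : x2 < x < c -> [/\ 0 <= x < ell, W < f x & W < F x].
    move=> /andP[h1 h2]; have x0 := le_lt_trans x20 h1; have xl := lt_le_trans h2 cl.
    rewrite (ltW x0) xl; split => //.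
    - by apply: le_lt_trans Wx2 _; exact: (profile_mono Pf) x20 h1 (ltW xl).
    - by apply: lt_trans WF _; exact: (profile_mono PF) (lexx _) x0 (ltW xl).
  have dd x : x2 < x < c -> is_derive x 1 D (dD x).
    move=> /inside[hx Wf WFx].
    have d1 := deriv_scale A^-1 (deriv_phase Pf hx Wf).
    have d2 := deriv_scale B^-1 (deriv_phase PF hx WFx).
    have := deriv_sub d1 d2; rewrite (_ : (fun t => _) = D).
      by move/is_derive_eq; apply; rewrite /dD ![_ / _]mulrC.
    by apply/funext => t; rewrite /D mulrC [B^-1 * _]mulrC.
  apply: (deriv_ge0_le (ltW x2c) (fun x _ => cD x) dd) => x hx.
  have [hx' Wf WFx] := inside x hx; have hx'' : 0 <= x <= ell.
    by case/andP: hx' => -> /ltW.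
  have Dx : 0 < D x by apply: pos; case/andP: hx => /ltW-> ->.
  have r0 : 0 < Num.sqrt 2 :> R by rewrite sqrtr_gt0.
  suff : qf x / A <= qF x / B.
    rewrite /dD => h1; rewrite !mulNr opprK addrC subr_ge0 ![_ / Num.sqrt 2 / _]mulrAC.
    by rewrite ler_pM2r// invr_gt0.
  have /andP[pf0 pf1] := phase_itv Pf hx''; have /andP[pF0 pF1] := phase_itv PF hx''.
  have cle : cos (phase f x) <= cos (phase F x).
    have : phase F x < phase f x.
      move: Dx; rewrite subr_gt0 ltr_pdivlMr// mulrAC => h1.
      apply: le_lt_trans h1; rewrite -mulrA ler_peMr// ler_pdivlMr// mul1r; exact: ltW.
    move=> h1; exact/ltW/cos_decr_pihalf.
  have qf0 : 0 <= qf x by rewrite divr_ge0 ?sqrtr_ge0// force_le0// ltW.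
  have qF0 : 0 <= qF x by rewrite divr_ge0 ?sqrtr_ge0// force_le0// ltW.
  (* If f <= F, -force / sqrt(depth) is larger at [F x] and the amplitude [B] is smaller. Otherwise
     the relative rate is written as (-force / depth) * cos(phase), and both factors are larger for
     [F]. *)
  have [fF|Ff] := leP (f x) (F x).
    have := force_depth_ratio_incr p2 lam0 Wf fF; rewrite -/(qf x) -/(qF x) => h1.
    apply: ler_pM => //; first by rewrite invr_ge0 ltW.
    by rewrite lef_pV2 ?posrE// ltW.
  have sf := sqr_sqrtr (ltW (depth_gt0 p2 lam0 Wf)).
  have sF := sqr_sqrtr (ltW (depth_gt0 p2 lam0 WFx)).
  have tf : 0 < Num.sqrt (depth p lam (f x)) by rewrite sqrtr_gt0 depth_gt0.
  have tF : 0 < Num.sqrt (depth p lam (F x)) by rewrite sqrtr_gt0 depth_gt0.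
  have kF := force_le0 p2 lam0 (ltW WFx). have kf := force_le0 p2 lam0 (ltW Wf).
  have h1 := force_depth_ratio_decr p2 lam0 WFx (ltW Ff); rewrite -sf -sF in h1.
  rewrite (cos_phase Pf hx'') (cos_phase PF hx'') -/A -/B in cle.
  rewrite /qf /qF.
  move: (Num.sqrt (depth p lam (f x))) tf cle h1 => t t0 cle h1.
  move: (Num.sqrt (depth p lam (F x))) tF cle h1 => T T0 cle h1.
  move: (- force p lam (f x)) kf h1 => k k0 h1.
  move: (- force p lam (F x)) kF h1 => K K0 h1.
  rewrite (_ : k / t / A = k / t ^+ 2 * (t / A)); last by field; rewrite !lt0r_neq0.
  rewrite (_ : K / T / B = K / T ^+ 2 * (T / B)); last by field; rewrite !lt0r_neq0.
  apply: ler_pM => //.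
  - by rewrite divr_ge0// sqr_ge0.
  - by rewrite divr_ge0// ltW.
(* For [f] at [x2] and for [F] at 0 the potential is the respective vertex value, so amplitude^2 (1
   + 3 cos(phase)^2) = 4 H(W) in both cases. Hence (phase / amplitude)^2 is a fixed multiple of the
   increasing function of [phase_incr], and the smaller amplitude has the smaller phase. *)
have /andP[b0' bP] := phase_itv Pf hx2; have /andP[B0' BP] := phase_itv PF h00.
have /andP[B20 B2P] := phase_itv PF hx2.
have depf : depth p lam (f x2) = H W - H (f 0) by rewrite /depth Hx2.
have c1 := cos_phase Pf hx2; have c2 := cos_phase PF h00.
have amp4 (a d : R) : 0 < a -> a * (1 + 3 * (d / a)) = a + 3 * d.
  by move=> a0'; field; exact: lt0r_neq0.
have A4 : A ^+ 2 * (1 + 3 * cos (phase f x2) ^+ 2) = 4 * H W.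
  rewrite c1 -/A exprMn exprVn (sqr_sqrtr (depth_ge0 p2 lam0 Wx2)) depf.
  by rewrite amp4 ?exprn_gt0// afE; lra.
have B4 : B ^+ 2 * (1 + 3 * cos (phase F 0) ^+ 2) = 4 * H W.
  rewrite c2 -/B exprMn exprVn (sqr_sqrtr (depth_ge0 p2 lam0 (ltW WF))).
  by rewrite amp4 ?exprn_gt0// aFE /depth; lra.
have lt1 : cos (phase f x2) < cos (phase F 0).
  rewrite -(@ltr_pXn2r _ 2)// ?nnegrE ?c1 ?c2 ?divr_ge0 ?sqrtr_ge0 ?(ltW af) ?(ltW aF)//.
  rewrite -c1 -c2; have BA2 : B ^+ 2 < A ^+ 2 by rewrite afE aFE; lra.
  have xp : 0 < 1 + 3 * cos (phase f x2) ^+ 2.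
    by rewrite ltr_pwDl// mulr_ge0// sqr_ge0.
  have B2 := exprn_gt0 2 aF.
  move: A4 B4 xp; move: (cos _ ^+ 2) (cos _ ^+ 2) => y x A4 B4 xp.
  rewrite ltNge; apply/negP => yx.
  have h1 : B ^+ 2 * (1 + 3 * x) < A ^+ 2 * (1 + 3 * x) by rewrite ltr_pM2r.
  have h2 : B ^+ 2 * (1 + 3 * y) <= B ^+ 2 * (1 + 3 * x).
    by rewrite ler_pM2l// lerD2l ler_pM2l.
  by have := le_lt_trans h2 h1; rewrite A4 B4 ltxx.
have lt2 : phase F 0 < phase f x2.
  rewrite ltNge; apply/negP; rewrite le_eqVlt => /predU1P[e|h].
    by move: lt1; rewrite e ltxx.
  have : cos (phase F 0) < cos (phase f x2).
    exact: cos_decr_pihalf.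
  by rewrite ltNge (ltW lt1).
have le3 : phase F x2 <= phase F 0.
  rewrite leNgt; apply/negP => h.
  have : cos (phase F x2) < cos (phase F 0).
    exact: cos_decr_pihalf.
  rewrite (cos_phase PF hx2) c2 -/B ltr_pM2r ?invr_gt0// ltNge ler_wsqrtr//.
  rewrite lerB// potential_anti_le//; first exact: ltW.
  exact: (profile_mono_le PF).
have := phase_incr B0' lt2 bP.
have C0 : 0 < 4 * H W by rewrite mulr_gt0// (lt_le_trans hf0)// (profile_h_le_well Pf).
rewrite /D subr_gt0 => h.
apply: (@le_lt_trans _ _ (phase F 0 / B)); first by rewrite ler_pM2r// invr_gt0.
rewrite -(@ltr_pXn2r _ 2)// ?nnegrE ?divr_ge0 ?(ltW af) ?(ltW aF)// !exprMn !exprVn.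
rewrite ltr_pdivrMr ?exprn_gt0// mulrAC ltr_pdivlMr ?exprn_gt0//.
move: h A4 B4 C0; move: (A ^+ 2) (exprn_gt0 2 af) (B ^+ 2) (exprn_gt0 2 aF) => a pa bb pb.
move: (phase F 0 ^+ 2) (phase f x2 ^+ 2) (cos _ ^+ 2) (cos _ ^+ 2) => u v x y.
move=> h A4 B4 C0; rewrite -(ltr_pM2r C0) -{1}B4 -A4.
have ab : 0 < a * bb by rewrite mulr_gt0.
have h' : u * (1 + 3 * y) * (a * bb) < v * (1 + 3 * x) * (a * bb) by rewrite ltr_pM2r.
move: h'; rewrite (_ : u * (1 + 3 * y) * (a * bb) = u * a * (bb * (1 + 3 * y))); last by ring.
by rewrite (_ : v * (1 + 3 * x) * (a * bb) = v * bb * (a * (1 + 3 * x))) //; ring.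
Qed.

End Phase.

(** * Sturm comparison and uniqueness of the branch *)

Section Uniqueness.
Context {R : realType}.
Implicit Types (p lam ell : R) (f g F G : R -> R) (u v : gfun R).

Lemma profile_bounded p lam ell f g x : 0 < ell -> edge_profile p lam ell f g ->
  0 <= x <= ell -> 0 < f x <= f ell.
Proof.
move=> ell0 Pf hx; rewrite (profile_gt0 Pf hx)/=; case/andP: hx => x0 xl.
exact: profile_mono_le Pf _ _ _ xl _.
Qed.

Lemma profile_start_unique p lam ell f g F G : 2 < p -> 0 < ell ->
  edge_profile p lam ell f g -> edge_profile p lam ell F G ->
  forall x, 0 <= x <= ell -> (f 0 = F 0 <-> f x = F x /\ g x = G x).
Proof.
move=> p2 ell0 Pf PF x /andP[x0 xl].
rewrite -(@ode_unique _ p lam _ _ f g F G (Num.max (f ell) (F ell)) 0 x p2 x0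
  (profile_ode Pf) (profile_ode PF)).
  split=> [e|[]//]; split=> //.
  by rewrite (profile_slope Pf) (profile_slope PF) e.
move=> t /andP[t0 tx]; have ht : 0 <= t <= ell by rewrite t0 (le_trans tx).
have /andP[f0 fl] := profile_bounded ell0 Pf ht.
have /andP[F0 Fl] := profile_bounded ell0 PF ht.
by rewrite terminal_edgeE f0 F0 !le_max fl Fl orbT.
Qed.

Lemma profile_no_crossing p lam ell f g F G : 2 < p -> 0 < lam -> 0 < ell ->
  edge_profile p lam ell f g -> edge_profile p lam ell F G ->
  f 0 < F 0 -> potential p lam (f 0) <= potential p lam (F 0) -> False.
Proof.
move=> p2 lam0 ell0 Pf PF ff hh.
have [fdf cg gF] := profile_ode Pf; have [FdF cG GF] := profile_ode PF.
have cf := ode_continuous (profile_ode Pf); have cF := ode_continuous (profile_ode PF).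
have /andP[a0 aM] := profile_start Pf; have /andP[b0 bM] := profile_start PF.
have hl : 0 <= ell <= ell by rewrite lexx ltW.
have nn f' g' (P : edge_profile p lam ell f' g') x : 0 <= x <= ell -> 0 <= g' x.
  move=> /andP[x0]; rewrite le_eqVlt => /predU1P[->|xl]; first by rewrite (profile_end P).
  by apply/ltW/(profile_incr P); rewrite x0.
pose D x := F x - f x; pose dD x := G x - g x.
have dd (x : R) : is_derive x 1 D (dD x) := deriv_sub (FdF x) (fdf x).
have cD : continuous D by move=> x; exact: deriv_continuous (dd x).
have cdD : continuous dD by move=> x; apply: cvgB; [exact: cG|exact: cg].
(* At a first contact the ordering of the energies gives g <= G, whereas [F - f] decreasing to 0
   gives G <= g. The contact is tangential, so the profiles coincide back to the vertex, against
   [f 0 < F 0]. *)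
have pos x : 0 <= x <= ell -> f x < F x.
  move=> /andP[x0 xl]; rewrite ltNge; apply/negP => Fx.
  have D0 : 0 < D 0 by rewrite subr_gt0.
  have Dx : D x <= 0 by rewrite subr_le0.
  have [c [/andP[c0 cx] Dc Dpos]] := first_zero cD x0 D0 Dx.
  have hc : 0 <= c <= ell by rewrite (ltW c0) (le_trans cx).
  have fc : f c = F c by apply/eqP; rewrite eq_sym -subr_eq0 -/(D c) Dc.
  have gG : g c <= G c.
    rewrite -(@ler_pXn2r _ 2)// ?nnegrE ?(nn _ _ Pf) ?(nn _ _ PF)//.
    rewrite (profile_energy p2 lam0 Pf hc) (profile_energy p2 lam0 PF hc) fc.
    by rewrite lerD2l ler_pM2l.
  have Gg : dD c <= 0.
    rewrite leNgt; apply/negP => dDc.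
    have dr (t : R) : is_derive t 1 (fun t => D (c - t)) (- dD (c - t)) := deriv_reflect (dd (c - t)).
    have cdr : continuous (fun t => - dD (c - t)).
      move=> t; apply: cvgN; apply: (@continuous_comp _ _ _ (fun t => c - t) dD); last exact: cdD.
      by apply: cvgB; [exact: cvg_cst|exact: cvg_id].
    have [|y /andP[y0 yc]] := deriv_neg_lt (x := 0) dr cdr _ c0; first by rewrite subr0 oppr_lt0.
    rewrite subr0 Dc ltNge => /negP; apply; rewrite ltW// Dpos//.
    by rewrite add0r in yc; rewrite subr_ge0 (ltW yc) gtrBl.
  have gc : g c = G c by apply: le_anti; rewrite gG/= -subr_le0.
  have := (profile_start_unique p2 ell0 Pf PF hc).2 (conj fc gc).
  by move=> e; move: ff; rewrite e ltxx.
(* Sturm comparison: as [f < F], the Wronskian would increase from a nonnegative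
   value at 0 to the value 0 imposed by the Neumann condition. *)
pose Z x := g x * F x - f x * G x.
pose dZ x := force p lam (f x) * F x + g x * G x - (g x * G x + f x * force p lam (F x)).
have dZd (x : R) : 0 <= x <= ell -> is_derive x 1 Z (dZ x).
  move=> hx; have hI : terminal_edge ell x by rewrite terminal_edgeE.
  exact: deriv_sub (deriv_mul (gF x hI) (FdF x)) (deriv_mul (fdf x) (GF x hI)).
have inn x : 0 < x < ell -> 0 <= x <= ell by move=> /andP[/ltW-> /ltW->].
have powlt x y : 0 < x -> x < y -> x `^ (p - 2) < y `^ (p - 2).
  by move=> x0 xy; rewrite ltr_powR2 ?(ltW x0)// ltW// (lt_trans x0).
have Zlt : Z 0 < Z ell.
  apply: (deriv_gt0_lt ell0 (fun x h => deriv_continuous (dZd x h))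
    (fun x h => dZd x (inn x h))) => x /inn hx.
  have f0 := profile_gt0 Pf hx; have F0 := profile_gt0 PF hx.
  rewrite /dZ !force_ge0E ?(ltW f0) ?(ltW F0)//.
  have := powlt _ _ f0 (pos x hx); move: (_ `^ _) (_ `^ _) => A B AB.
  rewrite (_ : _ - _ = f x * F x * (A - B)); last by ring.
  by rewrite mulr_gt0 ?subr_gt0// mulr_gt0.
move: Zlt; rewrite {2}/Z (profile_end Pf) (profile_end PF) mul0r mulr0 subrr.
(* The slopes at 0 are [2 * speed], and the inequality holds because H(y) / y^2 = lam/2 - y^(p-2) /
   p decreases in y > 0. *)
apply/negP; rewrite -leNgt /Z subr_ge0 (profile_slope Pf) (profile_slope PF).
have sf := speed_sqr (ltW (profile_h_gt0 p2 lam0 Pf)).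
have sF := speed_sqr (ltW (profile_h_gt0 p2 lam0 PF)).
have s0 := speed_ge0 p lam (f 0); have S0 := speed_ge0 p lam (F 0).
rewrite -(@ler_pXn2r _ 2)// ?nnegrE ?mulr_ge0 ?(ltW a0) ?(ltW b0)//.
rewrite !exprMn sf sF !potential_ge0E ?(ltW a0) ?(ltW b0)//.
have := powlt _ _ a0 ff; move: (_ `^ _) (_ `^ _) => A B AB.
have p0 : 0 < p by lra.
rewrite -subr_ge0 (_ : _ - _ = 8 * f 0 ^+ 2 * F 0 ^+ 2 * ((A - B) / p)).
  have AB' : 0 <= A - B by rewrite subr_ge0 ltW.
  exact: mulr_ge0 (mulr_ge0 (mulr_ge0 (ler0n _ 8) (sqr_ge0 _)) (sqr_ge0 _))
    (divr_ge0 AB' (ltW p0)).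
by field; exact: lt0r_neq0.
Qed.

Lemma profile_unique p lam ell f g F G : 2 < p -> 0 < lam -> 0 < ell ->
  edge_profile p lam ell f g -> edge_profile p lam ell F G -> f 0 = F 0.
Proof.
move=> p2 lam0 ell0.
have [arc [c1 c2 c3 c4 c5]] := @arc_exists R.
have main f' g' F' G' : edge_profile p lam ell f' g' -> edge_profile p lam ell F' G' ->
    f' 0 < F' 0 -> False.
  move=> P Q lt; have [h|h] := leP (potential p lam (f' 0)) (potential p lam (F' 0)).
    exact: (profile_no_crossing p2 lam0 ell0 P Q lt h).
  exact: (phase_no_slower p2 lam0 ell0 c1 c2 c3 c4 c5 P Q lt h).
move=> P Q; have [h|h|//] := ltgtP (f 0) (F 0); exfalso.
- exact: main P Q h.
- exact: main Q P h.
Qed.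

Lemma half_line_unique p lam f g F G : 2 < p -> 0 < lam ->
  ode_solution p lam (@half_line R) f g -> H1 (@half_line R) f ->
  ode_solution p lam (@half_line R) F G -> H1 (@half_line R) F ->
  0 < f 0 -> f 0 = F 0 -> g 0 = G 0 -> forall x, 0 <= x -> f x = F x.
Proof.
move=> p2 lam0 of_ fH oF FH f0 fF gG x x0.
have F0 : 0 < F 0 by rewrite -fF.
apply: ((@ode_unique _ p lam _ _ f g F G (peak p lam) 0 x p2 x0 of_ oF _).1 (conj fF gG)).1.
move=> t /andP[t0 _]; rewrite half_lineE t0; split => //.
- by rewrite (half_line_gt0 p2 of_ fH f0 t0) (half_line_le_peak p2 lam0 of_ fH t0).
- by rewrite (half_line_gt0 p2 oF FH F0 t0) (half_line_le_peak p2 lam0 oF FH t0).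
Qed.

Lemma branch_A_unique p lam ell u v f1 g1 f2 g2 f3 g3 F1 G1 F2 G2 F3 G3 :
  2 < p -> 0 < lam -> 0 < ell ->
  branch_A p lam ell u f1 g1 f2 g2 f3 g3 -> branch_A p lam ell v F1 G1 F2 G2 F3 G3 ->
  eq_on_graph ell u v.
Proof.
move=> p2 lam0 ell0 [us P s1 s2] [vs Q t1 t2].
have e0 := profile_unique p2 lam0 ell0 P Q.
have /andP[a0 _] := profile_start P.
have f10 : f1 0 = f3 0 by rewrite (split_vertex12 us) (split_vertex23 us).
have F10 : F1 0 = F3 0 by rewrite (split_vertex12 vs) (split_vertex23 vs).
split => x; rewrite inE ?half_lineE ?terminal_edgeE => hx.
- rewrite -(split_eq1 us hx) -(split_eq1 vs hx).
  apply: (half_line_unique p2 lam0 (split_ode1 us) (split_H1_1 us) (split_ode1 vs)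
    (split_H1_1 vs)) => //; first by rewrite f10.
  + by rewrite f10 F10.
  + by rewrite s1 t1 e0.
- rewrite -(split_eq2 us hx) -(split_eq2 vs hx).
  apply: (half_line_unique p2 lam0 (split_ode2 us) (split_H1_2 us) (split_ode2 vs)
    (split_H1_2 vs)) => //; first by rewrite (split_vertex23 us).
  + by rewrite (split_vertex23 us) (split_vertex23 vs).
  + by rewrite s2 t2 e0.
- rewrite -(split_eq3 us hx) -(split_eq3 vs hx).
  exact: ((profile_start_unique p2 ell0 P Q hx).1 e0).1.
Qed.

Lemma branch_A_type_A p lam ell u f1 g1 f2 g2 f3 g3 :
  2 < p -> 0 < lam -> 0 < ell -> solution ell p lam u ->
  branch_A p lam ell u f1 g1 f2 g2 f3 g3 -> type_A ell p lam u.
Proof.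
move=> p2 lam0 ell0 usol [us P s1 s2].
have /andP[a0 aM] := profile_start P.
have S0 : 0 < speed p lam (f3 0) by rewrite sqrtr_gt0 mulr_gt0// (profile_h_gt0 p2 lam0 P).
have f10 : f1 0 = f3 0 by rewrite (split_vertex12 us) (split_vertex23 us).
have f20 : f2 0 = f3 0 by rewrite (split_vertex23 us).
have f10' : 0 < f1 0 by rewrite f10. have f20' : 0 < f2 0 by rewrite f20.
split => //.
- split => x; rewrite ?half_lineE ?terminal_edgeE => hx.
  + by rewrite -(split_eq1 us hx) (half_line_gt0 p2 (split_ode1 us) (split_H1_1 us)).
  + by rewrite -(split_eq2 us hx) (half_line_gt0 p2 (split_ode2 us) (split_H1_2 us)).
  + by rewrite -(split_eq3 us hx) (profile_gt0 P).
- move=> x; rewrite inE half_lineE => hx.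
  rewrite -(split_eq1 us hx) -(split_eq2 us hx).
  apply: (half_line_unique p2 lam0 (split_ode1 us) (split_H1_1 us) (split_ode2 us)
    (split_H1_2 us)) => //; first by rewrite f10 f20.
  by rewrite s1 s2.
- move=> x y; rewrite !inE !half_lineE => hx hy xy.
  rewrite -(split_eq1 us hx) -(split_eq1 us hy); have [fdf cdf _] := split_ode1 us.
  apply: (deriv_lt0_gt xy (fun t _ => deriv_continuous (fdf t)) (fun t _ => fdf t)).
  move=> t /andP[xt _].
  apply: (half_line_decreasing p2 lam0 (split_ode1 us) (split_H1_1 us)) => //.
  + by rewrite f10.
  + by rewrite s1 oppr_lt0.
  + by rewrite (le_trans hx)// ltW.
Qed.

End Uniqueness.

(** * Existence of the type A solution *)

Section Time_map.
Context {R : realType}.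
Local Notation mu := (@lebesgue_measure R).
Context (p lam : R) (p2 : 2 < p) (lam0 : 0 < lam).
Implicit Types (x t k : R).

Let p0 : 0 < p. Proof. by have h := p2; lra. Qed.

(* [(1 - |cos x|^p) / sin x ^+ 2], with its singularity at 0 removed. *)
Lemma quotient_exists : exists q : R -> R, [/\ continuous q, forall x, 1 <= q x, q 0 = p / 2
  & forall x, 0 <= cos x -> 1 - pabs p (cos x) = q x * sin x ^+ 2].
Proof.
have d1 : is_derive (1 : R) 1 (pabs p) p.
  by have := deriv_pabs p2 (1 : R); rewrite psgn_ge0E// powR1 !mulr1.
have /is_derive1_caratheodory[h [hE hC h1]] := d1.
have pabs1 : pabs p (1 : R) = 1 by rewrite pabs_ge0E// powR1.
have ch : continuous h.
  move=> y; have [->//|y1] := eqVneq y 1.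
  have y1' : y - 1 != 0 by rewrite subr_eq0.
  pose s (z : R) : R := (pabs p z - pabs p 1) / (z - 1).
  have cs : {for y, continuous s}.
    exact: deriv_continuous (@deriv_div _ (fun z => pabs p z - pabs p 1)
      (fun z => z - 1) _ _ _ y1' (deriv_sub (deriv_pabs p2 y)
      (deriv_const (pabs p 1) y)) (deriv_sub (deriv_id y) (deriv_const 1 y))).
  have sh z : z != 1 -> s z = h z by move=> z1; rewrite /s hE mulfK// subr_eq0.
  have nz : \forall z \near y, z != 1 by apply: open_nbhs_nbhs; split=> //; exact: open_neq.
  rewrite /continuous_at -(sh y y1); apply: cvg_trans cs.
  by apply: near_eq_cvg; near=> z; apply: sh; near: z.
(* [h] is the difference quotient of |y|^p based at 1, so 1 - |c|^p = (1 - c) h(c), while sin^2 = (1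
   - c) (1 + c) for c = cos x. *)
pose r x := h (cos x) / (1 + `|cos x|).
have r0 x : 0 < 1 + `|cos x| by rewrite ltr_pwDl.
have cr : continuous r.
  move=> x; apply: cvgM.
    by apply: (@continuous_comp _ _ _ (@cos R) h); [exact: continuous_cos|exact: ch].
  apply: cvgV; first exact: lt0r_neq0.
  by apply: cvgD; [exact: cvg_cst|apply: cvg_norm; exact: continuous_cos].
have rE x : 0 <= cos x -> 1 - pabs p (cos x) = r x * sin x ^+ 2.
  move=> c0; rewrite /r -opprB -{1}pabs1 hE sin2cos2 (ger0_norm c0).
  by field; rewrite -(ger0_norm c0) lt0r_neq0.
have r1 x : 0 <= cos x -> 1 <= r x.
  move=> c0; have := cos_le1 x; rewrite le_eqVlt => /predU1P[c1|c1].
    by rewrite /r c1 h1 normr1 ler_pdivlMr//; have hp := p2; lra.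
  have s0 : 0 < sin x ^+ 2 by rewrite sin2cos2 subr_gt0 exprn_ilt1.
  rewrite -(ler_pM2r s0) mul1r -rE// sin2cos2 lerD2l lerN2 pabs_ge0E//.
  have [->|cn0] := eqVneq (cos x) 0; first by rewrite powR0 ?sqr_ge0// gt_eqF.
  rewrite -powR_mulrn//; apply: ger_powR; last exact: ltW.
  by rewrite lt0r cn0 c0 ltW.
(* The maximum with 1 changes nothing where the cosine is nonnegative, and gives the lower bound on
   the rest of the line. *)
exists (fun x => Num.max 1 (r x)); split.
- by move=> x; apply: continuous_max; [exact: cvg_cst|exact: cr].
- by move=> x; rewrite le_max lexx.
- by rewrite max_r ?r1 ?cos0// /r cos0 normr1 h1.
- by move=> x c0; rewrite max_r ?r1// rE.
Unshelve. all: by end_near. Qed.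

Context (q : R -> R) (cq : continuous q) (q1 : forall x, 1 <= q x) (q0 : q 0 = p / 2)
  (qE : forall x, 0 <= cos x -> 1 - pabs p (cos x) = q x * sin x ^+ 2).

(** A profile is sought as z cos(phase), z being its height at the Neumann end and k = (z /
    peak)^(p-2). Conservation of energy then gives the phase the speed sqrt(lam (k q - 1)); [pace]
    is its reciprocal, and integrates to the length travelled. *)
Definition pace k x : R := (Num.sqrt (lam * (k * q x - 1)))^-1.

Lemma pace_arg_gt0 k x : 1 < k -> 0 < lam * (k * q x - 1).
Proof.
move=> k1; rewrite mulr_gt0// subr_gt0 (lt_le_trans k1)// ler_peMr//.
by rewrite ltW// (lt_trans _ k1).
Qed.

Lemma pace_gt0 k x : 1 < k -> 0 < pace k x.
Proof. by move=> k1; rewrite invr_gt0 sqrtr_gt0 pace_arg_gt0. Qed.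

Lemma continuous_pace k : 1 < k -> continuous (pace k).
Proof.
move=> k1 x; apply: cvgV; first by rewrite lt0r_neq0// sqrtr_gt0 pace_arg_gt0.
apply: (@continuous_comp _ _ _ (fun x => lam * (k * q x - 1)) Num.sqrt); last exact: sqrt_continuous.
by apply: cvgMr; apply: cvgB; [apply: cvgMr; exact: cq|exact: cvg_cst].
Qed.

(** As q >= 1, the quotient (k' q - 1) / (k q - 1) lies between 1 and (k' - 1) / (k - 1). These
    bounds are uniform in [x], so they pass to the integral and give its continuity in [k]. *)
Lemma pace_compare k k' x : 1 < k -> k <= k' ->
  pace k' x <= pace k x /\ pace k x <= Num.sqrt ((k' - 1) / (k - 1)) * pace k' x.
Proof.
move=> k1 kk; have k1' := lt_le_trans k1 kk.
have a0 := pace_arg_gt0 x k1; have a0' := pace_arg_gt0 x k1'.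
have d0 : 0 < k - 1 by rewrite subr_gt0. have d0' : 0 < k' - 1 by rewrite subr_gt0.
split.
  rewrite lef_pV2 ?posrE ?sqrtr_gt0// ler_wsqrtr//.
  by rewrite ler_pM2l// lerD2r ler_wpM2r// (le_trans ler01).
rewrite ler_pdivlMr ?sqrtr_gt0// mulrC -ler_pdivlMr ?invr_gt0 ?sqrtr_gt0// invrK.
rewrite -sqrtrM ?divr_ge0 ?(ltW d0) ?(ltW d0')//; apply: ler_wsqrtr.
rewrite mulrAC ler_pdivlMr// mulrAC [leRHS]mulrCA -mulrA ler_pM2l//.
have h := q1 x; rewrite -subr_ge0.
rewrite (_ : _ - _ = (k' - k) * (q x - 1)); last by ring.
by rewrite mulr_ge0 ?subr_ge0.
Qed.

Definition travel_time k t : R := \int[mu]_(x in `[0, t]) pace k x.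

Lemma travel_time_compare k k' t : 1 < k -> k <= k' ->
  travel_time k' t <= travel_time k t /\
  travel_time k t <= Num.sqrt ((k' - 1) / (k - 1)) * travel_time k' t.
Proof.
move=> k1 kk; have k1' := lt_le_trans k1 kk.
have i1 := continuous_integrable 0 t (continuous_pace k1).
have i2 := continuous_integrable 0 t (continuous_pace k1').
have mI : measurable (`[0, t] : set R) by exact: measurable_itv.
split; last rewrite /travel_time -RintegralZl//; apply: le_Rintegral => //.
- by move=> x _; case: (pace_compare x k1 kk).
- exact: summableZ.
- by move=> x _; case: (pace_compare x k1 kk).
Qed.

(** The value of k for which the vertex sits at phase arccos c: solving H(z) = -3 H(z c), the
    relation between the potentials at the two ends, for k. *)
Definition ratio c : R := (1 + 3 * c ^+ 2) / (1 + 3 * c `^ p).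

Lemma ratio_gt1 c : 0 < c -> c < 1 -> 1 < ratio c.
Proof.
move=> c0 c1; have d0 : 0 < 1 + 3 * c `^ p by rewrite ltr_pwDl// mulr_ge0// powR_ge0.
rewrite /ratio ltr_pdivlMr// mul1r ltrD2l ltr_pM2l//.
rewrite -[c]ger0_norm ?(ltW c0)// -/(pabs p c) pabs_sqr// gtr0_norm//.
by rewrite gtr_pMl ?exprn_gt0//; have := ltr_powR2 p2 (ltW c0) ler01; rewrite powR1 c1.
Qed.

Lemma ratio_sub1 c : 0 < c -> ratio c - 1 <= 3 * c ^+ 2.
Proof.
move=> c0; have P := powR_ge0 c p; have d0 : 0 < 1 + 3 * c `^ p by lra.
rewrite /ratio lerBlDr ler_pdivrMr//.
have : 0 <= c ^+ 2 * c `^ p by rewrite mulr_ge0 ?sqr_ge0.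
by lra.
Qed.

Lemma continuous_ratio c : 0 < c -> {for c, continuous ratio}.
Proof.
move=> c0; have d0 : 0 < 1 + 3 * c `^ p by rewrite ltr_pwDl// mulr_ge0// powR_ge0.
have d1 := deriv_add (deriv_const 1 c) (deriv_scale 3 (is_derive1_powR p c0)).
have d2 := deriv_add (deriv_const 1 c) (deriv_scale 3 (deriv_sqr (deriv_id c))).
exact: deriv_continuous (@deriv_div _ (fun c => 1 + 3 * c ^+ 2)
  (fun c => 1 + 3 * c `^ p) _ _ _ (lt0r_neq0 d0) d2 d1).
Qed.

Definition length t : R := travel_time (ratio (cos t)) t.

Let cos_bounds t : 0 < t < pi / 2 -> 0 < cos t < 1.
Proof.
move=> /andP[t0 tP]; have pp := pi_gt0 R; have := pihalf_02 R; move=> /andP[h1 h2].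
rewrite cos_gt0_pihalf/=; last by rewrite tP andbT (lt_trans _ t0)// oppr_lt0.
by rewrite -(@cos0 R) ltr_cos// in_itv/= ?lexx ?(ltW t0) ?(ltW pp)//=; lra.
Qed.

Let ratio_cos t : 0 < t < pi / 2 -> 1 < ratio (cos t).
Proof. by move=> /cos_bounds/andP[]; exact: ratio_gt1. Qed.

(** The parameter k varies with the upper bound. Freezing it at its value for [t] leaves an ordinary
    primitive [T], and [travel_time_compare] squeezes [length] between multiples of [T s - T 0]
    whose factors tend to 1. *)
Lemma continuous_length t : 0 < t < pi / 2 -> {for t, continuous length}.
Proof.
move=> ht; have k1 := ratio_cos ht; set k := ratio (cos t) in k1.
have /andP[c0 c1] := cos_bounds ht.
have [T dT] := antiderivative_exists (continuous_pace k1).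
have TE : \forall s \near t, travel_time k s = T s - T 0.
  near=> s; apply: (Rintegral_FTC _ dT (continuous_pace k1)); apply: ltW.
  by near: s; apply: lt_nbhsr; case/andP: ht.
pose r s := Num.sqrt ((k - 1) / (ratio (cos s) - 1)).
have cR : {for t, continuous (fun s => ratio (cos s))}.
  by apply: (@continuous_comp _ _ _ (@cos R) ratio); [exact: continuous_cos|exact: continuous_ratio].
have d0 : 0 < k - 1 by rewrite subr_gt0.
have rt : r t = 1 by rewrite /r divff ?sqrtr1// lt0r_neq0.
have cr : {for t, continuous r}.
  apply: (@continuous_comp _ _ _ (fun s => (k - 1) / (ratio (cos s) - 1)) Num.sqrt);
    last exact: sqrt_continuous.
  apply: cvgM; first exact: cvg_cst.
  by apply: cvgV; [exact: lt0r_neq0|apply: cvgB; [exact: cR|exact: cvg_cst]].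
have cT : T s - T 0 @[s --> t] --> T t - T 0.
  by apply: cvgB; [exact: deriv_continuous (dT t)|exact: cvg_cst].
have Lt : length t = T t - T 0.
  by apply: (Rintegral_FTC _ dT (continuous_pace k1)); case/andP: ht => /ltW.
have hs : \forall s \near t, 0 < s < pi / 2 by exact: near_in_itvoo.
suff : length s @[s --> t] --> T t - T 0 by rewrite -Lt.
apply: (@squeeze_cvgr _ _ _ _ (fun s => Num.min 1 (r s) * (T s - T 0))
  (fun s => Num.max 1 (r s) * (T s - T 0))).
- near=> s; have k1s : 1 < ratio (cos s) by apply: ratio_cos; near: s.
  have E : travel_time k s = T s - T 0 by near: s.
  have T0 : 0 <= T s - T 0.
    by rewrite -E; apply: Rintegral_ge0 => x _; rewrite ltW// pace_gt0.
  have d0' : 0 < ratio (cos s) - 1 by rewrite subr_gt0.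
  have rE : r s * Num.sqrt ((ratio (cos s) - 1) / (k - 1)) = 1.
    rewrite -sqrtrM ?divr_ge0 ?(ltW d0) ?(ltW d0')// (_ : _ * _ = 1) ?sqrtr1//.
    by field; rewrite !lt0r_neq0.
  have r0 : 0 <= r s := sqrtr_ge0 _.
  have [kk|kk] := leP k (ratio (cos s)).
  + have [h1 h2] := travel_time_compare s k1 kk; rewrite -/(length s) E in h1 h2.
    apply/andP; split.
      apply: (@le_trans _ _ (r s * (T s - T 0))).
        by rewrite ler_wpM2r// ge_min lexx orbT.
      by have := ler_wpM2l r0 h2; rewrite mulrA rE mul1r.
    by apply: le_trans h1 _; rewrite ler_peMl// le_max lexx.
  + have [h1 h2] := travel_time_compare s k1s (ltW kk); rewrite -/(length s) E in h1 h2.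
    apply/andP; split.
      by apply: le_trans h1; rewrite ler_piMl// ge_min lexx.
    apply: le_trans h2 _; rewrite ler_wpM2r// le_max -/(r s) lexx orbT//.
- have h : {for t, continuous ((fun=> 1) \min r)} by apply: continuous_min => //; exact: cvg_cst.
  have {}h : Num.min 1 (r s) @[s --> t] --> Num.min 1 (r t) := h.
  have e : Num.min 1 (r t) = 1 by rewrite rt minxx.
  rewrite e in h.
  by rewrite -[X in _ --> X]mul1r; exact: cvgM.
- have h : {for t, continuous ((fun=> 1) \max r)} by apply: continuous_max => //; exact: cvg_cst.
  have {}h : Num.max 1 (r s) @[s --> t] --> Num.max 1 (r t) := h.
  have e : Num.max 1 (r t) = 1 by rewrite rt maxxx.
  rewrite e in h.
  by rewrite -[X in _ --> X]mul1r; exact: cvgM.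
Unshelve. all: by end_near. Qed.

Lemma length_small e : 0 < e -> exists2 t, 0 < t < pi / 2 & length t <= e.
Proof.
move=> e0; pose m := (1 + p / 2) / 2.
have hp := p2; have m1 : 1 < m by rewrite /m; lra.
have mq : m < q 0 by rewrite q0 /m; lra.
have /cvgrPdist_lt/(_ (q 0 - m)) := cq (x := 0); rewrite subr_gt0 => /(_ mq)[d /= d0 hd].
pose C := (Num.sqrt (lam * (m - 1)))^-1.
have C0 : 0 < C by rewrite invr_gt0 sqrtr_gt0 mulr_gt0// subr_gt0.
pose t := Num.min (2^-1) (Num.min (d / 2) (e / C)).
have t0 : 0 < t by rewrite !lt_min divr_gt0// divr_gt0// invr_gt0 ltr0n.
have tP : t < pi / 2.
  apply: (@le_lt_trans _ _ 2^-1); first by rewrite ge_min lexx.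
  by apply: lt_le_trans (pihalf_ge1 R); lra.
have td : t < d.
  apply: (@le_lt_trans _ _ (d / 2)); first by rewrite !ge_min lexx !orbT.
  by lra.
have tC : t <= e / C by rewrite !ge_min lexx !orbT.
have ht : 0 < t < pi / 2 by rewrite t0.
exists t => //; have k1 := ratio_cos ht.
apply: (@le_trans _ _ (C * (t - 0))); last by rewrite subr0 mulrC -ler_pdivlMr.
rewrite -(Rintegral_itv_cst C (ltW t0)); apply: le_Rintegral.
- exact: measurable_itv.
- exact: continuous_integrable (continuous_pace k1).
- by apply: continuous_integrable => x; exact: cvg_cst.
- move=> x /=; rewrite in_itv/= => /andP[x0 xt].
  have /hd : `|0 - x| < d by rewrite sub0r normrN ger0_norm// (le_lt_trans xt).
  rewrite ltr_norml => /andP[_ h].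
  have qm : m < q x by lra.
  rewrite lef_pV2 ?posrE ?sqrtr_gt0 ?pace_arg_gt0// ?mulr_gt0 ?subr_gt0//.
  rewrite ler_wsqrtr// ler_pM2l// lerD2r (le_trans (ltW qm))// ler_peMl ?(ltW k1)//.
  by rewrite (le_trans ler01).
Qed.

(** Near pi/2 both q and k approach 1 and the pace blows up. Precisely, (k q - 1) sin^2 <= 4 cos^2
    on [0, t], so [pace] dominates the derivative of -ln(cos) / (2 sqrt(lam)). Taking cos t = exp(-2
    sqrt(lam) e) makes the increment of that function equal to [e]. *)
Lemma length_large e : 0 < e -> exists2 t, 0 < t < pi / 2 & e <= length t.
Proof.
move=> e0; pose s := Num.sqrt lam; have s0 : 0 < s by rewrite sqrtr_gt0.
pose c := expR (- (2 * s * e)).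
have c0 : 0 < c := expR_gt0 _.
have c1 : c < 1 by rewrite expR_lt1 oppr_lt0 !mulr_gt0.
have /andP[P0 P2] := pihalf_02 R.
have [|t /andP[t0 tP] ct] := intermediate_value (f := @cos R) (v := c) (ltW P0)
    (fun x _ => @continuous_cos R x).
  by rewrite cos0 cos_pihalf ge_min le_max (ltW c0) (ltW c1) orbT.
have ht : 0 < t < pi / 2.
  rewrite !lt_neqAle t0 tP !andbT; apply/andP; split; apply/eqP => h.
  - by move: c1; rewrite -ct -h cos0 ltxx.
  - by move: c0; rewrite -ct h cos_pihalf ltxx.
exists t => //; have k1 := ratio_cos ht; rewrite /length ct in k1 *.
have [T dT] := antiderivative_exists (continuous_pace k1).
rewrite /travel_time (Rintegral_FTC t0 dT (continuous_pace k1)).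
pose F x : R := (- (2 * s))^-1 * ln (cos x).
have cos_ge x : 0 <= x <= t -> c <= cos x.
  move=> /andP[x0]; rewrite le_eqVlt => /predU1P[->|xt]; first by rewrite ct.
  by rewrite -ct ltW//; apply: cos_decr_pihalf.
have dF (x : R) : 0 <= x <= t -> is_derive x 1 F ((- (2 * s))^-1 * ((cos x)^-1 * - sin x)).
  move=> hx; have cx := lt_le_trans c0 (cos_ge x hx).
  exact: deriv_scale (@deriv_comp _ (@ln R) (@cos R) _ _ _ (is_derive1_ln cx) (is_derive_cos x)).
have sub x : 0 < x < t -> 0 <= x <= t by move=> /andP[/ltW-> /ltW->].
have FE : F t - F 0 = e.
  rewrite /F ct cos0 ln1 mulr0 subr0 expRK; field; exact: lt0r_neq0.
rewrite -FE; suff : T 0 - F 0 <= T t - F t by lra.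
have dd (x : R) (hx : 0 <= x <= t) := deriv_sub (dT x) (dF x hx).
apply: (deriv_ge0_le t0 (fun x hx => deriv_continuous (dd x hx))
  (fun x hx => dd x (sub x hx))) => x /sub hx.
have cx := lt_le_trans c0 (cos_ge x hx); have ccx := cos_ge x hx.
have /andP[x0 xt] := hx.
have sx : 0 <= sin x.
  by apply: sin_ge0_pi; rewrite x0 (le_trans (le_trans xt tP))//; have := pi_gt0 R; lra.
rewrite subr_ge0 (_ : _ * _ = (2 * s * cos x)^-1 * sin x); last first.
  by field; rewrite !lt0r_neq0.
rewrite /pace -ler_pdivlMl ?invr_gt0 ?mulr_gt0// invrK.
rewrite ler_pdivlMr ?sqrtr_gt0 ?pace_arg_gt0//.
have A0 := pace_arg_gt0 x k1.
rewrite -(@ler_pXn2r _ 2)// ?nnegrE ?mulr_ge0 ?sqrtr_ge0 ?(ltW s0) ?(ltW cx)//.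
rewrite !exprMn !sqr_sqrtr ?(ltW A0) ?(ltW lam0)//.
rewrite mulrCA [2 ^+ 2 * lam]mulrC -[leRHS]mulrA ler_pM2l//.
have qE' := qE (ltW cx); have := ratio_sub1 c0; have := sin2cos2 x.
have Pp := pabs_ge0 p (cos x).
have cc : c ^+ 2 <= cos x ^+ 2 by rewrite lerXn2r ?nnegrE ?(ltW c0) ?(ltW cx).
have h1 : ratio c * (q x * sin x ^+ 2) <= ratio c.
  by rewrite -qE' ler_piMr ?(le_trans ler01 (ltW k1))// gerBl.
move=> s2; rewrite (_ : _ * (_ - 1) = ratio c * (q x * sin x ^+ 2) - sin x ^+ 2); last by ring.
move: {qE' A0} (ratio c * (q x * sin x ^+ 2)) h1 => A h1; rewrite s2.
by move: h1 cc; move: (ratio c) (cos x ^+ 2) (c ^+ 2) => r y d; lra.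
Qed.

Lemma length_exists e : 0 < e -> exists2 t, 0 < t < pi / 2 & length t = e.
Proof.
move=> e0; have [t0 /andP[a0 aP] ta] := length_small e0.
have [t1 /andP[b0 bP] tb] := length_large e0.
have [h|/ltW h] := leP t0 t1.
- have sub t : t0 <= t <= t1 -> 0 < t < pi / 2.
    by move=> /andP[h1 h2]; rewrite (lt_le_trans a0)// (le_lt_trans h2).
  have [|t /sub ht lt] := intermediate_value (v := e) h
    (fun t ht => continuous_length (sub t ht)); last by exists t.
  by move: (length t0) (length t1) ta tb => u v ta tb; rewrite ge_min le_max ta tb orbT.
- have sub t : t1 <= t <= t0 -> 0 < t < pi / 2.
    by move=> /andP[h1 h2]; rewrite (lt_le_trans b0)// (le_lt_trans h2).
  have [|t /sub ht lt] := intermediate_value (v := e) h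
    (fun t ht => continuous_length (sub t ht)); last by exists t.
  by move: (length t0) (length t1) ta tb => u v ta tb; rewrite ge_min le_max ta tb orbT.
Qed.

End Time_map.

(** * Construction of the profile on the terminal edge *)

Section Profile_existence.
Context {R : realType}.
Local Notation mu := (@lebesgue_measure R).
Implicit Types (p lam ell x y : R) (f g : R -> R).

(** The inverse of the travel time is differentiable only inside the edge. Integrating the force
    twice supplies two-sided derivatives at the ends as well. *)
Lemma ode_solution_of_interior p lam ell f g : 2 < p -> 0 < ell ->
  continuous f -> continuous g ->
  (forall x : R, 0 < x < ell -> is_derive x 1 f (g x)) ->
  (forall x : R, 0 < x < ell -> is_derive x 1 g (force p lam (f x))) ->
  exists F G, ode_solution p lam (terminal_edge ell) F G /\
    (forall x, 0 <= x <= ell -> F x = f x /\ G x = g x).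
Proof.
move=> p2 ell0 cf cg fg gF.
have [A dA] : exists A : R -> R, forall x : R, is_derive x 1 A (force p lam (f x)).
  apply: antiderivative_exists => x.
  by apply: (@continuous_comp _ _ _ f (force p lam)); [exact: cf|exact: continuous_force].
pose G x := A x + (g 0 - A 0).
have dG (x : R) : is_derive x 1 G (force p lam (f x)).
  by have := deriv_add (dA x) (deriv_const (g 0 - A 0) x); rewrite addr0.
have cG : continuous G by move=> x; exact: deriv_continuous (dG x).
have [B dB] := antiderivative_exists cG.
pose F x := B x + (f 0 - B 0).
have dF (x : R) : is_derive x 1 F (G x).
  by have := deriv_add (dB x) (deriv_const (f 0 - B 0) x); rewrite addr0.
have cF : continuous F by move=> x; exact: deriv_continuous (dF x).
have sub x t : 0 <= x <= ell -> 0 < t < x -> 0 < t < ell.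
  by move=> /andP[_ xl] /andP[-> tx]; exact: lt_le_trans xl.
have cGg : continuous (fun t => G t - g t).
  by move=> t; apply: cvgB; [exact: cG|exact: cg].
have cFf : continuous (fun t => F t - f t).
  by move=> t; apply: cvgB; [exact: cF|exact: cf].
have Gg x : 0 <= x <= ell -> G x = g x.
  move=> hx; have /andP[x0 _] := hx.
  have := @deriv_eq0_cst _ (fun t => G t - g t)
    (fun t => force p lam (f t) - force p lam (f t)) 0 x x0
    (fun t _ => cGg t) (fun t ht => deriv_sub (dG t) (gF t (sub x t hx ht)))
    (fun t _ => subrr _).
  by rewrite /G; lra.
have Ff x : 0 <= x <= ell -> F x = f x.
  move=> hx; have /andP[x0 _] := hx.
  have z t : 0 < t < x -> G t - g t = 0.
    by move=> /(sub x t hx)/andP[t0 tl]; rewrite Gg ?subrr// !ltW.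
  have := @deriv_eq0_cst _ (fun t => F t - f t) (fun t => G t - g t) 0 x x0
    (fun t _ => cFf t) (fun t ht => deriv_sub (dF t) (fg t (sub x t hx ht))) z.
  by rewrite /F; lra.
exists F, G; split=> [|x hx]; last by rewrite Ff// Gg.
by split=> // x; rewrite terminal_edgeE => hx; rewrite Ff.
Qed.

(** The phase [phi] inverts the travel time, which is counted from the Neumann end where the phase
    is 0; hence the reflection [ell - x]. The choice of k by [ratio] makes the potentials of the two
    ends satisfy the Kirchhoff relation. *)
Lemma profile_exists p lam ell : 2 < p -> 0 < lam -> 0 < ell ->
  exists f g, edge_profile p lam ell f g.
Proof.
move=> p2 lam0 ell0; have p0 : 0 < p by lra. have n0 : 0 < p - 2 by lra.
have [q [cq q1 q0 qE]] := quotient_exists p2.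
have [t ht lt] := length_exists p2 lam0 cq q1 q0 qE ell0.
have /andP[t0 tP] := ht; have pp := pi_gt0 R.
have c0 : 0 < cos t.
  by rewrite cos_gt0_pihalf// tP andbT (lt_trans _ t0)// oppr_lt0 divr_gt0.
have c1 : cos t < 1 by rewrite -(@cos0 R); apply: cos_decr_pihalf => //; exact: ltW.
have k1 := ratio_gt1 p2 c0 c1; set k := ratio p (cos t) in k1.
have [T0 dT0] := antiderivative_exists (continuous_pace lam0 cq q1 k1).
pose T x := T0 x - T0 0.
have dT (x : R) : is_derive x 1 T (pace lam q k x).
  by have := deriv_sub (dT0 x) (deriv_const (T0 0) x); rewrite subr0.
have Tt : T t = ell.
  rewrite -lt /length /travel_time.
  by rewrite (Rintegral_FTC (ltW t0) dT0 (continuous_pace lam0 cq q1 k1)).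
have T00 : T 0 = 0 by rewrite /T subrr.
have [phi [cphi phi_itv phiK Kphi dphi]] := inverse_exists t0
  (fun x _ => deriv_continuous (dT x)) (fun x _ => dT x)
  (fun x _ => pace_gt0 lam0 q1 x k1).
rewrite Tt T00 in Kphi dphi.
pose V x := Num.sqrt (lam * (k * q x - 1)).
have V0 x : 0 < V x by rewrite sqrtr_gt0 pace_arg_gt0.
have V2 x : V x ^+ 2 = lam * (k * q x - 1).
  by rewrite sqr_sqrtr// ltW// pace_arg_gt0.
have cV : continuous V.
  move=> x; apply: (@continuous_comp _ _ _ (fun x => lam * (k * q x - 1)) Num.sqrt);
    last exact: sqrt_continuous.
  by apply: cvgMr; apply: cvgB; [apply: cvgMr; exact: cq|exact: cvg_cst].
(* The height at the Neumann end, chosen so that z^(p-2) = k peak^(p-2). *)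
pose z := (k * (p * lam / 2)) `^ (p - 2)^-1.
have a0 : 0 < p * lam / 2 by rewrite divr_gt0// mulr_gt0.
have k0 : 0 < k by exact: lt_trans k1.
have z0 : 0 < z by rewrite powR_gt0// mulr_gt0.
have zn : z `^ (p - 2) = k * (p * lam / 2).
  by rewrite /z -powRrM mulVf ?gt_eqF// powRr1// ltW// mulr_gt0.
pose f x := z * cos (phi (ell - x)).
pose g x := z * (sin (phi (ell - x)) * V (phi (ell - x))).
have crefl : continuous (fun x => phi (ell - x)).
  move=> x; apply: (@continuous_comp _ _ _ (fun x => ell - x) phi); last exact: cphi.
  by apply: cvgB; [exact: cvg_cst|exact: cvg_id].
have cf : continuous f.
  move=> x; apply: cvgMr; apply: (@continuous_comp _ _ _ (fun x => phi (ell - x)) (@cos R));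
    [exact: crefl|exact: continuous_cos].
have cg : continuous g.
  move=> x; apply: cvgMr; apply: cvgM.
    by apply: (@continuous_comp _ _ _ (fun x => phi (ell - x)) (@sin R));
      [exact: crefl|exact: continuous_sin].
  by apply: (@continuous_comp _ _ _ (fun x => phi (ell - x)) V); [exact: crefl|exact: cV].
have cos_phi x : 0 <= cos (phi x).
  have /andP[h1 h2] := phi_itv x; apply: cos_ge0_pihalf.
  by rewrite (le_trans h2 (ltW tP)) andbT (le_trans _ h1)// oppr_le0 divr_ge0// ltW.
have potE y : 0 <= y -> potential p lam (z * y)
    = z ^+ 2 * (lam / 2 * (y ^+ 2 - k * pabs p y)).
  move=> y0; rewrite /potential pabsM ?(ltW z0)//.
  have -> : z `^ p = z `^ (p - 2) * z ^+ 2.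
    by have := pabs_sqr p2 z; rewrite /pabs gtr0_norm.
  by rewrite zn; field; exact: lt0r_neq0.
have pabs1 : pabs p (1 : R) = 1 by rewrite pabs_ge0E// powR1.
have potz : potential p lam z = z ^+ 2 * (lam / 2 * (1 - k)).
  by rewrite -[X in potential p lam X]mulr1 potE// pabs1 expr1n mulr1.
have g2 x : g x ^+ 2 = 2 * (potential p lam (f x) - potential p lam z).
  rewrite /g /f potE ?cos_phi// potz !exprMn V2.
  have := qE _ (cos_phi (ell - x)); have := sin2cos2 (phi (ell - x)).
  move: (pabs _ _) (q _) (sin _ ^+ 2) (cos _ ^+ 2) => P Q S C ->.
  move=> h; rewrite (_ : P = 1 - Q * (1 - C)); first by field.
  by rewrite -h; ring.
have sin_pos x : 0 <= x < ell -> 0 < sin (phi (ell - x)).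
  move=> /andP[x0 xl]; have /andP[h1 h2] := phi_itv (ell - x).
  apply: sin_gt0_pi; apply/andP; split; last by move: h2 tP pp; lra.
  rewrite lt_neqAle h1 andbT; apply/eqP => e.
  have := Kphi (ell - x); rewrite -e T00 => /(_ _)/esym h.
  have : ell - x = 0 by apply: h; rewrite subr_ge0 (ltW xl) gerBl x0.
  by move: xl; lra.
have gpos x : 0 <= x < ell -> 0 < g x by move=> hx; rewrite mulr_gt0// mulr_gt0// sin_pos.
have inn x : 0 < x < ell -> 0 <= x < ell by move=> /andP[/ltW-> ->].
have dfg (x : R) : 0 < x < ell -> is_derive x 1 f (g x).
  move=> /andP[x0 xl]; have hy : 0 < ell - x < ell by rewrite subr_gt0 xl gtrBl.
  have d1 := deriv_reflect (dphi _ hy).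
  have := deriv_scale z (@deriv_comp _ (@cos R) (fun x => phi (ell - x)) _ _ _ (is_derive_cos _) d1).
  by move/is_derive_eq; apply; rewrite /g /pace invrK mulrNN.
have dgF (x : R) : 0 < x < ell -> is_derive x 1 g (force p lam (f x)).
  move=> hx; have gx := gpos x (inn x hx).
  (* Only continuity of [q] is available, so the formula for [g] is not differentiated; the second
     derivative comes from [g = Num.sqrt E]. *)
  pose E y := 2 * (potential p lam (f y) - potential p lam z).
  have Ex : 0 < E x by rewrite /E -g2 exprn_gt0.
  have dE : is_derive x 1 E (2 * (force p lam (f x) * g x)).
    have := deriv_scale 2 (deriv_sub (@deriv_comp _ (potential p lam) f _ _ _
      (deriv_potential lam (f x) p2) (dfg x hx)) (deriv_const (potential p lam z) x)).
    by rewrite subr0.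
  have := deriv_sqrt Ex dE; have -> : Num.sqrt (E x) = g x.
    by rewrite /E -g2 sqrtr_sqr gtr0_norm.
  rewrite -mulf_div mulfK ?lt0r_neq0// divff ?pnatr_eq0// mul1r.
  apply: near_eq_deriv; near=> y; rewrite /E -g2 sqrtr_sqr gtr0_norm//.
  by apply/gpos/inn; near: y; exact: near_in_itvoo.
have [F [G [ode FG]]] := ode_solution_of_interior p2 ell0 cf cg dfg dgF.
have h0 : (0 : R) <= 0 <= ell by rewrite lexx ltW.
have hl : 0 <= ell <= ell by rewrite lexx ltW.
have f0 : f 0 = z * cos t by rewrite /f subr0 -Tt phiK// lexx ltW.
have potf0 : potential p lam z = - 3 * potential p lam (f 0).
  rewrite f0 potE ?(ltW c0)// potz /k /ratio.
  have d0 : 0 < 1 + 3 * cos t `^ p by rewrite ltr_pwDl// mulr_ge0// powR_ge0.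
  rewrite pabs_ge0E ?(ltW c0)//; move: (cos t `^ p) d0 => P d0.
  by field; exact: lt0r_neq0.
have Hf0 : 0 < potential p lam (f 0).
  have : potential p lam z < 0.
    rewrite potz pmulr_rlt0 ?exprn_gt0// pmulr_rlt0 ?divr_gt0// subr_lt0.
    exact: k1.
  by rewrite potf0; lra.
exists F, G; split => //.
- rewrite (FG 0 h0).1; apply/andP; split; first by rewrite f0 mulr_gt0.
  rewrite ltNge; apply/negP; rewrite le_eqVlt => /predU1P[e|h].
    by move: Hf0; rewrite -e potential_peak// ltxx.
  by have := potential_lt0 p2 lam0 h; rewrite ltNge (ltW Hf0).
- rewrite (FG 0 h0).1 (FG 0 h0).2.
  have g00 : 0 <= g 0 by apply/ltW/gpos; rewrite lexx.
  apply/eqP; rewrite -(@eqrXn2 _ 2)// ?mulr_ge0 ?speed_ge0//.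
  by rewrite g2 potf0 exprMn speed_sqr ?(ltW Hf0)//; apply/eqP; ring.
- by rewrite (FG ell hl).2 /g subrr -T00 phiK ?sin0 ?mul0r ?mulr0// lexx ltW.
- move=> x hx; have hx' : 0 <= x <= ell by case/andP: hx => -> /ltW.
  by rewrite (FG x hx').2 gpos.
Unshelve. all: by end_near. Qed.

End Profile_existence.

(** * The decreasing soliton tail on a half-line *)

Section Tail_existence.
Context {R : realType}.
Local Notation mu := (@lebesgue_measure R).
Implicit Types (p lam a r x y : R) (f g : R -> R).

Lemma summable_exp r : 0 < r -> summable (@half_line R) (fun x => expR (- r * x)).
Proof.
move=> r0; have mI : measurable (@half_line R) by exact: measurable_itv.
have h : summable (@half_line R) (exponential_pdf r).
  by apply: (@summable_sub _ setT) => //; exact: integrable_exponential_pdf.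
apply: (@summable_eq _ _ (fun x => r^-1 * exponential_pdf r x)) => //.
  move=> x; rewrite inE half_lineE => x0.
  by rewrite exponential_pdfE// mulKf// gt_eqF.
exact: summableZ.
Qed.

(** The explicit sech soliton: for s = 2 / (p - 2) the function w = f^(-1/s) satisfies the linear
    equation w'' = k^2 w with k = sqrt(lam) / s, so f is the power -s of a positive combination of
    two exponentials. *)
Lemma tail_exists p lam a : 2 < p -> 0 < lam -> 0 < a < peak p lam ->
  exists f g, [/\ ode_solution p lam (@half_line R) f g, H1 (@half_line R) f,
    f 0 = a & g 0 = - speed p lam a].
Proof.
move=> p2 lam0 /andP[a0 aM]; have p0 : 0 < p by lra. have n0 : 0 < p - 2 by lra.
pose s := 2 / (p - 2); pose l := Num.sqrt lam; pose k := l / s.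
have s0 : 0 < s by rewrite divr_gt0. have l0 : 0 < l by rewrite sqrtr_gt0.
have k0 : 0 < k by rewrite divr_gt0.
have l2 : l ^+ 2 = lam by rewrite sqr_sqrtr// ltW.
pose w0 := a `^ (- s^-1); have w00 : 0 < w0 by rewrite powR_gt0.
have w02 : w0 ^+ 2 = (a `^ (p - 2))^-1.
  rewrite -powR_mulrn ?ltW// /w0 -powRrM -powRN; congr (_ `^ _); rewrite /s.
  by field; rewrite lt0r_neq0.
have an0 : 0 < a `^ (p - 2) by rewrite powR_gt0.
have anM : a `^ (p - 2) < p * lam / 2.
  by rewrite -(peak_pow p2 lam0) ltr_powR2// ltW// peak_gt0.
have disc : 0 < w0 ^+ 2 - 2 / (p * lam).
  rewrite w02 subr_gt0 (_ : 2 / (p * lam) = (p * lam / 2)^-1); last by rewrite invf_div.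
  by rewrite ltf_pV2 ?posrE// divr_gt0// mulr_gt0.
pose D := Num.sqrt (w0 ^+ 2 - 2 / (p * lam)).
have D0 : 0 < D by rewrite sqrtr_gt0.
have D2 : D ^+ 2 = w0 ^+ 2 - 2 / (p * lam) by rewrite sqr_sqrtr// ltW.
have Dw : D < w0.
  by rewrite -(@ltr_pXn2r _ 2)// ?nnegrE ?(ltW w00) ?(ltW D0)// D2 gtrBl divr_gt0// mulr_gt0.
(* Zero energy prescribes A B and the initial value prescribes A + B, so they are the roots of a
   quadratic, whose discriminant is positive because [a] is below the peak. The larger root
   multiplies the growing exponential, which makes the slope at 0 nonpositive. *)
have [A [B [A0 B0 AB AB1 AB2]]] : exists A B : R,
    [/\ 0 < A, 0 < B, 4 * (A * B) = 2 / (p * lam), A + B = w0 & 0 <= A - B].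
  exists ((w0 + D) / 2), ((w0 - D) / 2); split; lra.
pose w x := A * expR (k * x) + B * expR (- k * x).
pose dw x := k * (A * expR (k * x) - B * expR (- k * x)).
have wpos x : 0 < w x by rewrite addr_gt0// mulr_gt0// expR_gt0.
have dwd (x : R) : is_derive x 1 w (dw x).
  have := deriv_add (deriv_scale A (deriv_exp k x)) (deriv_scale B (deriv_exp (- k) x)).
  by move/is_derive_eq; apply; rewrite /dw; ring.
have ddwd (x : R) : is_derive x 1 dw (k ^+ 2 * w x).
  have := deriv_scale k (deriv_sub (deriv_scale A (deriv_exp k x))
    (deriv_scale B (deriv_exp (- k) x))).
  by move/is_derive_eq; apply; rewrite /w; ring.
have dw2 x : dw x ^+ 2 = k ^+ 2 * (w x ^+ 2 - 2 / (p * lam)).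
  have e1 : expR (k * x) * expR (- k * x) = 1 by rewrite mulNr expRxMexpNx_1.
  rewrite -AB /dw /w; move: (expR (k * x)) (expR (- k * x)) e1 => u v e1.
  by rewrite exprMn (_ : 4 * (A * B) = 4 * (A * B) * (u * v)); [ring|rewrite e1 mulr1].
pose f x := w x `^ (- s); pose g x := - s * (f x * dw x / w x).
have f0 x : 0 < f x by rewrite powR_gt0.
have fd (x : R) : is_derive x 1 f (g x).
  have := @deriv_comp _ (fun y => y `^ (- s)) w _ _ _ (is_derive1_powR (- s) (wpos x)) (dwd x).
  move/is_derive_eq; apply; rewrite powR_pred// -/(f x) /g.
  by field; exact: lt0r_neq0.
have fn x : f x `^ (p - 2) = (w x ^+ 2)^-1.
  rewrite /f -powRrM -powR_mulrn ?(ltW (wpos x))// -powRN; congr (_ `^ _).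
  by rewrite /s; field; exact: lt0r_neq0.
have gd (x : R) : is_derive x 1 g (force p lam (f x)).
  have := deriv_scale (- s) (@deriv_div _ (fun x => f x * dw x) w _ _ _
    (lt0r_neq0 (wpos x)) (deriv_mul (fd x) (ddwd x)) (dwd x)).
  move/is_derive_eq; apply; rewrite force_ge0E ?(ltW (f0 x))// fn.
  have := wpos x; have := dw2 x; rewrite /g; move: (dw x) (w x) (f x) => d v y d2 v0.
  have kE : k ^+ 2 = lam / s ^+ 2 by rewrite /k -l2 expr_div_n.
  rewrite [LHS](_ : _ = s * (s + 1) * y * d ^+ 2 / v ^+ 2 - s * k ^+ 2 * y); last first.
    by field; exact: lt0r_neq0.
  rewrite d2 kE /s; field; rewrite !lt0r_neq0//.
have fE0 : f 0 = a.
  rewrite /f /w !mulr0 expR0 !mulr1 AB1.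
  by rewrite /w0 -powRrM (_ : - s^-1 * - s = 1) ?powRr1 ?ltW//; field; exact: lt0r_neq0.
have ode : ode_solution p lam (@half_line R) f g.
  by split=> // x; exact: deriv_continuous (gd x).
have eH := edge_interval_half_line (R := R).
have mI : measurable (@half_line R) by exact: measurable_itv.
have cf : continuous f by move=> x; exact: deriv_continuous (fd x).
have cg : continuous g by move=> x; exact: deriv_continuous (gd x).
have mcont (h : R -> R) : continuous h -> measurable_fun (@half_line R) h.
  by move=> ch; apply: measurable_funTS; exact: continuous_measurable_fun.
have g2 x : g x ^+ 2 = f x ^+ 2 * (lam - 2 / p * f x `^ (p - 2)).
  have kE : k ^+ 2 = lam / s ^+ 2 by rewrite /k -l2 expr_div_n.
  rewrite (_ : g x ^+ 2 = s ^+ 2 * (f x ^+ 2 * dw x ^+ 2 / w x ^+ 2)); last first.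
    by rewrite /g; field; exact: lt0r_neq0.
  rewrite fn dw2 kE.
  by have := wpos x; move: (w x) (f x) => v y v0; field; rewrite !lt0r_neq0.
have f2s : summable (@half_line R) (fun x => f x ^+ 2).
  have l20 : 0 < 2 * l by rewrite mulr_gt0.
  apply: (@summable_le _ _ _ (fun x => (A `^ (- s)) ^+ 2 * expR (- (2 * l) * x))) => //.
  - by apply: mcont; exact: continuous_sqr.
  - move=> x _; rewrite ger0_norm ?sqr_ge0//.
    have -> : expR (- (2 * l) * x) = expR (- l * x) ^+ 2.
      by rewrite -expRM_natl; congr expR; ring.
    rewrite -exprMn lerXn2r ?nnegrE ?mulr_ge0 ?powR_ge0 ?expR_ge0//.
    rewrite /f !powRN.
    have -> : expR (- l * x) = (expR (k * x) `^ s)^-1.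
      rewrite -powRN -expRM; congr expR; rewrite /k; field; exact: lt0r_neq0.
    rewrite -invfM -powRM ?(ltW A0) ?expR_ge0//.
    rewrite lef_pV2 ?posrE ?powR_gt0// ?mulr_gt0 ?expR_gt0//.
    apply: ge0_ler_powR; rewrite ?nnegrE ?(ltW s0) ?(ltW (wpos x)) ?mulr_ge0 ?expR_ge0 ?(ltW A0)//.
    by rewrite lerDl mulr_ge0 ?expR_ge0// ltW.
  - exact: summableZ (summable_exp l20).
have fL2 : L2 (@half_line R) f by apply/L2P => //; split=> //; exact: mcont.
have gL2 : L2 (@half_line R) g.
  apply/L2P => //; split; first exact: mcont.
  apply: (@summable_le _ _ _ (fun x => lam * f x ^+ 2)) => //.
  - by apply: mcont; exact: continuous_sqr.
  - move=> x _; rewrite ger0_norm ?sqr_ge0// g2 mulrC ler_wpM2r ?sqr_ge0// gerBl.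
    by rewrite mulr_ge0 ?powR_ge0// divr_ge0// ltW.
  - exact: summableZ.
exists f, g; split => //; first exact: classical_H1 eH fL2 gL2 fd cg.
have g0 : g 0 <= 0.
  rewrite /g mulNr oppr_le0 mulr_ge0 ?(ltW s0)// divr_ge0 ?(ltW (wpos 0))//.
  rewrite mulr_ge0 ?(ltW (f0 0))// /dw !mulr0 expR0 !mulr1 mulr_ge0 ?(ltW k0)//.
apply/eqP; rewrite -eqr_oppLR; apply/eqP.
have : (- g 0) ^+ 2 = speed p lam a ^+ 2.
  rewrite sqrrN g2 fE0 speed_sqr; last by rewrite ltW// potential_gt0.
  by rewrite potential_ge0E ?(ltW a0)//; field; exact: lt0r_neq0.
move/eqP; rewrite eqrXn2 ?oppr_ge0 ?speed_ge0// => /eqP//.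
Qed.

End Tail_existence.

(** * Existence and uniqueness of the action ground state *)

Section Ground_states.
Context {R : realType}.
Implicit Types (p lam ell nu : R) (u v : gfun R).

Lemma branch_A_exists p lam ell : 2 < p -> 0 < lam -> 0 < ell ->
  exists u f g f3 g3, solution ell p lam u /\ branch_A p lam ell u f g f g f3 g3.
Proof.
move=> p2 lam0 ell0; have [f3 [g3 P]] := profile_exists p2 lam0 ell0.
have [f [g [ode fH f0 g0]]] := tail_exists p2 lam0 (profile_start P).
have eE := edge_interval_terminal_edge ell0.
have [df3 cg3 _] := profile_ode P.
have f3H : H1 (terminal_edge ell) f3.
  apply: (classical_H1 eE _ _ df3 cg3); apply: continuous_L2_itv => //.
  exact: ode_continuous (profile_ode P).
have kir : g 0 + g 0 + g3 0 = 0 by rewrite g0 (profile_slope P); ring.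
exists (GFun f f f3), f, g, f3, g3; split; last first.
  by split=> //; split=> //; [exact: profile_ode P|exact: profile_end P].
split; first by split => //=; rewrite f0.
exists (GFun g g g3); split => //; last exact: profile_end P.
- exact: solves_on_of_ode ode _.
- exact: solves_on_of_ode ode _.
- exact: solves_on_of_ode (profile_ode P) _.
Qed.

Lemma eq_on_graph_gintegral ell u v F : eq_on_graph ell u v ->
  gintegral ell F u = gintegral ell F v.
Proof.
move=> [h1 h2 h3]; rewrite /gintegral; congr (_ + _ + _);
  apply: eq_Rintegral => x hx; congr F; [exact: h1|exact: h2|exact: h3].
Qed.

Lemma positive_not_zero ell u : positive_on_graph ell u ->
  ~ eq_on_graph ell u (gzero R).
Proof.
move=> [u0 _ _] [h _ _]; have h0 : half_line (0 : R) by rewrite half_lineE.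
by have := u0 0 h0; rewrite h ?inE//= ltxx.
Qed.

Lemma least_actionP ell p lam u : solution ell p lam u -> positive_on_graph ell u ->
  (forall v, solution ell p lam v -> ~ eq_on_graph ell v (gzero R) ->
     action ell p lam u <= action ell p lam v) ->
  action_ground_state ell p lam u.
Proof.
move=> usol upos umin; split => //; apply: le_anti; apply/andP; split.
- by apply: le_ereal_inf_tmp => _ [v [vsol vn0] <-]; rewrite lee_fin umin.
- by apply: ereal_inf_lbound; exists u => //; split => //; exact: positive_not_zero.
Qed.

Lemma action_ground_state_exists p lam ell : 2 < p -> 0 < lam -> 0 < ell ->
  exists u, [/\ action_ground_state ell p lam u, type_A ell p lam u
    & forall v, action_ground_state ell p lam v -> eq_on_graph ell v u].
Proof.
move=> p2 lam0 ell0.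
have [u [f [g [f3 [g3 [usol A]]]]]] := branch_A_exists p2 lam0 ell0.
have [P dP] := antiderivative_exists (@continuous_speed _ p lam p2).
pose Phi y := P y - P 0; have Phi0 : Phi 0 = 0 by rewrite /Phi subrr.
have dPhi (y : R) : is_derive y 1 Phi (speed p lam y).
  by have := deriv_sub (dP y) (deriv_const (P 0) y); rewrite subr0.
have uA := branch_A_type_A p2 lam0 ell0 usol A; have [_ upos _ _] := uA.
have ult := branch_A_action_lt p2 lam0 ell0 dPhi Phi0 A.
have actE w q1 r1 q2 r2 q3 r3 : branch_A p lam ell w q1 r1 q2 r2 q3 r3 ->
    eq_on_graph ell w u /\ action ell p lam w = action ell p lam u.
  move=> B; have e := branch_A_unique p2 lam0 ell0 B A; split; first exact: e.
  rewrite (split_action p2 ell0 (branch_split A)) (split_action p2 ell0 (branch_split B)).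
  by rewrite (eq_on_graph_gintegral _ e).
have ugs : action_ground_state ell p lam u.
  apply: (least_actionP usol upos) => v vsol vn0.
  have [h|[s [q1 [r1 [q2 [r2 [q3 [r3 [_ e B]]]]]]]]] :=
    solution_classification p2 lam0 ell0 dPhi Phi0 vsol vn0.
    exact: ltW (lt_le_trans ult h).
  by rewrite -e (actE _ _ _ _ _ _ _ B).2.
exists u; split => // v [vsol vpos vact].
have vu : action ell p lam v = action ell p lam u.
  by apply: EFin_inj; case: ugs => _ _ ->; exact: vact.
have [h|[s [q1 [r1 [q2 [r2 [q3 [r3 [s1 _ B]]]]]]]]] :=
  solution_classification p2 lam0 ell0 dPhi Phi0 vsol (positive_not_zero vpos).
  by move: ult; rewrite -vu ltNge h.
(* The sign -1 is impossible: it would give [v] and [u] opposite values at the vertex, where both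
   are positive. *)
have [e _] := actE _ _ _ _ _ _ _ B; case: s1 e B => -> e B; first by rewrite gscale1 in e.
have h0 : half_line (0 : R) by rewrite half_lineE.
have [e1' _ _] := e; have [v0 _ _] := vpos; have [u0 _ _] := upos.
have e0 : - e1 v 0 = e1 u 0 by rewrite -mulN1r; apply: e1'; rewrite inE.
have := u0 0 h0; rewrite -e0 oppr_gt0 => v0'.
by exfalso; exact: (lt_nsym v0' (v0 0 h0)).
Qed.

End Ground_states.

Theorem theorem1p3 (R : realType) (p : R) (hp : 2 < p)
    (ell : R) (hell : 0 < ell) :
  (forall lam : R, 0 < lam ->
     exists u : gfun R,
       [/\ action_ground_state ell p lam u,
           type_A ell p lam u
         & forall v : gfun R, action_ground_state ell p lam v ->
             eq_on_graph ell v u]) /\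
  (forall (nu : R) (u : gfun R), 0 < nu ->
     energy_ground_state ell p nu u -> positive_on_graph ell u ->
     (exists! lam : R, solution ell p lam u) /\
     (forall lam : R, solution ell p lam u ->
        0 < lam /\ action_ground_state ell p lam u)).
Proof.
split=> [lam lam0|nu u nu0 ugs upos]; first exact: action_ground_state_exists.
split.
  have [lam usol] := energy_ground_state_solution hp hell nu0 ugs.
  exists lam; split=> // lam' usol'.
  exact: (solution_lam_unique hp hell upos).
move=> lam usol; split; first exact: (positive_solution_lam_gt0 hp hell usol upos).
apply: (least_actionP usol upos) => v vsol vn0.
exact: (energy_ground_state_action_le hp hell nu0 ugs vsol vn0).
Qed.
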